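(* Let $0<\alpha_1<\alpha_2\le 1$, $K>0$, $\mu>0$ and $\eta>0$. Let $\Pi$ be an OPT prior with split probabilities $p_{lk}=\Gamma^{-l}$, $l\ge0$, $0\le k<2^l$, and parameter $a>0$, with $\Gamma$ large enough. Let $\hat f_{\mathcal{T}^*}$ be the median tree estimator, $\sigma_n=v_n\sqrt{\frac{\log n}{n}}\,2^{d(\mathcal{T}^* )/2}$ and $$\mathcal{C}_n=\{f:\ \|f-\hat f_{\mathcal{T}^*}\|_\infty\le\sigma_n\},$$ where $v_n/\log^{1/2}n\to\infty$. Then, uniformly on $f_0\in\mathcal{S}(\alpha,K,\eta)\cap\mathcal{F}(\alpha,K,\mu)$, $\alpha\in[\alpha_1,\alpha_2]$, $$|\mathcal{C}_n|_\infty=O_{P_0}\left(v_n\Big(\frac{\log n}{n}\Big)^{\alpha/(2\alpha+1)}\right)$$ and $$P_0[f_0\in\mathcal{C}_n]=1+o(1),\qquad \Pi[\mathcal{C}_n\,|\,X]=1+o_{P_0}(1).$$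
   Context: Model: one observes $X=(X_1,\dots,X_n)$. In the Bayesian model $f\sim\Pi$ and, given $f$, $X_1,\dots,X_n$ are i.i.d. with density $f$ on $[0,1)$; $\Pi[\cdot\,|\,X]$ is the posterior distribution (on pairs $(f,\mathcal{T})$). It is studied under the assumption that the $X_i$ are i.i.d. from the law with density $f_0$; $P_0$ denotes the corresponding law of the data. Classes: $\Sigma(\alpha,K)=\{f:[0,1)\to\mathbb{R},\ \sup_{x\ne y}|f(x)-f(y)|/|x-y|^\alpha\le K\}$ and $\mathcal{F}(\alpha,K,\mu)=\{f\ge\mu,\ \int_0^1 f=1,\ f\in\Sigma(\alpha,K)\}$. Haar basis: $\phi=\mathbf 1_{[0,1)}$, $\psi=\mathbf 1_{[1/2,1)}-\mathbf 1_{[0,1/2)}$, $\psi_{lk}=2^{l/2}\psi(2^l\cdot-k)$, $l\ge0$, $0\le k<2^l$. Self-similarity: fix an integer $j_0>0$. For $\alpha\in(0,1]$, $\mathcal{S}(\alpha,K,\eta)$ is the set of $f\in\Sigma(\alpha,K)$ such that $\|K_j(f)-f\|_\infty\ge\eta2^{-j\alpha}$ for all $j\ge j_0$, where $K_j(f)=\langle f,\phi\rangle\phi+\sum_{l<j}\sum_k\langle f,\psi_{lk}\rangle\psi_{lk}$. Trees: a full binary tree is a set $\mathcal{T}$ of nodes $(l,k)$, $l\ge 0$, $0\le k\le 2^l-1$, such that if $(l,k)\in\mathcal{T}$ and $l>0$ then $(l-1,\lfloor k/2\rfloor)\in\mathcal{T}$ (the parent) and $(l,k+(-1)^k)\in\mathcal{T}$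 (the sibling). The root is $(0,0)$; $\mathcal{T}_{\rm ext}$ is the set of nodes without children and $\mathcal{T}_{\rm int}=\mathcal{T}\setminus\mathcal{T}_{\rm ext}$; the depth is $d(\mathcal{T})=\max_{(l,k)\in\mathcal{T}}l$. Let $L_{\max}=\lfloor\log_2(n/\log^2 n)\rfloor$. Dyadic notation: $I_{lk}=[k2^{-l},(k+1)2^{-l})$; $(l,k)$ is identified with the binary word $\epsilon=\epsilon_1\cdots\epsilon_l$ with $k2^{-l}=\sum_{i=1}^l\epsilon_i2^{-i}$, and $\epsilon^{[i]}=\epsilon_1\cdots\epsilon_i$. $N_X(I)$ is the number of observations $X_i$ in $I$. Prior: the OPT prior with split probabilities $(p_{lk})$ and parameter $a>0$ is the law of $f$ generated as follows. (1) $\mathcal{T}\sim\mathrm{GW}(p)$: starting from the root, each node $(l,k)$ present with $l<L_{\max}$ independently is given the two children $(l+1,2k),(l+1,2k+1)$ with probability $p_{lk}$ and is a leaf with probability $1-p_{lk}$; nodes at level $L_{\max}$ are never split. (2) Given $\mathcal{T}$, $f=\sum_{(l,k)\in\mathcal{T}_{\rm ext}}h_{lk}\mathbf 1_{I_{lk}}$ with $h_{lk}=2^l\prod_{i=1}^lY_{\epsilon^{[i]}}$, where $\epsilon$ is the word of $(l,k)$, the $Y_{\epsilon0}$ (over all finite binary words $\epsilon$) are independent $\mathrm{Beta}(a,a)$ and $Y_{\epsilon1}=1-Y_{\epsilon0}$. Median tree: $\mathcal{T}^*$ is the full binary tree with interior nodes $\mathcal{T}^*_{\rm int}=\{(l,k):\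 \Pi[(l,k)\in\mathcal{T}_{\rm int}\,|\,X]>1/2\}$. The median tree estimator is $$\hat f_{\mathcal{T}^*}=1+\sum_{(l,k)\in\mathcal{T}^*_{\rm int}}2^{l/2}\,\frac{N_X(I_{l+1,2k+1})-N_X(I_{l+1,2k})}{n}\,\psi_{lk}.$$ $|\mathcal{C}|_\infty=\sup_{f,g\in\mathcal{C}}\|f-g\|_\infty$ denotes the supremum-norm diameter. *)

(* Defs.v *)
From HB Require Import structures.
From mathcomp Require Import all_boot all_order all_algebra finmap.
From mathcomp Require Import all_classical all_reals all_analysis.
From mathcomp Require Import zify.

Set Implicit Arguments.
Unset Strict Implicit.
Unset Printing Implicit Defensive.

Import Order.TTheory GRing.Theory Num.Theory.
Import numFieldNormedType.Exports.

Local Open Scope classical_set_scope.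
Local Open Scope ring_scope.

(* Functions on [0,1) are represented by total functions R -> R whose values
   outside [0,1) are never read. *)

Section function_classes.
Context {R : realType}.
Implicit Types f g : R -> R.

Definition unit_itv : set R := [set` `[0, 1[].

Definition sup_dist f g : \bar R :=
  ereal_sup [set (`|f x - g x|)%:E | x in unit_itv].

Definition sup_diameter (C : set (R -> R)) : \bar R :=
  ereal_sup [set sup_dist fg.1 fg.2 | fg in C `*` C].

Definition holder_ball (alpha K : R) : set (R -> R) :=
  [set f | forall x y, unit_itv x -> unit_itv y -> x != y ->
    `|f x - f y| / `|x - y| `^ alpha <= K].

Definition density_class (alpha K mu : R) : set (R -> R) :=
  [set f | [/\ forall x, unit_itv x -> mu <= f x,
               (\int[lebesgue_measure]_(x in unit_itv) (f x)%:E = 1)%E &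
               holder_ball alpha K f]].

Definition inner f g : R := \int[lebesgue_measure]_(x in unit_itv) (f x * g x).

Definition haar_father (x : R) : R := (x \in `[0, 1[)%:R.

Definition haar_mother (x : R) : R :=
  (x \in `[1/2, 1[)%:R - (x \in `[0, 1/2[)%:R.

Definition haar (l k : nat) (x : R) : R :=
  2 `^ (l%:R / 2) * haar_mother (2 ^+ l * x - k%:R).

Definition haar_proj (j : nat) f (x : R) : R :=
  inner f haar_father * haar_father x +
  \sum_(l < j) \sum_(k < 2 ^ l) inner f (haar l k) * haar l k x.

Definition self_similar (j0 : nat) (alpha K eta : R) : set (R -> R) :=
  [set f | holder_ball alpha K f /\
    forall j, (j0 <= j)%N ->
      ((eta * 2 `^ (- (j%:R * alpha)))%:E <= sup_dist (haar_proj j f) f)%E].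

End function_classes.

Section trees.
Local Open Scope nat_scope.

Definition node := (nat * nat)%type.

Definition tree := {fset node}.

Definition nodes (L : nat) : tree :=
  [fset v in [seq (l, k) | l <- iota 0 L.+1, k <- iota 0 (2 ^ l)]]%fset.

Definition parent (v : node) : node := (v.1.-1, v.2 %/ 2).

Definition sibling (v : node) : node :=
  (v.1, if odd v.2 then v.2.-1 else v.2.+1).

Definition children (v : node) : seq node :=
  [:: (v.1.+1, 2 * v.2); (v.1.+1, (2 * v.2).+1)].

Definition full_tree (T : tree) : Prop :=
  [/\ (0, 0) \in T,
      forall v, v \in T -> (v.2 < 2 ^ v.1)%N &
      forall v, v \in T -> (0 < v.1)%N -> (parent v \in T) && (sibling v \in T)].

Definition tree_ext (T : tree) : tree :=
  [fset v in T | ~~ has [in T] (children v)]%fset.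

Definition tree_int (T : tree) : tree := (T `\` tree_ext T)%fset.

Definition depth (T : tree) : nat := \max_(v <- T) v.1.

(* The full binary tree with a prescribed (parent-closed) set of interior
   nodes; see [tree_of_intK]. *)
Definition tree_of_int (I : tree) : tree :=
  ((0%N, 0%N) |` [fset v in flatten [seq children u | u <- I]])%fset.

Definition ancestor (v : node) (i : nat) : node := (i, v.2 %/ 2 ^ (v.1 - i)).

(* The tree grown from the split decisions: a node of level at most L is
   present iff all its strict ancestors were split. *)
Definition grow_tree (L : nat) (split : node -> bool) : tree :=
  [fset v in nodes L | all (fun i => split (ancestor v i)) (iota 0 v.1)]%fset.

(* The binary word eps_1 ... eps_l of (l,k): eps_i is the i-th most significant
   of the l binary digits of k. *)
Definition word_of (v : node) : seq bool :=
  [seq odd (v.2 %/ 2 ^ (v.1 - i)) | i <- iota 1 v.1].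

Lemma mem_nodes L v : (v \in nodes L) = (v.1 <= L)%N && (v.2 < 2 ^ v.1)%N.
Proof.
have -> : (v \in nodes L) =
    (v \in [seq (l, k) | l <- iota 0 L.+1, k <- iota 0 (2 ^ l)]).
  by rewrite /nodes in_fset.
case: v => l k; apply/allpairsPdep/idP => [[l0 [k0 []]]|/andP[/= lL kl]].
  by rewrite !mem_iota !add0n => /= l0L k0l [-> ->]; rewrite -ltnS l0L.
by exists l, k; split; rewrite // -?[_ :: _]/(iota 0 L.+1) mem_iota.
Qed.

Lemma mem_tree_int T v :
  (v \in tree_int T) = (v \in T) && has [in T] (children v).
Proof.
rewrite in_fsetD andbC; case vT: (v \in T) => //=.
by rewrite in_fset [in_mem _ _]/= inE vT negbK.
Qed.

Lemma mem_tree_of_int I v : (v \in tree_of_int I) =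
  (v == (0, 0)%N) || (0 < v.1)%N && (parent v \in I).
Proof.
rewrite !inE; congr (_ || _).
case: v => l k; rewrite /parent /=.
apply/flatten_mapP/andP => [[[l' k'] uI]|[l0 pI]].
  rewrite !inE => /orP[] /eqP[-> ->] /=; split => //;
    by rewrite (_ : _ %/ 2 = k') //; lia.
exists (l.-1, k %/ 2) => //; rewrite !inE /= prednK // !xpair_eqE eqxx /=.
lia.
Qed.

Lemma full_tree_of_int (I : tree) :
  (forall v, v \in I -> (v.2 < 2 ^ v.1)%N) ->
  (forall v, v \in I -> (0 < v.1)%N -> parent v \in I) ->
  full_tree (tree_of_int I).
Proof.
move=> Ilt Ipar; split.
- by rewrite mem_tree_of_int eqxx.
- move=> [l k]; rewrite mem_tree_of_int => /orP[/eqP[-> ->]//|/andP[]].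
  case: l => // l _ /Ilt /=; rewrite expnS; lia.
- move=> [l k]; rewrite mem_tree_of_int => /orP[/eqP[-> ->]//|/andP[]].
  case: l => // l _ pI _; apply/andP; split; rewrite mem_tree_of_int.
    case: l pI => [|l] pI; last by rewrite Ipar ?orbT.
    by have := Ilt _ pI; rewrite /parent /= => ?; apply/orP; left; apply/eqP; congr pair; lia.
  apply/orP; right => /=; move: pI; rewrite /parent /sibling /=.
  suff -> : (if odd k then k.-1 else k.+1) %/ 2 = k %/ 2 by [].
  by case: ifP => ?; lia.
Qed.

Lemma tree_of_intK (I : tree) :
  (forall v, v \in I -> (v.2 < 2 ^ v.1)%N) ->
  (forall v, v \in I -> (0 < v.1)%N -> parent v \in I) ->
  tree_int (tree_of_int I) = I.
Proof.
move=> Ilt Ipar; apply/fsetP => -[l k].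
have chE : has [in tree_of_int I] (children (l, k)) = ((l, k) \in I).
  rewrite /= orbF !mem_tree_of_int /parent /=.
  have -> : (2 * k) %/ 2 = k by lia.
  have -> : (2 * k).+1 %/ 2 = k by lia.
  exact: orbb.
rewrite mem_tree_int chE; case: (boolP ((l, k) \in I)) => lkI; rewrite ?andbF //.
rewrite andbT mem_tree_of_int.
case: l lkI {chE} => [|l] lkI; last by rewrite Ipar ?orbT.
have := Ilt _ lkI; rewrite /= => ?; apply/orP; left; apply/eqP; congr pair; lia.
Qed.

Lemma full_grow_tree L split : full_tree (grow_tree L split).
Proof.
have memE v : (v \in grow_tree L split) =
  [&& v.1 <= L, v.2 < 2 ^ v.1 &
      all (fun i => split (ancestor v i)) (iota 0 v.1)]%N.
  by rewrite in_fset /= inE mem_nodes andbA.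
split; first by rewrite memE.
  by move=> v; rewrite memE => /and3P[].
move=> [[|l] k]; rewrite memE => /and3P[] //= lL kl /andP[s0 sl] _.
have {s0 sl}sE i : (i <= l)%N -> split (i, k %/ 2 ^ (l.+1 - i)).
  case: i => [//|i] il; move/allP: sl => /(_ i.+1); apply.
  by rewrite mem_iota; lia.
have halfE i : (i < l.+1)%N -> k %/ 2 ^ (l.+1 - i) = k %/ 2 %/ 2 ^ (l - i).
  by move=> il; rewrite -divnMA -expnS subSn.
have klt : (k %/ 2 < 2 ^ l)%N by move: kl; rewrite expnS; lia.
have sibE : (if odd k then k.-1 else k.+1) %/ 2 = k %/ 2 by case: ifP => ?; lia.
apply/andP; split; rewrite memE /parent /sibling /=.
  rewrite (ltnW lL) klt /=; apply/allP => i; rewrite mem_iota add0n => /= il.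
  by rewrite /ancestor /= -halfE ?sE //; lia.
rewrite lL /=; apply/andP; split.
  by move: klt; rewrite -{1}sibE expnS; lia.
apply/(@allP _ _ (iota 0 l.+1)) => i; rewrite mem_iota add0n => /= il.
rewrite /ancestor /= subSn // expnS divnMA sibE -divnMA -expnS -subSn //.
by apply: sE.
Qed.

End trees.

Section opt_model.
Context {R : realType}.

Definition dyadic (v : node) : interval R :=
  `[v.2%:R / 2 ^+ v.1, v.2.+1%:R / 2 ^+ v.1[.

(* The argument of [truncn] is nonnegative for n >= 2, so this is its floor. *)
Definition level_max (n : nat) : nat :=
  Num.truncn (ln (n%:R / ln n%:R ^+ 2) / ln 2 : R).

(* Joint independence of sigma-algebras: product rule on finite subfamilies. *)
Definition mutual_independence {d} {Om : measurableType d}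
    (Q : probability Om R) (I : choiceType) (G : I -> set (set Om)) : Prop :=
  forall (J : {fset I}) (E : I -> set Om), (forall i, i \in J -> G i (E i)) ->
    (Q (\bigcap_(i in [set` J]) E i) = \prod_(i <- J) Q (E i))%E.

Definition beta_weight (a b x : R) : R := x `^ (a - 1) * (1 - x) `^ (b - 1).

Definition beta_law (a b : R) (A : set R) : \bar R :=
  (\int[lebesgue_measure]_(x in A `&` [set` `]0%R, 1%R[])
     (beta_weight a b x /
      \int[lebesgue_measure]_(y in [set` `]0%R, 1%R[]) beta_weight a b y)%:E)%E.

(* [S v] is the decision to split the node [v], and [Y eps] is the variable
   attached to the word [eps]; nodes with 2 ^ l <= k and the empty word are
   never read.  The same families serve all sample sizes. *)
Definition opt_variables {d} {Om : measurableType d} (Q : probability Om R)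
    (p : node -> R) (a : R)
    (S : node -> {RV Q >-> bool}) (Y : seq bool -> {RV Q >-> R}) : Prop :=
  [/\ forall v, Q (S v @^-1` [set true]) = (p v)%:E,
      forall eps (A : set R), measurable A ->
        Q (Y (rcons eps false) @^-1` A) = beta_law a a A,
      forall eps w, Y (rcons eps true) w = 1 - Y (rcons eps false) w &
      mutual_independence Q (fun i : node + seq bool =>
        match i with
        | inl v => preimage_set_system setT (S v) measurable
        | inr eps => preimage_set_system setT (Y (rcons eps false)) measurable
        end)].

Definition opt_height (Y : seq bool -> R) (v : node) : R :=
  2 ^+ v.1 * \prod_(1 <= i < v.1.+1) Y (take i (word_of v)).

Definition opt_density (T : tree) (Y : seq bool -> R) (x : R) : R :=
  \sum_(v <- tree_ext T) opt_height Y v * (x \in dyadic v)%:R.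

Definition opt_draw {Om : Type} (L : nat) (S : node -> Om -> bool)
    (Y : seq bool -> Om -> R) (w : Om) : (R -> R) * tree :=
  let T := grow_tree L (S ^~ w) in (opt_density T (Y ^~ w), T).

Definition likelihood n (f : R -> R) (X : n.-tuple R) : R :=
  \prod_(i < n) f (tnth X i).

(* Bayes' formula for the prior law of the random pair [Z] under [Q]. *)
Definition posterior {d} {Om : measurableType d} (Q : probability Om R)
    (Z : Om -> (R -> R) * tree) n (X : n.-tuple R)
    (B : set ((R -> R) * tree)) : R :=
  (\int[Q]_(w in Z @^-1` B) likelihood (Z w).1 X) /
  (\int[Q]_w likelihood (Z w).1 X).

(* The law of n i.i.d. observations with density f on [0,1). *)
Definition sample_law n (f : R -> R)
    (P : probability (n.-tuple (measurableTypeR R)) R) : Prop :=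
  forall A : 'I_n -> set R, (forall i, measurable (A i)) ->
    (P [set X | forall i, A i (tnth X i)] =
     \prod_(i < n)
       \int[lebesgue_measure]_(x in A i `&` unit_itv) (f x)%:E)%E.

Definition nobs n (X : n.-tuple R) (v : node) : R :=
  (count [in dyadic v] X)%:R.

(* Posterior trees have no node beyond [level_max n], so restricting to
   [nodes (level_max n)] loses nothing. *)
Definition median_int n (post : set ((R -> R) * tree) -> R) : tree :=
  [fset v in nodes (level_max n) |
     2^-1 < post [set fT | v \in tree_int fT.2]]%fset.

Definition median_tree n (post : set ((R -> R) * tree) -> R) : tree :=
  tree_of_int (median_int n post).

Definition median_estimator n (X : n.-tuple R)
    (post : set ((R -> R) * tree) -> R) (x : R) : R :=
  1 + \sum_(v <- median_int n post)
        2 `^ (v.1%:R / 2) *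
        ((nobs X (v.1.+1, (2 * v.2).+1) - nobs X (v.1.+1, 2 * v.2)%N) / n%:R) *
        haar v.1 v.2 x.

Definition band_radius (v : nat -> R) n (post : set ((R -> R) * tree) -> R) : R :=
  v n * Num.sqrt (ln n%:R / n%:R) * 2 `^ ((depth (median_tree n post))%:R / 2).

Definition confidence_set (v : nat -> R) n (X : n.-tuple R)
    (post : set ((R -> R) * tree) -> R) : set (R -> R) :=
  [set f | (sup_dist f (median_estimator X post) <=
            (band_radius v n post)%:E)%E].

Definition opt_posterior {d} {Om : measurableType d} (Q : probability Om R)
    (S : node -> {RV Q >-> bool}) (Y : seq bool -> {RV Q >-> R})
    n (X : n.-tuple R) : set ((R -> R) * tree) -> R :=
  posterior Q (opt_draw (level_max n) (fun v w => S v w) (fun eps w => Y eps w))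
    X.

Definition opt_confidence_set {d} {Om : measurableType d}
    (Q : probability Om R)
    (S : node -> {RV Q >-> bool}) (Y : seq bool -> {RV Q >-> R})
    (v : nat -> R) n (X : n.-tuple R) : set (R -> R) :=
  confidence_set v X (opt_posterior S Y X).

(* The pairs (alpha, f0) over which the conclusions are uniform, together with
   the law P0 of the n observations under f0. *)
Definition true_law (j0 : nat) (alpha1 alpha2 K mu eta : R) n (alpha : R)
    (f0 : R -> R) (P0 : probability (n.-tuple (measurableTypeR R)) R) : Prop :=
  [/\ alpha1 <= alpha <= alpha2,
      self_similar j0 alpha K eta f0,
      density_class alpha K mu f0 &
      sample_law f0 P0].

Definition rate (n : nat) (alpha : R) : R :=
  (ln n%:R / n%:R) `^ (alpha / (2 * alpha + 1)).

End opt_model.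

(* Main.v *)
Require Import Defs.
From HB Require Import structures.
From mathcomp Require Import all_boot all_order all_algebra finmap.
From mathcomp Require Import all_classical all_reals all_analysis.
From mathcomp Require Import measurable_realfun.
From mathcomp Require Import zify ring lra.

Set Implicit Arguments.
Unset Strict Implicit.
Unset Printing Implicit Defensive.

Import Order.TTheory GRing.Theory Num.Theory.
Import numFieldNormedType.Exports.
Import HBNNSimple.

Local Open Scope classical_set_scope.
Local Open Scope ring_scope.

(** The posterior is analysed on a deterministic good event for the sample, on
    which the frequency of every dyadic cell up to the maximal level is as close
    to its probability as the noise at that level permits ([good_sample]); a
    Chernoff bound and a union bound give it probability tending to one,
    uniformly in the truth ([prob_not_good]).

    Since the likelihood of a piecewise constant density is a product over the
    split nodes ([likelihood_prod]), the posterior probability of a set of trees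
    is a ratio of sums of product weights, in which a split of v multiplies the
    weight by its prior odds and by an integrated Beta-binomial likelihood. Trees
    are compared by adding or removing one split whose children are leaves
    ([mass_leaf_le], [mass_cherry_le]). The likelihood gain of a split is, up to
    a power of n, the exponential of ln n times the squared empirical Haar
    coefficient in units of noise. Three consequences follow
    ([posterior_atypical]). With Gamma large, splits beyond the level m where
    bias and noise balance have negligible posterior probability
    ([mass_deep_le]). A node whose true Haar coefficient exceeds the noise by a
    large multiple of sqrt (ln n), a signal, is split: its gain
    exp (c (ln n)^2) pays even for prolonging a tree all the way from the root
    ([mass_nosplit_le]). Finally the split variables of a draw stay within the
    noise of the empirical splits, by a Hellinger bound for Bernoulli likelihoods
    ([bernoulli_lik_le]).

    Hence the median tree splits all signals and nothing beyond level m. By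
    self-similarity there is a signal at level J or beyond, where 2^J is smaller
    than 2^m by at most a power of ln n ([signal_exists], [signal_level]), so the
    depth of the median tree lies between J and m. The estimator and a typical
    draw are, along each branch, local averages stopped after the last signal;
    their bias is at most a multiple of sqrt (ln n) times the noise of level J
    ([bias_le]), and their stochastic error at most a multiple of the noise at
    the depth, respectively at level m, which again costs a factor sqrt (ln n).
    As v n exceeds every multiple of sqrt (ln n), the radius v n times the noise
    at the depth covers both the truth ([truth_in_band]) and the typical draws
    ([draw_in_band]), and as the depth is at most m, the radius is at most a
    multiple of v n times the minimax rate ([stop_noise_le_rate]). *)

(** * Expectations under mutual independence *)

Section independence.
Context {R : realType} {d} {Om : measurableType d} (Q : probability Om R).

(** Approximating F by simple functions reduces the product rule to the
    hypothesis, which covers only events that F generates; this suffices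
    because F enters linearly. *)
Lemma integral_indepM (F h : Om -> R) :
  measurable_fun setT F -> measurable_fun setT h ->
  (forall w, 0 <= F w) -> (forall w, 0 <= h w) ->
  (\int[Q]_w (h w)%:E < +oo)%E ->
  (forall B : set R, measurable B ->
    \int[Q]_(w in F @^-1` B) (h w)%:E = Q (F @^-1` B) * \int[Q]_w (h w)%:E)%E ->
  (\int[Q]_w (F w * h w)%:E = \int[Q]_w (F w)%:E * \int[Q]_w (h w)%:E)%E.
Proof.
move=> mF mh F0 h0 hoo FB.
have mid : measurable_fun [set: R] (fun x : R => (`|x| : R)%:E).
  by apply/measurable_EFinP; exact: normr_measurable.
pose g := nnsfun_approx measurableT mid.
have mg k : measurable_fun setT (fun w => g k (F w)).
  by apply: measurableT_comp => //; exact: measurable_funPT.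
have gcvg w : (fun k => (g k (F w))%:E) @ \oo --> (F w)%:E.
  rewrite -[in X in _ --> X](ger0_norm (F0 w)).
  exact: (@cvg_nnsfun_approx _ _ _ _ measurableT _ mid _ (F w)).
have gnd w : {homo (fun k => g k (F w)) : m n / (m <= n)%N >-> m <= n}.
  by move=> m n mn; exact/lefP/nd_nnsfun_approx.
have g0 k w : 0 <= g k (F w) by [].
have hfin : (\int[Q]_w (h w)%:E)%E \is a fin_num.
  by rewrite ge0_fin_numE// integral_ge0// => w _; rewrite lee_fin.
(* both sides agree for functions of F taking finitely many values *)
have stepM (u : Om -> R) k : measurable_fun setT u -> (forall w, 0 <= u w) ->
    (\int[Q]_w (g k (F w) * u w)%:E = \sum_(y \in range (g k))
       (y%:E * \int[Q]_(w in F @^-1` (g k @^-1` [set y])) (u w)%:E))%E.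
  move=> mu u0.
  have mpre y : measurable (F @^-1` (g k @^-1` [set y])).
    by rewrite -[X in measurable X]setTI; apply: mF => //; exact: measurable_funPTI.
  transitivity (\int[Q]_w \sum_(y \in range (g k))
      (y * (\1_(F @^-1` (g k @^-1` [set y])) w * u w))%:E)%E.
    apply: eq_integral => w _.
    rewrite fsbig_finite//= sumEFin; congr EFin.
    rewrite {1}(fimfunE (g k) (F w)) fsbig_finite//= mulr_suml.
    by apply: eq_bigr => y _; rewrite mulrA.
  rewrite ge0_integral_fsum//; last 2 first.
  - move=> y; apply/measurable_EFinP; apply: measurable_funM => //.
    by apply: measurable_funM.
  - move=> y w _; rewrite lee_fin; case: (ltP y 0) => [y0|y0]; last first.
      by rewrite mulr_ge0 // mulr_ge0.
    rewrite indicE memNset ?mul0r ?mulr0// => /= gy.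
    by have := g0 k w; rewrite gy leNgt y0.
  apply: eq_fsbigr => y; rewrite inE => -[x _ <-{y}].
  under eq_integral do rewrite EFinM.
  rewrite ge0_integralZl//; last 3 first.
  - by apply/measurable_EFinP; apply: measurable_funM.
  - by move=> w _; rewrite lee_fin mulr_ge0.
  - by rewrite lee_fin.
  congr (_ * _)%E; rewrite [RHS]integral_mkcond; apply: eq_integral => w _.
  by rewrite patchE indicE; case: ifP => _; rewrite ?mul1r ?mul0r.
have icvg (u : Om -> R) : measurable_fun setT u -> (forall w, 0 <= u w) ->
    (fun k => \int[Q]_w (g k (F w) * u w)%:E)%E @ \oo -->
    (\int[Q]_w (F w * u w)%:E)%E.
  move=> mu u0.
  have -> : (fun w => (F w * u w)%:E) =
      (fun w => limn (fun k => (g k (F w) * u w)%:E)).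
    apply/funext => w; apply/esym/cvg_lim => //.
    by under eq_fun do rewrite EFinM; rewrite EFinM; exact: cvgeZr.
  apply: cvg_monotone_convergence => //.
  - by move=> k; apply/measurable_EFinP; exact: measurable_funM.
  - by move=> k w _; rewrite lee_fin mulr_ge0.
  - by move=> w _ m n mn; rewrite lee_fin ler_wpM2r// gnd.
have lhs := icvg h mh h0.
have rhs : (fun k => \int[Q]_w (g k (F w))%:E)%E @ \oo -->
    (\int[Q]_w (F w)%:E)%E.
  have := icvg (fun=> 1) (measurable_cst _) (fun=> ler01).
  by under eq_integral do rewrite mulr1; under eq_fun do
    under eq_integral do rewrite mulr1.
have {}rhs := cvgeZr hfin rhs.
suff E : (fun k => \int[Q]_w (g k (F w) * h w)%:E)%E =
         (fun k => \int[Q]_w (g k (F w))%:E * \int[Q]_w (h w)%:E)%E.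
  by rewrite E in lhs; exact: (cvg_unique _ lhs rhs).
apply/funext => k; rewrite stepM//.
under [in RHS]eq_integral => w _ do rewrite -[g k (F w)]mulr1.
rewrite (stepM (fun=> 1))// !fsbig_finite//= ge0_sume_distrl => [|y _].
  apply: eq_bigr => y _; rewrite FB; last exact: measurable_funPTI.
  rewrite integral_cst; last first.
    by rewrite -[X in measurable X]setTI; apply: mF => //; exact: measurable_funPTI.
  by rewrite mul1e muleA.
case: (leP 0 y) => [y0|y0].
  by rewrite mule_ge0 ?lee_fin// integral_ge0// => w _; rewrite lee_fin.
rewrite (_ : F @^-1` _ = set0) ?integral_set0 ?mule0//.
rewrite -subset0 => w /= gy.
by have := g0 k w; rewrite gy leNgt y0.
Qed.

(** The expectation form of mutual independence.  Only finiteness of the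
    individual expectations is needed, and the induction trades one factor at
    a time for an event, because the hypothesis speaks of events only. *)
Lemma integral_indep_prod (I : choiceType) (G : I -> set (set Om))
    (J : {fset I}) (F : I -> Om -> R) :
  mutual_independence Q G ->
  (forall i, measurable_fun setT (F i)) ->
  (forall i w, 0 <= F i w) ->
  (forall i, i \in J -> \int[Q]_w (F i w)%:E < +oo)%E ->
  (forall i (B : set R), i \in J -> measurable B -> G i (F i @^-1` B)) ->
  (\int[Q]_w (\prod_(i <- J) F i w)%:E = \prod_(i <- J) \int[Q]_w (F i w)%:E)%E.
Proof.
move=> indG mF F0 Foo GF.
have Ffin i : i \in J -> (\int[Q]_w (F i w)%:E)%E \is a fin_num.
  by move=> iJ; rewrite ge0_fin_numE ?Foo// integral_ge0// => w _; rewrite lee_fin.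
have mFB i (B : set R) : measurable B -> measurable (F i @^-1` B).
  by move=> mB; rewrite -[X in measurable X]setTI; apply: mF.
(* K: the factors still integrated; B: the events already traded *)
suff H (s : seq I) : forall (J2 : {fset I}) (B : I -> set R), uniq s ->
    {subset s <= J} -> {subset J2 <= J} -> (forall i, i \in s -> i \notin J2) ->
    (forall i, measurable (B i)) ->
    (\int[Q]_(w in \bigcap_(i in [set` J2]) F i @^-1` B i) (\prod_(i <- s) F i w)%:E
     = \prod_(i <- J2) Q (F i @^-1` B i) * \prod_(i <- s) \int[Q]_w (F i w)%:E)%E.
  have := H J fset0 (fun=> setT); rewrite set_fset0 bigcap_set0 big_seq_fset0 mul1e.
  by apply => //; exact: fset_uniq.
elim: s => [|j s IH] J2 B.
  move=> _ _ J2J _ mB; rewrite big_nil mule1.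
  under eq_integral do rewrite big_nil.
  rewrite integral_cst ?mul1e; last first.
    by apply: fin_bigcap_measurable => // i _; exact: mFB.
  by apply: indG => i iJ2; apply: GF; [exact: J2J|exact: mB].
move=> /= /andP[js us] sJ J2J sJ2 mB.
set A := \bigcap_(i in _) _.
have mA : measurable A by apply: fin_bigcap_measurable => // i _; exact: mFB.
pose h w := \1_A w * \prod_(i <- s) F i w.
have mprod : measurable_fun setT (fun w => \prod_(i <- s) F i w).
  exact: measurable_prod.
have mh : measurable_fun setT h by exact: measurable_funM.
have prod0 w : 0 <= \prod_(i <- s) F i w by rewrite prodr_ge0.
have h0 w : 0 <= h w by rewrite mulr_ge0.
have hI (C : set Om) : measurable C ->
    (\int[Q]_(w in C) (h w)%:E = \int[Q]_(w in C `&` A) (\prod_(i <- s) F i w)%:E)%E.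
  move=> mC; rewrite [RHS]integral_mkcondr; apply: eq_integral => w _.
  by rewrite patchE /h indicE; case: ifP => _; rewrite ?mul1r ?mul0r.
have hE : (\int[Q]_w (h w)%:E =
    \prod_(i <- J2) Q (F i @^-1` B i) * \prod_(i <- s) \int[Q]_w (F i w)%:E)%E.
  rewrite hI// setTI IH// => i si; first by apply: sJ; rewrite inE si orbT.
  by apply: sJ2; rewrite inE si orbT.
have hoo : (\int[Q]_w (h w)%:E < +oo)%E.
  rewrite hE ltey_eq fin_numM//.
    by rewrite prode_fin_num// => i _; apply: fin_num_measure; exact: mFB.
  rewrite big_seq; apply: prode_fin_num => i si.
  by apply: Ffin; apply: sJ; rewrite inE si orbT.
have jJ2 : j \notin J2 by apply: sJ2; rewrite inE eqxx.
transitivity (\int[Q]_w (F j w * h w)%:E)%E.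
  rewrite integral_mkcond; apply: eq_integral => w _; rewrite patchE /h indicE.
  by case: ifP => _; rewrite ?mul1r ?big_cons ?mul0r ?mulr0.
rewrite integral_indepM//.
  by rewrite hE big_cons muleCA.
move=> C mC; rewrite hI; last exact: mFB.
pose B' i := if i == j then C else B i.
have -> : F j @^-1` C `&` A = \bigcap_(i in [set` (j |` J2)%fset]) F i @^-1` B' i.
  rewrite set_fsetU set_fset1 bigcap_setU bigcap_set1 /B' eqxx; congr (_ `&` _).
  apply: eq_bigcapr => i /= iJ2.
  by case: eqP => // ij; move: iJ2; rewrite ij (negbTE jJ2).
rewrite IH//; last 4 first.
- by move=> i si; apply: sJ; rewrite inE si orbT.
- by move=> i; rewrite !inE => /orP[/eqP->|/J2J//]; apply: sJ; rewrite inE eqxx.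
- move=> i si; rewrite !inE negb_or sJ2 ?inE ?si ?orbT// andbT.
  by apply: contraNneq js => <-.
- by move=> i; rewrite /B'; case: ifP.
rewrite big_fsetU1//= hE /B' eqxx muleA; congr (_ * _ * _)%E.
rewrite big_seq [RHS]big_seq; apply: eq_bigr => i iJ2.
by case: eqP => // ij; move: iJ2; rewrite ij (negbTE jJ2).
Qed.

End independence.

(** * Dyadic cells and binary trees *)

Section dyadic_cells.
Context {R : realType}.
Implicit Types x y : R.

Definition cell (x : R) (l : nat) : nat := Num.truncn (2 ^+ l * x).

(** The nodes [node_at x l], for l = 0, 1, ..., are the branch of x:
    statements about functions on trees become statements about one sequence
    of levels. *)
Definition node_at (x : R) (l : nat) : node := (l, cell x l).

Lemma mem_dyadic x (v : node) : 0 <= x ->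
  (x \in dyadic v) = (v.2 == cell x v.1).
Proof.
move=> x0; have p0 : (0 : R) < 2 ^+ v.1 by rewrite exprn_gt0.
rewrite /dyadic in_itv /= ler_pdivrMr// ltr_pdivlMr//.
have y0 : 0 <= 2 ^+ v.1 * x by rewrite mulr_ge0// ltW.
by rewrite eq_sym /cell truncn_eq// (mulrC x).
Qed.

Lemma unit_itv_ge0 x : unit_itv x -> 0 <= x.
Proof. by rewrite /unit_itv /= in_itv/= => /andP[]. Qed.

Lemma cell_lt x l : unit_itv x -> (cell x l < 2 ^ l)%N.
Proof.
rewrite /unit_itv /= in_itv /= => /andP[x0 x1].
rewrite -(ltr_nat R) (le_lt_trans (_ : _ <= 2 ^+ l * x))//.
  by rewrite /cell truncn_le// mulr_ge0// exprn_ge0.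
by rewrite natrX gtr_pMr// exprn_gt0.
Qed.

Lemma node_at_dyadic x l : 0 <= x -> x \in dyadic (node_at x l).
Proof. by move=> x0; rewrite mem_dyadic. Qed.

Lemma cellS x l : 0 <= x -> (cell x l.+1 %/ 2 = cell x l)%N.
Proof.
move=> x0; apply/esym/truncn_def.
have y0 : 0 <= 2 ^+ l.+1 * x by rewrite mulr_ge0// exprn_ge0.
have /andP[h1 h2] := truncn_itv y0; rewrite -/(cell _ _) in h1 h2.
have hE : 2 ^+ l * x = (2 ^+ l.+1 * x) / 2 by rewrite exprS; field.
have a1 : ((cell x l.+1 %/ 2 * 2)%N%:R : R) <= (cell x l.+1)%:R.
  by rewrite ler_nat leq_divM.
have a2 : ((cell x l.+1).+1%:R : R) <= ((cell x l.+1 %/ 2).+1 * 2)%N%:R.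
  by rewrite ler_nat; lia.
rewrite hE ler_pdivlMr// ltr_pdivrMr//; apply/andP; split.
  by rewrite natrM in a1; exact: le_trans a1 h1.
by rewrite natrM in a2; exact: lt_le_trans h2 a2.
Qed.

Lemma cell_ancestor x l i : 0 <= x -> (i <= l)%N ->
  (cell x l %/ 2 ^ (l - i) = cell x i)%N.
Proof.
move=> x0; elim: l => [|l IH]; first by rewrite leqn0 => /eqP->; rewrite divn1.
rewrite leq_eqVlt ltnS => /orP[/eqP->|il]; first by rewrite subnn divn1.
by rewrite subSn// expnS divnMA cellS// IH.
Qed.

Lemma ancestor_node_at x l i : 0 <= x -> (i <= l)%N ->
  ancestor (node_at x l) i = node_at x i.
Proof. by move=> x0 il; rewrite /ancestor /= cell_ancestor. Qed.

(** A representative of each cell, for evaluating functions that are constant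
    on cells. *)
Definition lpoint (v : node) : R := v.2%:R / 2 ^+ v.1.

Lemma lpoint_dyadic v : lpoint v \in dyadic v.
Proof.
by rewrite /dyadic in_itv /= /lpoint lexx /= ltr_pM2r ?invr_gt0 ?exprn_gt0// ltr_nat.
Qed.

Lemma dyadic_unit v x : (v.2 < 2 ^ v.1)%N -> x \in dyadic v -> unit_itv x.
Proof.
move=> vlt; rewrite /dyadic /unit_itv /= !in_itv /= => /andP[h1 h2].
rewrite (le_trans _ h1) ?divr_ge0 ?exprn_ge0//=.
apply: lt_le_trans h2 _.
by rewrite ler_pdivrMr ?exprn_gt0// mul1r -natrX ler_nat.
Qed.

End dyadic_cells.

Section words_and_children.
Local Open Scope nat_scope.

Definition child (v : node) (b : bool) : node :=
  (v.1.+1, if b then (2 * v.2).+1 else 2 * v.2).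

Lemma childrenE v : children v = [:: child v false; child v true].
Proof. by []. Qed.

Lemma ancestor_id v : ancestor v v.1 = v.
Proof. by case: v => l k; rewrite /ancestor /= subnn divn1. Qed.

Lemma ancestorA v i j : i <= j <= v.1 -> ancestor (ancestor v j) i = ancestor v i.
Proof.
move=> /andP[ij jv]; rewrite /ancestor /= -divnMA -expnD.
by congr (_, _ %/ 2 ^ _); lia.
Qed.

Lemma ancestor_lt v i : v.2 < 2 ^ v.1 -> i <= v.1 ->
  (ancestor v i).2 < 2 ^ (ancestor v i).1.
Proof.
by move=> h iv; rewrite /ancestor /= ltn_divLR ?expn_gt0// -expnD subnKC.
Qed.

Lemma ancestor_child v b i : i <= v.1 -> ancestor (child v b) i = ancestor v i.
Proof.
move=> iv; rewrite /ancestor /= subSn// expnS divnMA; congr (_, _ %/ _).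
by case: b; lia.
Qed.

Lemma parent_child v b : parent (child v b) = v.
Proof. by case: v b => l k [] /=; rewrite /parent /=; congr (_, _); lia. Qed.

Lemma child_lt v b : v.2 < 2 ^ v.1 -> (child v b).2 < 2 ^ (child v b).1.
Proof. by rewrite /= expnS; case: b; lia. Qed.

Lemma size_word_of v : size (word_of v) = v.1.
Proof. by rewrite size_map size_iota. Qed.

Lemma word_of_child v b : word_of (child v b) = rcons (word_of v) b.
Proof.
case: v => l k; rewrite /word_of /child [(_, _).1]/= [(_, _).2]/=.
have -> : iota 1 l.+1 = rcons (iota 1 l) l.+1 by rewrite -cats1 -[[:: l.+1]]/(iota (1 + l) 1) -iotaD addn1.
rewrite map_rcons; congr rcons; last first.
  by rewrite subnn divn1; case: b; rewrite /= ?oddM.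
apply/eq_in_map => i; rewrite mem_iota => /andP[i1 il].
rewrite subSn; last lia.
rewrite expnS divnMA; congr (odd (_ %/ _)); case: b => /=; lia.
Qed.

Lemma take_word_of v i : i <= v.1 -> take i (word_of v) = word_of (ancestor v i).
Proof.
case: v => l k /= il; rewrite /word_of -map_take take_iota /=.
rewrite (minn_idPl il); apply/eq_in_map => j; rewrite mem_iota => /andP[j1 ji].
by rewrite -divnMA -expnD; congr (odd (_ %/ 2 ^ _)); lia.
Qed.

Lemma node_child v : 0 < v.1 -> v = child (parent v) (odd v.2).
Proof.
case: v => [[//|l] k] _; rewrite /child /parent /=; congr (_, _).
by case: ifP; lia.
Qed.

Lemma word_of_inj v w : v.2 < 2 ^ v.1 -> w.2 < 2 ^ w.1 ->
  word_of v = word_of w -> v = w.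
Proof.
move=> vl wl E; have := congr1 size E; rewrite !size_word_of => l12.
case: v w vl wl l12 E => [l k] [l' k'] /= + + ll; rewrite -{}ll {l'}.
elim: l k k' => [|l IH] k k' kl kl' E; first by congr (_, _); lia.
rewrite (@node_child (l.+1, k))// (@node_child (l.+1, k'))// in E *.
move: E; rewrite !word_of_child => /rcons_inj[E <-].
rewrite expnS in kl kl'.
have h1 : k %/ 2 < 2 ^ l by lia.
have h2 : k' %/ 2 < 2 ^ l by lia.
by have [] := IH _ _ h1 h2 E; rewrite /parent /= => ->.
Qed.

End words_and_children.

Section grown_trees.
Variables (L : nat) (s : node -> bool).

(** Only the decisions at the node and at its ancestors matter, so a split
    pattern is read from the decisions without building the tree. *)
Definition splits (v : node) : bool :=
  [&& (v.1 < L)%N, (v.2 < 2 ^ v.1)%N & all (fun i => s (ancestor v i)) (iota 0 v.1.+1)].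

Definition present (v : node) : bool :=
  [&& (v.1 <= L)%N, (v.2 < 2 ^ v.1)%N & all (fun i => s (ancestor v i)) (iota 0 v.1)].

Lemma mem_grow_tree v : (v \in grow_tree L s) = present v.
Proof. by rewrite /present in_fset /= inE mem_nodes andbA. Qed.

Lemma splitsE v : splits v = [&& (v.1 < L)%N, present v & s v].
Proof.
rewrite /splits /present -[X in iota 0 X]addn1 iotaD all_cat /= add0n ancestor_id.
by rewrite andbT; case: ltnP => //= /ltnW->; rewrite andbA.
Qed.

Lemma present_child v b : present (child v b) = splits v.
Proof.
rewrite /present /splits.
have -> : all (fun i => s (ancestor (child v b) i)) (iota 0 (child v b).1) =
  all (fun i => s (ancestor v i)) (iota 0 v.1.+1).
  by apply: eq_in_all => i; rewrite mem_iota add0n => /= il; rewrite ancestor_child.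
by congr [&& _, _ & _]; rewrite /= expnS; case: b; lia.
Qed.

Lemma mem_tree_int_grow v : (v \in tree_int (grow_tree L s)) = splits v.
Proof.
rewrite mem_tree_int childrenE /= orbF.
rewrite [in_mem _ _]mem_grow_tree [X in _ && (X || _)]mem_grow_tree.
rewrite [X in _ && (_ || X)]mem_grow_tree !present_child orbb splitsE.
by case: present; rewrite ?andbF.
Qed.

Lemma mem_tree_ext_grow v :
  (v \in tree_ext (grow_tree L s)) = present v && ~~ splits v.
Proof.
rewrite -mem_grow_tree -mem_tree_int_grow in_fsetD negb_and negbK.
by case: (boolP (v \in grow_tree L s)) => vT; rewrite ?orbF// in_fset /= inE (negbTE vT).
Qed.

Lemma splits_ancestor v i : (i <= v.1)%N -> splits v -> splits (ancestor v i).
Proof.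
move=> iv /and3P[vL v2 /allP sv]; apply/and3P; split.
- exact: leq_ltn_trans vL.
- exact: ancestor_lt.
- apply/allP => j; rewrite mem_iota add0n /= => ji.
  by rewrite ancestorA ?(leq_trans _ iv) ?iv ?andbT// sv// mem_iota /=; lia.
Qed.

End grown_trees.

(** The first level at which P fails along the branch of x; closure under
    ancestors excludes later exceptions. Interior nodes of a random tree and
    of the median tree both have this shape. *)
Lemma branch_length {R : realType} (P : node -> bool) (L : nat) (x : R) :
  0 <= x ->
  (forall v, P v -> (v.1 < L)%N) ->
  (forall v i, (i <= v.1)%N -> P v -> P (ancestor v i)) ->
  exists2 m, (m <= L)%N & forall l, P (node_at x l) = (l < m)%N.
Proof.
move=> x0 PL Pa; have ex : exists m, ~~ P (node_at x m).
  by exists L; apply/negP => /PL /=; rewrite ltnn.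
exists (ex_minn ex); case: ex_minnP => m mP mmin.
  by apply: mmin; apply/negP => /PL /=; rewrite ltnn.
move=> l; apply/idP/idP => [Pl|lm].
  rewrite ltnNge; apply: contra mP => ml.
  by rewrite -(ancestor_node_at x0 ml); exact: Pa.
by apply/negPn/negP => /mmin; rewrite leqNgt lm.
Qed.

Section density_along_branch.
Context {R : realType}.
Variables (L : nat) (s : node -> bool) (Y : seq bool -> R).

Lemma splits_branch (x : R) : 0 <= x ->
  exists2 m, (m <= L)%N & forall l, splits L s (node_at x l) = (l < m)%N.
Proof.
move=> x0; apply: branch_length => // [v /and3P[]//|v i iv].
exact: splits_ancestor.
Qed.

Lemma present_node_at (x : R) m : unit_itv x -> (m <= L)%N ->
  (forall l, splits L s (node_at x l) = (l < m)%N) ->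
  forall l, present L s (node_at x l) = (l <= m)%N.
Proof.
move=> xu mL sm [|l].
  by rewrite /present /= cell_lt.
have x0 := unit_itv_ge0 xu.
rewrite (_ : node_at x l.+1 = child (node_at x l) (odd (cell x l.+1))).
  by rewrite present_child sm.
by rewrite {1}(@node_child (node_at x l.+1))// /parent /= cellS.
Qed.

(** The leaf that contains x ends the branch of x, and the powers of 2 in its
    height can be shared among the split variables met on the way. *)
Lemma opt_density_path (x : R) m : unit_itv x -> (m <= L)%N ->
  (forall l, splits L s (node_at x l) = (l < m)%N) ->
  opt_density (grow_tree L s) Y x =
  \prod_(i < m) (2 * Y (word_of (node_at x i.+1))).
Proof.
move=> xu mL sm; have x0 := unit_itv_ge0 xu.
have pm := present_node_at xu mL sm.
have mE : node_at x m \in tree_ext (grow_tree L s).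
  by rewrite mem_tree_ext_grow pm sm leqnn ltnn.
rewrite /opt_density (big_fsetD1 _ mE)/= node_at_dyadic// mulr1.
rewrite big1_fset ?addr0; last first.
  move=> v; rewrite in_fsetD1 mem_tree_ext_grow => /andP[vm /andP[pv sv]] _.
  case: (boolP (x \in dyadic v)) => xv; rewrite ?mulr0//; exfalso.
  move: xv; rewrite mem_dyadic// => /eqP v2.
  have vE : v = node_at x v.1 by rewrite /node_at -v2; case: (v).
  move: pv sv vm; rewrite vE pm sm -leqNgt => h1 h2.
  by rewrite (_ : v.1 = m) ?eqxx//; apply/eqP; rewrite eqn_leq h1.
rewrite /opt_height [LHS]/= big_split /= prodr_const card_ord; congr (_ * _).
rewrite -(big_mkord xpredT (fun i => Y (word_of (node_at x i.+1)))).
rewrite big_add1 /= big_nat [RHS]big_nat; apply: eq_bigr => i /andP[_ im].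
by rewrite take_word_of// ancestor_node_at.
Qed.

End density_along_branch.

(** * The likelihood as a product over split nodes *)

Section sums_over_nodes.
Context {R : realType}.

Lemma big_nodes (A : Type) (idx : A) (op : Monoid.com_law idx) (L : nat)
    (F : node -> A) :
  \big[op/idx]_(v <- nodes L) F v =
  \big[op/idx]_(l < L.+1) \big[op/idx]_(k < 2 ^ l) F (nat_of_ord l, nat_of_ord k).
Proof.
pose r := [seq (l, k) | l <- iota 0 L.+1, k <- iota 0 (2 ^ l)].
have ur : uniq r.
  by apply: allpairs_uniq_dep => [|l _|[l k] [l' k'] _ _ /= [-> ->]];
    rewrite ?iota_uniq.
have -> : \big[op/idx]_(v <- nodes L) F v = \big[op/idx]_(v <- r) F v.
  apply: perm_big; apply: uniq_perm; rewrite ?fset_uniq// => v.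
  by rewrite /nodes in_fset.
rewrite /r big_allpairs_dep -(big_mkord xpredT (fun l => \big[op/idx]_(k < 2 ^ l) F (l, nat_of_ord k))).
rewrite /index_iota subn0; apply: eq_bigr => l _.
by rewrite -(big_mkord xpredT (fun k => F (l, k))) /index_iota subn0.
Qed.

(** Exactly one cell of each level contains x. *)
Lemma big_level (A : Type) (idx : A) (op : Monoid.com_law idx) (x : R) (l : nat)
    (F : node -> A) : unit_itv x ->
  (forall k, (k < 2 ^ l)%N -> k != cell x l -> F (l, k) = idx) ->
  \big[op/idx]_(k < 2 ^ l) F (l, nat_of_ord k) = F (node_at x l).
Proof.
move=> xu F0; have x0 := unit_itv_ge0 xu.
rewrite (bigD1 (Ordinal (cell_lt l xu)))//= big1 ?Monoid.mulm1// => k kx.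
by apply: F0 => //; apply: contraNneq kx => kx; apply/eqP/val_inj.
Qed.

Lemma mem_dyadic_child (x : R) (v : node) b : 0 <= x ->
  (x \in dyadic (child v b)) =
  (v == node_at x v.1) && (b == odd (cell x v.1.+1)).
Proof.
case: v => l k x0; rewrite mem_dyadic//= xpair_eqE eqxx /= -(cellS l x0).
have Eb (c c' : bool) : (c == c') = ((c : nat) == c') by case: c c' => [] [].
move: (cell x l.+1) => c; rewrite Eb -modn2; apply/eqP/andP => [E|[/eqP E1 /eqP E2]].
  by split; apply/eqP; case: b E => /=; lia.
by case: b E2 => /=; lia.
Qed.

Lemma node_atS (x : R) l : 0 <= x ->
  node_at x l.+1 = child (node_at x l) (odd (cell x l.+1)).
Proof.
by move=> x0; rewrite {1}(@node_child (node_at x l.+1))// /parent /= cellS.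
Qed.

End sums_over_nodes.

Section likelihood_product.
Context {R : realType}.
Variables (L : nat) (s : node -> bool) (Y : seq bool -> R).

Definition ncount n (X : n.-tuple R) (v : node) : nat := count [in dyadic v] X.

(** Cells that miss x contribute factors with exponent 0. In this form, unlike
    that of a path, the range of the product does not depend on x, so it can
    be multiplied over the observations. *)
Lemma opt_density_prod (x : R) : unit_itv x ->
  opt_density (grow_tree L s) Y x =
  \prod_(v <- nodes L | splits L s v) \prod_(b : bool)
    (2 * Y (word_of (child v b))) ^+ (x \in dyadic (child v b)).
Proof.
move=> xu; have x0 := unit_itv_ge0 xu.
have [m mL sm] := splits_branch L s x0.
rewrite (opt_density_path _ xu mL sm) [RHS]big_mkcond big_nodes /=.
have H (l : 'I_L.+1) : (l < m)%N ->
  \prod_(k < 2 ^ l)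
     (if splits L s (l : nat, k : nat) then
      \prod_(b : bool) (2 * Y (word_of (child (l : nat, k : nat) b)))
         ^+ (x \in dyadic (child (l : nat, k : nat) b))
      else 1) = 2 * Y (word_of (node_at x l.+1)).
  move=> lm.
  rewrite (big_level _ (F := fun v => if splits L s v then
      \prod_(b : bool) (2 * Y (word_of (child v b)))
         ^+ (x \in dyadic (child v b)) else 1) xu) /=; last first.
    move=> k _ kx; case: ifP => // _; rewrite big1// => b _.
    by rewrite mem_dyadic_child//= -pair_eqE /pair_eq /= eqxx (negbTE kx).
  rewrite sm lm node_atS// (bigD1 (odd (cell x l.+1)))//= big1 ?mulr1.
    by rewrite mem_dyadic_child//= !eqxx.
  by move=> b bo; rewrite mem_dyadic_child//= (negbTE bo) andbF.
transitivity (\prod_(l < L.+1 | (l < m)%N) (2 * Y (word_of (node_at x l.+1)))).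
  have mL1 : (m <= L.+1)%N by exact: leqW.
  exact: (big_ord_widen _ (fun l => 2 * Y (word_of (node_at x l.+1))) mL1).
rewrite big_mkcond; apply: eq_bigr => l _; case: ltnP => lm; first by rewrite H.
rewrite big1// => k _; case: ifP => // slk; rewrite big1// => b _.
rewrite mem_dyadic_child//=.
by case: eqP => //= lkE; move: slk; rewrite lkE sm ltnNge lm.
Qed.

(** The likelihood factorizes over the split nodes, each factor seeing the
    sample through two counts only; all later computations of posterior
    probabilities rest on this. *)
Lemma likelihood_prod n (X : n.-tuple R) :
  (forall i, unit_itv (tnth X i)) ->
  likelihood (opt_density (grow_tree L s) Y) X =
  \prod_(v <- nodes L | splits L s v) \prod_(b : bool)
    (2 * Y (word_of (child v b))) ^+ ncount X (child v b).
Proof.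
move=> Xu; rewrite /likelihood.
rewrite (eq_bigr _ (fun i _ => opt_density_prod (Xu i))).
rewrite exchange_big; apply: eq_bigr => v _; rewrite exchange_big.
apply: eq_bigr => b _; rewrite prodrXr; congr (_ ^+ _).
rewrite /ncount -sum1_count big_tuple big_mkcond /=.
rewrite [RHS]big_mkcond /=; apply: eq_bigr => i _.
by case: (tnth X i \in _).
Qed.

End likelihood_product.

(** * Integrals under the prior *)

Section prior_integrals.
Context {R : realType} {d} {Om : measurableType d} (Q : probability Om R).
Variables (p : node -> R) (a : R).
Variables (S : node -> {RV Q >-> bool}) (Y : seq bool -> {RV Q >-> R}).
Hypothesis SY : opt_variables p a S Y.
Variable L : nat.

(** All split decisions at the finitely many relevant nodes, as one random
    variable with values in a finite type. *)
Definition conf (w : Om) : {fset node} := [fset v in nodes L | S v w]%fset.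

Lemma mem_conf w v : (v \in conf w) = (v \in nodes L) && S v w.
Proof. by rewrite in_fset /= inE. Qed.

Definition Ysplit (v : node) (w : Om) : R := Y (rcons (word_of v) false) w.

Definition split_prob (v : node) (b : bool) : R := if b then p v else 1 - p v.

(** The independence hypothesis indexes the split variables by words, whereas
    the products run over nodes; on the nodes up to level L this is the
    inverse of [word_of]. *)
Definition node_of (eps : seq bool) : node :=
  xget (0, 0)%N [set v | v \in nodes L /\ word_of v = eps].

Lemma node_ofK v : v \in nodes L -> node_of (word_of v) = v.
Proof.
move=> vL; rewrite /node_of; case: xgetP => [u _ [uL uv]|/(_ v)]; last first.
  by move=> /= []; split.
by move: uL vL; rewrite !mem_nodes => /andP[_ u2] /andP[_ v2]; exact: word_of_inj.
Qed.

Lemma measurable_split v (b : bool) : measurable (S v @^-1` [set b]).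
Proof. by rewrite -[X in measurable X]setTI; apply: measurable_funP. Qed.

Lemma split_probE v b : Q (S v @^-1` [set b]) = (split_prob v b)%:E.
Proof.
have [S1 _ _ _] := SY; case: b => //=.
rewrite (_ : _ @^-1` _ = ~` (S v @^-1` [set true])); last first.
  by apply/seteqP; split => w /=; case: (S v w).
by rewrite probability_setC ?S1//; exact: measurable_split.
Qed.

Lemma integral_split v b :
  (\int[Q]_w (\1_(S v @^-1` [set b]) w)%:E = (split_prob v b)%:E)%E.
Proof.
by rewrite integral_indic ?setIT//; [exact: split_probE|exact: measurable_split].
Qed.

Lemma indic_split v b w :
  \1_(S v @^-1` [set b]) w = (S v w == b)%:R :> R.
Proof.
by rewrite indicE; congr ((nat_of_bool _)%:R); apply/idP/eqP; rewrite inE.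
Qed.

Lemma split_prob_ge0 v b : 0 <= split_prob v b.
Proof. by rewrite -lee_fin -split_probE measure_ge0. Qed.

Lemma prod_conf (c : {fset node} -> R) (H : {fset node} -> node -> R) w :
  \sum_(s <- fpowerset (nodes L))
    c s * \prod_(v <- nodes L) ((S v w == (v \in s))%:R * H s v) =
  c (conf w) * \prod_(v <- nodes L) H (conf w) v.
Proof.
have cP : conf w \in fpowerset (nodes L).
  by rewrite fpowersetE; apply/fsubsetP => v; rewrite mem_conf => /andP[].
rewrite (big_fsetD1 _ cP)/= [X in _ + X]big1_fset ?addr0.
  congr (_ * _); rewrite big_seq [RHS]big_seq; apply: eq_bigr => v vL.
  by rewrite mem_conf vL eqxx mul1r.
move=> s; rewrite in_fsetD1 fpowersetE => /andP[sc sL] _.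
have [v vL vs] : exists2 v, v \in nodes L & S v w != (v \in s).
  apply: contrapT => H0; move/eqP: sc; apply; apply/fsetP => v.
  rewrite mem_conf; case: (boolP (v \in nodes L)) => vL /=.
    by apply/esym/eqP/negPn/negP => ?; apply: H0; exists v.
  by apply/negbTE; apply: contra vL => /(fsubsetP sL).
by rewrite (big_fsetD1 _ vL)/= (negbTE vs) !mul0r mulr0.
Qed.

Lemma integral_conf_prod (s : {fset node}) (H : node -> R -> R) :
  (forall v, measurable_fun setT (H v)) -> (forall v y, 0 <= H v y) ->
  (forall v, \int[Q]_w (H v (Ysplit v w))%:E < +oo)%E ->
  (\int[Q]_w (\prod_(v <- nodes L)
     ((S v w == (v \in s))%:R * H v (Ysplit v w)))%:E =
   \prod_(v <- nodes L) ((split_prob v (v \in s))%:E *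
     \int[Q]_w (H v (Ysplit v w))%:E))%E.
Proof.
move=> mH H0 Hoo; have [_ _ _ ind] := SY.
pose r := [seq inl v | v <- enum_fset (nodes L)] ++
  [seq inr (word_of v) | v <- enum_fset (nodes L)] : seq (node + seq bool).
have ur : uniq r.
  rewrite cat_uniq !map_inj_in_uniq ?fset_uniq//= ?andbT.
  - by apply/hasPn => _ /mapP[v _ ->]; apply/negP => /mapP[].
  - move=> v u vL uL [E]; rewrite -(@node_ofK v)// -(@node_ofK u)//.
    by rewrite E.
  - by move=> v u _ _ [].
pose J := [fset i in r]%fset.
have pJ : perm_eq J r by apply: uniq_perm; rewrite ?fset_uniq// => i; rewrite in_fset.
pose F (i : node + seq bool) (w : Om) : R :=
  match i with
  | inl v => \1_(S v @^-1` [set (v \in s)]) w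
  | inr eps => H (node_of eps) (Y (rcons eps false) w)
  end.
have mF i : measurable_fun setT (F i).
  case: i => [v|eps] /=; first exact/measurable_indicP/measurable_split.
  by apply: measurableT_comp => //; exact: measurable_funPT.
have F0 i w : 0 <= F i w by case: i => [v|eps] /=; rewrite ?indicE ?ler0n ?H0.
have Foo i : i \in J -> (\int[Q]_w (F i w)%:E < +oo)%E.
  rewrite in_fset mem_cat => /orP[/mapP[v _ ->]|/mapP[v vL ->]] /=.
    by rewrite integral_split ltry.
  by rewrite node_ofK//; exact: Hoo.
have := integral_indep_prod (J := J) ind mF F0 Foo.
rewrite (perm_big _ pJ)/= /r big_cat !big_map/= => IH.
transitivity (\int[Q]_w (\prod_(i <- J) F i w)%:E)%E.
  apply: eq_integral => w _; congr EFin; rewrite (perm_big _ pJ)/= /r.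
  rewrite big_cat !big_map/= -big_split/=.
  rewrite big_seq [RHS]big_seq; apply: eq_bigr => v vL.
  by rewrite node_ofK// indic_split.
rewrite IH; last first.
  move=> [v|eps] B _ mB.
    exists [set b | B ((b == (v \in s))%:R)] => //; rewrite setTI.
    by apply/seteqP; split => w; rewrite /F /= -indic_split.
  exists (H (node_of eps) @^-1` B); last by rewrite setTI.
  by rewrite -[X in measurable X]setTI; exact: mH.
rewrite big_split/=; congr (_ * _)%E; apply: eq_big_seq => v vL.
  exact: integral_split.
by rewrite node_ofK.
Qed.

(** Conditioning on the finite random set of split decisions: for each of its
    values, the indicators of the decisions and the functions of the split
    variables are independent. *)
Lemma opt_integral (c : {fset node} -> R) (H : {fset node} -> node -> R -> R) :
  (forall s, 0 <= c s) ->
  (forall s v, measurable_fun setT (H s v)) -> (forall s v y, 0 <= H s v y) ->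
  (forall s v, \int[Q]_w (H s v (Ysplit v w))%:E < +oo)%E ->
  (\int[Q]_w (c (conf w) * \prod_(v <- nodes L) H (conf w) v (Ysplit v w))%:E =
   \sum_(s <- fpowerset (nodes L)) (c s)%:E * \prod_(v <- nodes L)
     ((split_prob v (v \in s))%:E * \int[Q]_w (H s v (Ysplit v w))%:E))%E.
Proof.
move=> c0 mH H0 Hoo; under eq_integral => w _ do
  rewrite -(prod_conf c (fun s v => H s v (Ysplit v w))) -sumEFin.
have mprod s : measurable_fun setT (fun w => \prod_(v <- nodes L)
    ((S v w == (v \in s))%:R * H s v (Ysplit v w))).
  apply: measurable_prod => v _; apply: measurable_funM; last first.
    by apply: measurableT_comp => //; exact: measurable_funPT.
  under eq_fun do rewrite -indic_split.
  exact/measurable_indicP/measurable_split.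
have prod0 s w : 0 <= \prod_(v <- nodes L)
    ((S v w == (v \in s))%:R * H s v (Ysplit v w)).
  by rewrite prodr_ge0// => v _; rewrite mulr_ge0.
rewrite ge0_integral_sum//.
- apply: eq_bigr => s _; under eq_integral do rewrite EFinM.
  rewrite ge0_integralZl//.
  + by congr (_ * _)%E; exact: integral_conf_prod.
  + exact/measurable_EFinP.
  + by move=> w _; rewrite lee_fin.
  + by rewrite lee_fin.
- by move=> s; apply/measurable_EFinP; exact: measurable_funM.
- by move=> s w _; rewrite lee_fin mulr_ge0.
Qed.

End prior_integrals.

(** * Comparing trees by local surgery *)

Section tree_surgery.
Context {R : realType}.
Variables (L : nat) (p W : node -> R).

Local Notation splitsf s := (splits L (fun v => v \in s)).
Local Notation presentf s := (present L (fun v => v \in s)).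
Local Notation configs := (fpowerset (nodes L)).

(** The posterior weight of a pattern of decisions, up to normalization, when
    W v is the integrated likelihood of the split at v. Decisions below a leaf
    keep their prior probability, so that summing over them restores the
    weight of the tree. *)
Definition config_weight (s : {fset node}) : R :=
  \prod_(v <- nodes L) (split_prob p v (v \in s) * (if splitsf s v then W v else 1)).

Definition leaf_at (v : node) (s : {fset node}) : bool :=
  presentf s v && ~~ splitsf s v.

(** A split node with unsplit children, that is, a place where one split can
    be removed or added without touching the rest of the tree. *)
Definition cherry_at (v : node) (s : {fset node}) : bool :=
  [&& splitsf s v, ~~ splitsf s (child v false) & ~~ splitsf s (child v true)].

Definition mass (P : pred {fset node}) : R := \sum_(s <- configs | P s) config_weight s.

Hypothesis p01 : forall v, v \in nodes L -> 0 <= p v <= 1.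
Hypothesis W0 : forall v, v \in nodes L -> 0 < W v.

Lemma split_prob01 v b : v \in nodes L -> 0 <= split_prob p v b <= 1.
Proof. by move=> /p01; case: b => /=; lra. Qed.

Lemma config_weight_ge0 s : 0 <= config_weight s.
Proof.
rewrite /config_weight big_seq prodr_ge0// => v vL; have := split_prob01 (v \in s) vL.
by move=> /andP[h _]; rewrite mulr_ge0//; case: ifP => // _; exact/ltW/W0.
Qed.

Lemma mass_ge0 P : 0 <= mass P.
Proof. by rewrite sumr_ge0// => s _; exact: config_weight_ge0. Qed.

Lemma mass_le (P P' : pred {fset node}) : (forall s, P s -> P' s) -> mass P <= mass P'.
Proof.
move=> PP'; rewrite /mass big_mkcond [leRHS]big_mkcond /=.
apply: ler_sum => s _; case: (boolP (P s)) => Ps; first by rewrite PP'.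
by case: ifP => // _; exact: config_weight_ge0.
Qed.

Lemma mass_has (I : Type) (r : seq I) (A : pred I) (P : pred {fset node})
    (P' : I -> pred {fset node}) :
  (forall s, P s -> has (fun i => A i && P' i s) r) ->
  mass P <= \sum_(i <- r | A i) mass (P' i).
Proof.
move=> PP'; rewrite /mass (exchange_big_dep xpredT)//= big_mkcond /=.
apply: ler_sum => s _; case: (boolP (P s)) => Ps; last first.
  by rewrite sumr_ge0// => i _; exact: config_weight_ge0.
have := PP' _ Ps; elim: r {PP'} => //= i r IH.
rewrite big_cons; case: ifP => //= Pi _.
by rewrite lerDl sumr_ge0// => j _; exact: config_weight_ge0.
Qed.

(** Each surgery is an injective map between patterns of decisions that
    changes the weight by a bounded factor. *)
Lemma mass_inj (P P' : pred {fset node}) (f : {fset node} -> {fset node}) (c : R) :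
  0 <= c ->
  (forall s, s \in configs -> P s -> f s \in configs /\ P' (f s)) ->
  (forall s s', s \in configs -> s' \in configs -> P s -> P s' -> f s = f s' -> s = s') ->
  (forall s, s \in configs -> P s -> config_weight s <= c * config_weight (f s)) ->
  mass P <= c * mass P'.
Proof.
move=> c0 fP finj fw.
rewrite /mass (@le_trans _ _ (\sum_(s <- configs | P s) c * config_weight (f s)))//.
  by rewrite big_seq_cond [leRHS]big_seq_cond; apply: ler_sum => s /andP[]; exact: fw.
rewrite -mulr_sumr ler_wpM2l//.
pose r1 := [seq f s | s <- configs & P s]; pose r2 := [seq s <- configs | P' s].
have -> : \sum_(s <- configs | P s) config_weight (f s) = \sum_(s <- r1) config_weight s.
  by rewrite big_map big_filter.
have -> : \sum_(s <- configs | P' s) config_weight s = \sum_(s <- r2) config_weight s by rewrite big_filter.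
have u1 : uniq r1.
  rewrite map_inj_in_uniq ?filter_uniq ?fset_uniq// => s s'.
  by rewrite !mem_filter => /andP[? ?] /andP[? ?]; exact: finj.
have u2 : uniq r2 by rewrite filter_uniq ?fset_uniq.
rewrite [leRHS](bigID (fun s => s \in r1))/= -[leLHS]addr0 lerD//; last first.
  by rewrite sumr_ge0// => s _; exact: config_weight_ge0.
rewrite -[in leRHS]big_filter le_eqVlt; apply/orP; left; apply/eqP.
apply: perm_big; apply: uniq_perm => [//||s]; first exact: filter_uniq.
rewrite [RHS]mem_filter; case: (boolP (s \in r1)) => //= /mapP[s'].
rewrite mem_filter => /andP[Ps' s'c] ->; apply/esym.
by have [? ?] := fP _ s'c Ps'; rewrite /r2 mem_filter; apply/andP.
Qed.

Lemma splits_ext (s s' : node -> bool) v :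
  (forall i, (i <= v.1)%N -> s (ancestor v i) = s' (ancestor v i)) ->
  splits L s v = splits L s' v.
Proof.
move=> E; rewrite /splits; congr [&& _, _ & _].
by apply: eq_in_all => i; rewrite mem_iota add0n /= ltnS => /E.
Qed.

Lemma present_ext (s s' : node -> bool) v :
  (forall i, (i < v.1)%N -> s (ancestor v i) = s' (ancestor v i)) ->
  present L s v = present L s' v.
Proof.
move=> E; rewrite /present; congr [&& _, _ & _].
by apply: eq_in_all => i; rewrite mem_iota add0n /= => /E.
Qed.

Lemma ancestorS u i : (i < u.1)%N ->
  ancestor u i.+1 = child (ancestor u i) (odd (ancestor u i.+1).2).
Proof.
move=> iu; rewrite {1}(@node_child (ancestor u i.+1))//; congr child.
by rewrite /parent /ancestor /= -divnMA -expnSr; congr (_, _ %/ 2 ^ _)%N; lia.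
Qed.

Lemma splits_below s u v : (v.1 < u.1)%N -> ancestor u v.1 = v ->
  (forall b, ~~ splits L s (child v b)) -> splits L s u = false.
Proof.
move=> vu uv nb; apply/negP => su; have := splits_ancestor (i := v.1.+1) vu su.
by rewrite ancestorS// uv (negbTE (nb _)).
Qed.

Lemma splits_unsplit_below s u v : (v.1 <= u.1)%N -> ancestor u v.1 = v ->
  ~~ s v -> splits L s u = false.
Proof.
move=> vu uv; apply: contraNF => /and3P[_ _ /allP/(_ v.1)].
by rewrite mem_iota /= ltnS vu uv; exact.
Qed.

(** Why a surgery at v is local: nothing below a leaf or a cherry is split, so
    the decisions changed at v and at its children are seen by no other node. *)
Lemma splits_local (s s' : {fset node}) v :
  (v.1 < L)%N ->
  (forall u, u != v -> u != child v false -> u != child v true ->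
     (u \in s) = (u \in s')) ->
  (forall b, ~~ splitsf s (child v b)) -> (forall b, ~~ splitsf s' (child v b)) ->
  forall u, u != v -> splitsf s u = splitsf s' u.
Proof.
move=> vL ss' nb nb' u uv.
case: (boolP ((v.1 < u.1)%N && (ancestor u v.1 == v))) => [/andP[h1 /eqP h2]|H].
  by rewrite !(splits_below h1 h2).
apply: splits_ext => i iu; apply: ss'; apply/negP => /eqP E.
- have iE : i = v.1 by rewrite -E.
  move: E H; rewrite iE in iu * => E; rewrite E eqxx andbT -leqNgt => uv1.
  have vE : v.1 = u.1 by apply/eqP; rewrite eqn_leq iu.
  by move: uv; rewrite -E vE ancestor_id eqxx.
- have iE : i = v.1.+1 by rewrite -[i]/(ancestor u i).1 E.
  move: H; rewrite -(@ancestorA u v.1 i); last by rewrite iE leqnSn -iE.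
  rewrite E ancestor_child// ancestor_id eqxx andbT.
  by rewrite -iE iu.
- have iE : i = v.1.+1 by rewrite -[i]/(ancestor u i).1 E.
  move: H; rewrite -(@ancestorA u v.1 i); last by rewrite iE leqnSn -iE.
  rewrite E ancestor_child// ancestor_id eqxx andbT.
  by rewrite -iE iu.
Qed.

Lemma anc_neq v i u : (i < v.1)%N -> (v.1 <= u.1)%N -> ancestor v i != u.
Proof.
by move=> iv vu; apply/eqP => /(congr1 fst) /= E; move: iv; rewrite E ltnNge vu.
Qed.

Lemma child_neq v b : child v b != v.
Proof. by apply/eqP => /(congr1 fst) /= /esym/n_Sn. Qed.

(** Pruning: reversing the decision at v turns the cherry into a leaf and
    replaces the factor p v * W v by 1 - p v, which is at least 1/2. *)
Lemma mass_cherry_le v : v \in nodes L -> (v.1 < L)%N -> p v <= 1/2 ->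
  mass (cherry_at v) <= 2 * (p v * W v) * mass xpredT.
Proof.
move=> vN vL pv; have Wv := W0 vN; have /andP[p0 _] := p01 vN.
apply: (@mass_inj _ _ (fun s => s `\ v)%fset).
- by rewrite !mulr_ge0// ltW.
- move=> s; rewrite !fpowersetE => sL _; split=> //.
  by apply: fsubset_trans sL; exact: fsubsetDl.
- move=> s s' _ _ /and3P[h _ _] /and3P[h' _ _] E.
  have vs : v \in s by move: h; rewrite splitsE => /and3P[].
  have vs' : v \in s' by move: h'; rewrite splitsE => /and3P[].
  by rewrite -(fsetD1K vs) E fsetD1K.
move=> s sc /and3P[h hf ht].
have vs : v \in s by move: h; rewrite splitsE => /and3P[].
rewrite /config_weight !(big_fsetD1 _ vN)/= vs h.
have -> : splitsf (s `\ v)%fset v = false.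
  by rewrite splitsE !inE eqxx /= !andbF.
rewrite !inE eqxx /= mulr1.
set A := \prod_(i <- _) _; set B := \prod_(i <- _) _.
have AB : A = B.
  apply: eq_big_seq => u; rewrite in_fsetD1 => /andP[uv _].
  rewrite !inE uv /=; suff -> : splitsf s u = splitsf (s `\ v)%fset u by [].
  apply: (@splits_local _ _ v) => //.
  - by move=> u' u'v _ _; rewrite !inE u'v.
  - by case.
  - move=> b; rewrite (@splits_unsplit_below _ _ v)//=.
      by rewrite ancestor_child// ancestor_id.
    by rewrite !inE eqxx.
rewrite -AB; have A0 : 0 <= A.
  rewrite /A big_seq prodr_ge0// => u; rewrite in_fsetD1 => /andP[_ uL].
  have /andP[? _] := split_prob01 (u \in s) uL.
  by rewrite mulr_ge0//; case: ifP => // _; exact/ltW/W0.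
have T0 : 0 <= p v * W v * A by rewrite !mulr_ge0// ltW.
by rewrite [leRHS](_ : _ = 2 * (1 - p v) * (p v * W v * A)); [nra|ring].
Qed.

(** Growing: v is split and its children are declared unsplit. The decisions
    at the children were free, so the map is injective only once their four
    values are distinguished, which gives the factor 4. *)
Lemma mass_leaf_le v : v \in nodes L -> (v.1 < L)%N -> 0 < p v ->
  (forall b, p (child v b) <= 1/2) ->
  mass (leaf_at v) <= 4 / (p v * W v) * mass (cherry_at v).
Proof.
move=> vN vL p0 pc; have Wv := W0 vN; have /andP[_ p1] := p01 vN.
have pW : 0 < p v * W v by rewrite mulr_gt0.
have cN b : child v b \in nodes L.
  rewrite mem_nodes child_lt ?andbT//.
  by move: vN; rewrite mem_nodes => /andP[].
pose c0 := child v false; pose c1 := child v true.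
have c01 : c0 != c1 by rewrite /c0 /c1 xpair_eqE eqxx /=; lia.
pose f s : {fset node} := ((v |` s) `\ c0 `\ c1)%fset.
have fE s u : u != v -> u != c0 -> u != c1 -> (u \in f s) = (u \in s).
  by move=> uv u0 u1; rewrite /f !inE u0 u1 (negbTE uv).
pose leaf2 (bb : bool * bool) s :=
  [&& leaf_at v s, (c0 \in s) == bb.1 & (c1 \in s) == bb.2].
apply: (@le_trans _ _ (\sum_(bb : bool * bool) mass (leaf2 bb))).
  apply: (@mass_has _ _ xpredT) => s ls; apply/hasP.
  by exists (c0 \in s, c1 \in s); rewrite ?mem_index_enum// /leaf2 ls !eqxx.
rewrite [leRHS](_ : _ = \sum_(bb : bool * bool) (p v * W v)^-1 * mass (cherry_at v)); last first.
  by rewrite sumr_const card_prod card_bool -mulr_natl; field; rewrite !gt_eqF// -?mulr_gt0.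
apply: ler_sum => -[b0 b1] _.
apply: (@mass_inj _ _ f); first by rewrite invr_ge0 ltW.
- move=> s; rewrite !fpowersetE => sL /and3P[/andP[pv sv] _ _]; split.
    do 2 (apply: fsubset_trans (fsubsetDl _ _) _).
    by rewrite fsubUset fsub1set vN.
  have v0 : v != c0 by rewrite eq_sym child_neq.
  have v1 : v != c1 by rewrite eq_sym child_neq.
  apply/and3P; split.
  + rewrite splitsE vL /= /f !inE v1 v0 eqxx /= andbT.
    rewrite -(@present_ext (fun u => u \in s))// => i iv.
    by rewrite fE ?anc_neq//= leqW// ltnW.
  + by rewrite splitsE !inE eqxx /= !andbF.
  + by rewrite splitsE !inE eqxx /= !andbF.
- move=> s s' _ _ /and3P[/andP[pv sv] /eqP s0 /eqP s1] /and3P[/andP[pv' sv'] /eqP s0' /eqP s1'] E.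
  apply/fsetP => u.
  have vns : v \notin s by apply: contra sv => vs; rewrite splitsE vL pv vs.
  have vns' : v \notin s' by apply: contra sv' => vs; rewrite splitsE vL pv' vs.
  have [->|u0] := eqVneq u c0; first by rewrite s0 s0'.
  have [->|u1] := eqVneq u c1; first by rewrite s1 s1'.
  have [->|uv] := eqVneq u v; first by rewrite (negbTE vns) (negbTE vns').
  by move/fsetP/(_ u): E; rewrite !inE u0 u1 (negbTE uv).
move=> s sc /and3P[/andP[pv sv] /eqP s0 /eqP s1].
have vns : v \notin s by apply: contra sv => vs; rewrite splitsE vL pv vs.
have v0 : v != c0 by rewrite eq_sym child_neq.
have v1 : v != c1 by rewrite eq_sym child_neq.
have vf : v \in f s by rewrite /f !inE eqxx v0 v1.
have c0f : c0 \notin f s by rewrite /f !inE eqxx /= andbF.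
have c1f : c1 \notin f s by rewrite /f !inE eqxx.
have sfv : splitsf (f s) v.
  rewrite splitsE vL vf /= andbT -(@present_ext (fun u => u \in s))// => i iv.
  by rewrite fE ?anc_neq//= leqW// ltnW.
have nb b : ~~ splitsf s (child v b).
  rewrite (@splits_unsplit_below _ _ v)//=.
  by rewrite ancestor_child// ancestor_id.
have nb' b : ~~ splitsf (f s) (child v b).
  by rewrite splitsE; case: b; rewrite ?(negbTE c0f) ?(negbTE c1f) !andbF.
have c0N : c0 \in (nodes L `\ v)%fset by rewrite in_fsetD1 cN eq_sym v0.
have c1N : c1 \in (nodes L `\ v `\ c0)%fset.
  by rewrite !in_fsetD1 cN eq_sym c01 eq_sym v1.
rewrite /config_weight !(big_fsetD1 _ vN)/= !(big_fsetD1 _ c0N)/= !(big_fsetD1 _ c1N)/=.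
rewrite (negbTE vns) vf (negbTE sv) sfv (negbTE c0f) (negbTE c1f).
rewrite (negbTE (nb false)) (negbTE (nb true)).
rewrite (negbTE (nb' false)) (negbTE (nb' true)) !mulr1 /=.
set A := \prod_(i <- _) _; set B := \prod_(i <- _) _.
have AB : A = B.
  apply: eq_big_seq => u uN.
  have /and4P[u1 u0 uv _] : [&& u != c1, u != c0, u != v & u \in nodes L].
    by move: uN; rewrite !in_fsetD1.
  rewrite fE//; suff -> : splitsf s u = splitsf (f s) u by [].
  apply: (@splits_local _ _ v) => // u' u'v u'0 u'1.
  by rewrite fE.
rewrite -AB; have A0 : 0 <= A.
  rewrite /A big_seq prodr_ge0// => u; rewrite !in_fsetD1 => /and4P[_ _ _ uL].
  have /andP[? _] := split_prob01 (u \in s) uL.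
  by rewrite mulr_ge0//; case: ifP => // _; exact/ltW/W0.
rewrite [leRHS](_ : _ = (1 - p c0) * (1 - p c1) * A); last first.
  by field; rewrite !gt_eqF.
rewrite !mulrA ler_wpM2r//.
have q01 b c : 0 <= split_prob p (child v b) c <= 1 - p (child v b).
  by have := split_prob01 c (cN b); have := pc b; case: c => /=; lra.
have /andP[h1 h2] := q01 false (c0 \in s).
have /andP[h3 h4] := q01 true (c1 \in s).
have h5 := p01 vN.
rewrite -!mulrA; apply: (@le_trans _ _ (1 * (split_prob p c0 (c0 \in s) *
  split_prob p c1 (c1 \in s)))).
  by rewrite ler_wpM2r ?mulr_ge0//; lra.
by rewrite mul1r ler_pM.
Qed.

Lemma exists_leaf_ancestor s v : (v.1 < L)%N -> (v.2 < 2 ^ v.1)%N ->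
  ~~ splitsf s v -> exists2 i, (i <= v.1)%N & leaf_at (ancestor v i) s.
Proof.
move=> vL v2 sv.
have ex : exists i, (i <= v.1)%N && ~~ splitsf s (ancestor v i).
  by exists v.1; rewrite leqnn ancestor_id.
case: (ex_minnP ex) => i /andP[iv si] imin; exists i => //.
rewrite /leaf_at si andbT; case: i iv si imin => [|i] iv si imin.
  by rewrite /present /= (@ancestor_lt v 0).
rewrite ancestorS; last lia.
rewrite present_child; apply/negPn/negP => si'.
by have := imin i; rewrite (ltnW iv) si' => /(_ isT); rewrite ltnn.
Qed.

(** A tree that does not split v has a leaf at v or at an ancestor of v, and
    can be prolonged to v one cherry at a time. Each ancestor costs at most
    rho and v itself only kappa, which is minute when the data ask for this
    split. *)
Lemma mass_nosplit_le v (rho kappa : R) : v \in nodes L -> (v.1 < L)%N ->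
  (forall u, 0 < p u) -> (forall u, (0 < u.1)%N -> p u <= 1/2) ->
  1 <= rho -> 0 <= kappa ->
  (forall i, (i < v.1)%N -> 4 / (p (ancestor v i) * W (ancestor v i)) <= rho) ->
  4 / (p v * W v) <= kappa ->
  mass (fun s => ~~ splitsf s v) <= v.1.+1%:R * (rho ^+ v.1 * kappa) * mass xpredT.
Proof.
move=> vN vL p0 p12 rho1 kap0 Hrho Hkap.
have v2 : (v.2 < 2 ^ v.1)%N by move: vN; rewrite mem_nodes => /andP[].
have D0 := mass_ge0 xpredT.
have aN i : (i <= v.1)%N -> ancestor v i \in nodes L.
  move=> iv; rewrite mem_nodes (ancestor_lt v2 iv) andbT /=.
  exact: leq_trans (ltnW vL).
have step i : (i <= v.1)%N -> mass (leaf_at (ancestor v i)) <=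
    4 / (p (ancestor v i) * W (ancestor v i)) * mass (cherry_at (ancestor v i)).
  move=> iv; apply: mass_leaf_le => //; first exact: aN.
    exact: leq_ltn_trans vL.
  by move=> b; exact: p12.
have H j : (j <= v.1)%N ->
    mass (leaf_at (ancestor v (v.1 - j))) <= rho ^+ j * kappa * mass xpredT.
  elim: j => [|j IH] jv.
    rewrite subn0 expr0 mul1r; apply: le_trans (step _ (leqnn _)) _.
    rewrite ancestor_id ler_pM ?mass_ge0//; last exact: mass_le.
    by rewrite divr_ge0// ltW// mulr_gt0// W0.
  apply: le_trans (step _ _) _; first lia.
  rewrite exprS -(mulrA rho) -(mulrA rho); apply: ler_pM; rewrite ?mass_ge0//.
  - by rewrite mulr_ge0// invr_ge0 ltW// mulr_gt0// W0//; apply: aN; lia.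
  - by apply: Hrho; lia.
  apply: le_trans (IH (ltnW jv)); apply: mass_le => s.
  move=> /and3P[h h0 h1].
  have E : (v.1 - j = (v.1 - j.+1).+1)%N by rewrite subnS prednK ?subn_gt0.
  rewrite E ancestorS; last by rewrite -E leq_subr.
  by rewrite /leaf_at present_child h; case: (odd _).
apply: (@le_trans _ _ (\sum_(i < v.1.+1) mass (leaf_at (ancestor v i)))).
  apply: (@mass_has _ _ xpredT) => s sv; apply/hasP.
  have [i iv li] := exists_leaf_ancestor vL v2 sv.
  by exists (inord i); rewrite ?mem_index_enum//= inordK.
rewrite -mulrA mulr_natl -[in leRHS](card_ord v.1.+1) -sumr_const.
apply: ler_sum => -[i iv] _ /=; have := H (v.1 - i)%N.
rewrite subKn// => /(_ (leq_subr _ _)) /le_trans; apply.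
rewrite ler_wpM2r// ler_wpM2r//; apply: ler_weXn2l => //; exact: leq_subr.
Qed.

Lemma exists_deepest_split s m u : (m <= u.1)%N -> splitsf s u ->
  exists2 v, (m <= v.1)%N & cherry_at v s.
Proof.
have [k] := ubnP (L - u.1); elim: k u => // k IH u uk mu su.
have uL : (u.1 < L)%N by move: su => /and3P[].
case: (boolP (splitsf s (child u false))) => [h|h0].
  by apply: (IH (child u false)) => //=; lia.
case: (boolP (splitsf s (child u true))) => [h|h1].
  by apply: (IH (child u true)) => //=; lia.
by exists u => //; rewrite /cherry_at su h0.
Qed.

Lemma sum_nodes_le (P : pred node) (c : R) : 0 <= c ->
  \sum_(v <- nodes L | P v) c <= 2 ^+ L.+1 * c.
Proof.
move=> c0; apply: (@le_trans _ _ (\sum_(v <- nodes L) c)).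
  by rewrite big_mkcond /=; apply: ler_sum => v _; case: ifP.
rewrite big_nodes /=; under eq_bigr do rewrite sumr_const card_ord -mulr_natl.
rewrite -mulr_suml ler_wpM2r//.
elim: L => [|l IH]; first by rewrite big_ord1 expn0 expr1; lra.
by rewrite big_ord_recr /= exprS natrX; lra.
Qed.

(** The deepest split of a tree is a cherry, so a tree that splits beyond
    level m can be pruned there; a union bound over the nodes completes the
    argument. *)
Lemma mass_deep_le m (r : R) : 0 <= r -> (0 < m)%N ->
  (forall v, v \in nodes L -> (m <= v.1)%N -> p v <= 1/2) ->
  (forall v, v \in nodes L -> (m <= v.1 < L)%N -> 2 * (p v * W v) <= r) ->
  mass (fun s => has (fun u => (m <= u.1)%N && splitsf s u) (nodes L)) <=
  2 ^+ L.+1 * (r * mass xpredT).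
Proof.
move=> r0 m0 p12 rW.
apply: le_trans (sum_nodes_le (fun v => m <= v.1 < L)%N _); last first.
  by rewrite mulr_ge0// mass_ge0.
apply: (@le_trans _ _ (\sum_(v <- nodes L | (m <= v.1 < L)%N) mass (cherry_at v))).
  apply: mass_has => s /hasP[u _ /andP[mu su]].
  have [v mv cv] := exists_deepest_split mu su; apply/hasP; exists v.
    by move: cv => /and3P[/and3P[vL v2 _] _ _]; rewrite mem_nodes ltnW.
  by move: (cv) => /and3P[/and3P[-> _ _] _ _]; rewrite mv cv.
rewrite big_seq_cond [leRHS]big_seq_cond.
apply: ler_sum => v /andP[vN /andP[mv vL]].
apply: le_trans (mass_cherry_le vN vL (p12 _ vN mv)) _.
by rewrite ler_wpM2r ?mass_ge0// rW// mv.
Qed.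

End tree_surgery.

(** * The likelihood of one split *)

Section binomial_likelihood.
Context {R : realType}.
Implicit Types y q t : R.

(** The inequality r <= exp (r - 1) for r = sqrt (y / q), raised to the power
    2 * N0. *)
Lemma pow_le_hellinger y q (N N0 : nat) : 0 <= y -> 0 <= q ->
  N0%:R = N%:R * q ->
  y ^+ N0 <= q ^+ N0 * expR (2 * (N%:R * Num.sqrt (y * q) - N0%:R)).
Proof.
move=> y0 q0 NE; case: N0 NE => [|N0] NE.
  rewrite !expr0 mul1r subr0 -[leLHS]expR0 ler_expR.
  by rewrite !mulr_ge0// sqrtr_ge0.
have qp : 0 < q.
  rewrite lt_neqAle q0 andbT; apply/eqP => qE; move/eqP: NE.
  by rewrite -qE mulr0 pnatr_eq0.
pose r := Num.sqrt (y / q).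
have rE : y = q * r ^+ 2 by rewrite /r sqr_sqrtr ?divr_ge0//; field; rewrite gt_eqF.
have sE : Num.sqrt (y * q) = q * r.
  by rewrite rE (_ : _ * q = (q * r) ^+ 2) ?sqrtr_sqr ?ger0_norm ?mulr_ge0 ?sqrtr_ge0//; ring.
have r0 : 0 <= r by rewrite sqrtr_ge0.
rewrite sE mulrA -NE {1}rE exprMn ler_wpM2l ?exprn_ge0// -exprM.
rewrite (_ : 2 * (_ - _) = (r - 1) * (2 * N0.+1)%:R); last by rewrite natrM; ring.
rewrite expRM_natr ?lerXn2r ?nnegrE ?expR_ge0//.
by have := expR_ge1Dx (r - 1); rewrite addrC subrK.
Qed.

(** One minus the affinity is half the squared Hellinger distance, and square
    roots contract distances on the unit interval by at most a factor 2. *)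
Lemma hellinger_le y q : 0 <= y <= 1 -> 0 <= q <= 1 ->
  Num.sqrt (y * q) + Num.sqrt ((1 - y) * (1 - q)) <= 1 - (q - y) ^+ 2 / 4.
Proof.
move=> /andP[y0 y1] /andP[q0 q1].
rewrite !sqrtrM ?subr_ge0//.
have sq (z : R) : 0 <= z <= 1 -> 0 <= Num.sqrt z <= 1 /\ z = Num.sqrt z ^+ 2.
  move=> /andP[z0 z1]; rewrite sqr_sqrtr// sqrtr_ge0; split=> //.
  by rewrite -sqrtr1 ler_wsqrtr.
have [ys yE] := sq y ltac:(by rewrite y0). have [qs qE] := sq q ltac:(by rewrite q0).
have [ys' yE'] := sq (1 - y) ltac:(lra). have [qs' qE'] := sq (1 - q) ltac:(lra).
move: ys ys' qs qs' yE yE' qE qE'.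
move: (Num.sqrt y) (Num.sqrt q) (Num.sqrt (1 - y)) (Num.sqrt (1 - q)) => s t s' t'.
move=> hs hs' ht ht' yE yE' qE qE'.
have h1 : (q - y) ^+ 2 <= 4 * (t - s) ^+ 2.
  rewrite qE yE (_ : (t ^+ 2 - s ^+ 2) ^+ 2 = (t + s) ^+ 2 * (t - s) ^+ 2); last by ring.
  by rewrite ler_wpM2r ?sqr_ge0//; nra.
have h2 : (q - y) ^+ 2 <= 4 * (t' - s') ^+ 2.
  rewrite (_ : q - y = - ((1 - q) - (1 - y))) ?sqrrN; last by ring.
  rewrite qE' yE' (_ : (t' ^+ 2 - s' ^+ 2) ^+ 2 = (t' + s') ^+ 2 * (t' - s') ^+ 2); last by ring.
  by rewrite ler_wpM2r ?sqr_ge0//; nra.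
nra.
Qed.

(** A Pinsker-type inequality for the Bernoulli likelihood, obtained through the
    Hellinger affinity. *)
Lemma bernoulli_lik_le y q (N0 N1 : nat) : 0 <= y <= 1 -> 0 <= q <= 1 ->
  N0%:R = (N0 + N1)%:R * q ->
  y ^+ N0 * (1 - y) ^+ N1 <=
  q ^+ N0 * (1 - q) ^+ N1 * expR (- ((N0 + N1)%:R * (q - y) ^+ 2 / 2)).
Proof.
move=> y01 q01 NE; have /andP[y0 y1] := y01; have /andP[q0 q1] := q01.
have NE' : N1%:R = (N0 + N1)%:R * (1 - q).
  by rewrite mulrBr mulr1 -NE natrD addrC addKr.
have h0 := pow_le_hellinger y0 q0 NE.
have y1' : 0 <= 1 - y by rewrite subr_ge0.
have q1' : 0 <= 1 - q by rewrite subr_ge0.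
have h1 := pow_le_hellinger y1' q1' NE'.
apply: le_trans (ler_pM (exprn_ge0 _ y0) (exprn_ge0 _ y1') h0 h1) _.
rewrite mulrACA -expRD ler_wpM2l ?mulr_ge0 ?exprn_ge0// ler_expR.
have hl := hellinger_le y01 q01.
rewrite -mulrDr addrACA -mulrDr -opprD -natrD.
have N0' : (0 : R) <= (N0 + N1)%:R by [].
set N : R := (N0 + N1)%:R in N0' *; nra.
Qed.

(** From z <= exp (z - 1) for z = 2 q and z = 2 (1 - q), weighted by the
    counts. *)
Lemma bernoulli_chi2_le q (N0 N1 : nat) : 0 <= q <= 1 ->
  N0%:R = (N0 + N1)%:R * q ->
  2 ^+ (N0 + N1) * (q ^+ N0 * (1 - q) ^+ N1) <=
  expR ((N0 + N1)%:R * (2 * q - 1) ^+ 2).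
Proof.
move=> /andP[q0 q1] NE.
rewrite exprD mulrACA -!exprMn.
have e1 : 2 * q <= expR (2 * q - 1) by have := expR_ge1Dx (2 * q - 1); lra.
have e2 : 2 * (1 - q) <= expR (1 - 2 * q) by have := expR_ge1Dx (1 - 2 * q); lra.
apply: le_trans (ler_pM _ _ (lerXn2r N0 _ _ e1) (lerXn2r N1 _ _ e2)) _;
  rewrite ?nnegrE ?exprn_ge0 ?mulr_ge0 ?subr_ge0 ?expR_ge0//.
rewrite -!expRM_natr -expRD ler_expR.
have NE' : N1%:R = (N0 + N1)%:R * (1 - q).
  by rewrite mulrBr mulr1 -NE natrD addrC addKr.
by rewrite NE NE' le_eqVlt; apply/orP; left; apply/eqP; ring.
Qed.

Lemma bernoulli_ineq (x : R) n : -1 <= x -> 1 + n%:R * x <= (1 + x) ^+ n.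
Proof.
move=> x1; elim: n => [|n IH]; first by rewrite expr0 mul0r addr0.
have n0 : (0 : R) <= n%:R by [].
rewrite exprS; apply: le_trans (_ : _ <= (1 + x) * (1 + n%:R * x)) _.
  by rewrite -[n.+1]addn1 natrD; nra.
by rewrite ler_wpM2l//; lra.
Qed.

End binomial_likelihood.

Section beta_moments.
Context {R : realType} {d} {Om : measurableType d} (Q : probability Om R).
Variables (p : node -> R) (a : R).
Variables (S : node -> {RV Q >-> bool}) (Y : seq bool -> {RV Q >-> R}).
Hypothesis SY : opt_variables p a S Y.
Hypothesis a0 : 0 < a.

Local Notation Ysplit := (Ysplit Y).
Local Notation itv01 := ([set` `]0%R, 1%R[] : set R).

Definition beta_cst : R := \int[lebesgue_measure]_(y in itv01) beta_weight a a y.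

Lemma Ysplit_law v (A : set R) : measurable A ->
  Q (Ysplit v @^-1` A) = beta_law a a A.
Proof. by move=> mA; have [_ YA _ _] := SY; exact: YA. Qed.

Lemma beta_weight_ge0 y : 0 <= beta_weight a a y.
Proof. by rewrite mulr_ge0// powR_ge0. Qed.

Lemma beta_cst_gt0 : 0 < beta_cst.
Proof.
rewrite lt_neqAle andbC Rintegral_ge0/=; last by move=> y _; exact: beta_weight_ge0.
apply/eqP => /esym B0; have := Ysplit_law (0, 0)%N (@measurableT _ R).
rewrite preimage_setT probability_setT /beta_law.
rewrite -/beta_cst B0; under eq_integral do rewrite invr0 mulr0.
by rewrite integral0 => /eqP; rewrite onee_eq0.
Qed.

Lemma measurable_beta_weight : measurable_fun setT (beta_weight a a : R -> R).
Proof.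
apply: measurable_funM; first exact: measurable_powR.
by apply: (measurableT_comp (measurable_powR _)); exact: measurable_funB.
Qed.

Lemma beta_law_itv_ge (u t m : R) : 0 < m -> u <= t ->
  (forall y, u <= y <= t -> 0 < y < 1 /\ m <= y * (1 - y)) ->
  ((m `^ a / beta_cst * (t - u))%:E <= beta_law a a [set` `[u, t]])%E.
Proof.
move=> m0 ut H; rewrite /beta_law -/beta_cst.
have -> : [set` `[u, t]] `&` itv01 = [set` `[u, t]].
  by apply/setIidPl => y /=; rewrite !in_itv/= => /H[].
have -> : ((m `^ a / beta_cst * (t - u))%:E =
    \int[lebesgue_measure]_(y in [set` `[u, t]]) (cst (m `^ a / beta_cst)%:E) y)%E.
  rewrite integral_cst//= lebesgue_measure_itv/= lte_fin EFinM; congr (_ * _)%E.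
  case: ltP => // tu.
  by rewrite (_ : t - u = 0)//; apply/eqP; rewrite subr_eq0 eq_le ut tu.
have B0 := beta_cst_gt0.
apply: ge0_le_integral => //.
- by move=> y _; rewrite lee_fin divr_ge0 ?powR_ge0// ltW.
- apply/measurable_EFinP/measurable_funTS; apply: measurable_funM => //.
  exact: measurable_beta_weight.
move=> y; rewrite /= in_itv/= => /H[/andP[y0 y1] my].
rewrite lee_fin ler_pM2r ?invr_gt0//.
have z0 : 0 < y * (1 - y) by rewrite mulr_gt0// subr_gt0.
have -> : beta_weight a a y = (y * (1 - y)) `^ (a - 1).
  by rewrite /beta_weight powRM// ltW// subr_gt0.
apply: (@le_trans _ _ ((y * (1 - y)) `^ a)).
  by apply: ge0_ler_powR; rewrite ?nnegrE// ltW.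
apply: ger_powR; first by rewrite z0/=; nra.
by rewrite gerBl.
Qed.

Lemma Ysplit_ae v : {ae Q, forall w, 0 < Ysplit v w < 1}.
Proof.
exists (Ysplit v @^-1` (~` itv01)); split.
- rewrite -[X in measurable X]setTI; apply: measurable_funP => //.
  exact: measurableC.
- rewrite -[LHS]/(Q (Ysplit v @^-1` (~` itv01))) Ysplit_law; last exact: measurableC.
  by rewrite /beta_law setICl integral_set0.
- by move=> w /= h; rewrite in_itv/=.
Qed.

(** The likelihood factor of a split with N0 observations on the left and N1 on
    the right, killed off the support of the Beta law so as to be nonnegative. *)
Definition split_lik (N0 N1 : nat) (A : set R) (y : R) : R :=
  (2 * y) ^+ N0 * (2 * (1 - y)) ^+ N1 * \1_(itv01 `&` A) y.

Lemma split_lik_ge0 N0 N1 A y : 0 <= split_lik N0 N1 A y.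
Proof.
rewrite /split_lik indicE; case: (boolP (y \in _)) => [|_]; last by rewrite mulr0.
rewrite inE /= in_itv/= => -[/andP[y0 y1] _].
by rewrite mulr1 mulr_ge0// exprn_ge0// mulr_ge0// ?subr_ge0 ltW.
Qed.

Lemma measurable_split_lik N0 N1 A : measurable A ->
  measurable_fun setT (split_lik N0 N1 A).
Proof.
move=> mA; apply: measurable_funM.
  apply: measurable_funM; apply: measurable_funX.
    exact: measurable_funM.
  by apply: measurable_funM => //; exact: measurable_funB.
by apply/measurable_indicP; exact: measurableI.
Qed.

Definition split_mass (v : node) (N0 N1 : nat) (A : set R) : \bar R :=
  (\int[Q]_w (split_lik N0 N1 A (Ysplit v w))%:E)%E.

Lemma split_mass_le v N0 N1 (A : set R) (c : R) : measurable A ->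
  (forall y, 0 < y < 1 -> A y -> (2 * y) ^+ N0 * (2 * (1 - y)) ^+ N1 <= c) ->
  0 <= c -> (split_mass v N0 N1 A <= c%:E)%E.
Proof.
move=> mA H c0.
rewrite -[leRHS]mule1 -(@probability_setT _ _ _ Q) -integral_cst//.
apply: ge0_le_integral => //.
- by move=> w _; rewrite lee_fin split_lik_ge0.
- apply/measurable_EFinP; apply: measurableT_comp; first exact: measurable_split_lik.
  exact: measurable_funPT.
move=> w _; rewrite lee_fin /split_lik indicE; case: (boolP (_ \in _)) => [|_].
  rewrite inE /= in_itv/= => -[y01 Ay]; rewrite mulr1; exact: H.
by rewrite mulr0.
Qed.

(** The loss, polynomial in n, from replacing the peak of the likelihood of a
    split by its average under the Beta prior. *)
Definition beta_margin (n : nat) : R := (8 * n%:R) `^ (- (1 + 2 * a)) / beta_cst.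

(** On an interval of length 1/(4n) next to its maximizer q the likelihood is
    at least half its peak, since (1 - 1/(2n))^n >= 1/2, and such an interval
    has Beta probability at least a power of 1/n. *)
Lemma split_mass_ge v n N0 N1 q : (0 < n)%N -> (N0 + N1 <= n)%N -> 0 <= q <= 1 ->
  ((2 ^+ (N0 + N1) * (q ^+ N0 * (1 - q) ^+ N1) * beta_margin n)%:E <=
   split_mass v N0 N1 setT)%E.
Proof.
move=> n0 Nn /andP[q0 q1]; have B0 := beta_cst_gt0.
have np : (0 : R) < n%:R by rewrite ltr0n.
(* [u, t] shrinks q towards 1/2, to stay off the endpoints, by a relative e *)
pose e : R := (2 * n%:R)^-1; have e0 : 0 < e by rewrite invr_gt0 mulr_gt0.
have e1 : e <= 1 / 2.
  by rewrite div1r lef_pV2 ?posrE ?mulr_gt0// ler_peMr// ler1n.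
pose u := q * (1 - e) + e / 4; pose t := q * (1 - e) + 3 * e / 4.
have ut : u <= t by rewrite /u /t; lra.
have H y : u <= y <= t ->
    [/\ e / 4 <= y, e / 4 <= 1 - y, q * (1 - e) <= y & (1 - q) * (1 - e) <= 1 - y].
  by rewrite /u /t => /andP[h1 h2]; split; nra.
pose c := 2 ^+ (N0 + N1) * (q ^+ N0 * (1 - q) ^+ N1) / 2.
have c0 : 0 <= c by rewrite !mulr_ge0// ?exprn_ge0// ?subr_ge0// invr_ge0.
apply: (@le_trans _ _ (c%:E * Q (Ysplit v @^-1` [set` `[u, t]]))%E).
  rewrite Ysplit_law//.
  apply: le_trans (lee_wpmul2l _ (@beta_law_itv_ge u t (e / 4 * (e / 4)) _ ut _)).
  - rewrite -EFinM lee_fin /beta_margin.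
    have eE : e / 4 = (8 * n%:R)^-1 by rewrite /e; field; rewrite gt_eqF.
    have e8 : 0 < 8 * n%:R :> R by rewrite mulr_gt0.
    pose z : R := (8 * n%:R)^-1; have z0 : 0 < z by rewrite invr_gt0.
    have zE : (8 * n%:R) `^ (- (1 + 2 * a)) = z * (z * z) `^ a.
      rewrite -mulN1r powRrM powR_inv1 ?(ltW e8)// -/z.
      rewrite powRD; last by rewrite (gt_eqF z0) implybT.
      rewrite powRr1 ?(ltW z0)// mulr_natl mulr2n.
      rewrite powRD; last by rewrite (gt_eqF z0) implybT.
      by rewrite powRM ?(ltW z0).
    rewrite eE -/z zE (_ : t - u = 2 * z); last by rewrite /t /u /z -eE; lra.
    by rewrite le_eqVlt; apply/orP; left; apply/eqP; rewrite /c; field; rewrite gt_eqF.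
  - by rewrite lee_fin.
  - by rewrite mulr_gt0// divr_gt0.
  - move=> y /H[h1 h2 _ _]; split; first by lra.
    by rewrite ler_pM// divr_ge0// ltW.
have mut : measurable (Ysplit v @^-1` [set` `[u, t]]).
  by rewrite -[X in measurable X]setTI; apply: measurable_funP.
rewrite -[Q _]mul1e -integral_cst// -ge0_integralZl//.
rewrite integral_mkcond.
apply: ge0_le_integral => //.
- by move=> w _; rewrite patchE; case: ifP => // _; rewrite mule1 lee_fin.
- apply: (measurable_restrictT _ mut).1.
  exact: (measurable_cst (c%:E * 1)%E).
- apply/measurable_EFinP; apply: measurableT_comp; first exact: measurable_split_lik.
  exact: measurable_funPT.
move=> w _; rewrite patchE; case: ifP => [|_]; last by rewrite lee_fin split_lik_ge0.
rewrite inE /= in_itv/= => /H[h1 h2 h3 h4].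
rewrite mule1 lee_fin /split_lik indicE mem_set ?mulr1; last first.
  by split => //=; rewrite in_itv/=; apply/andP; split; lra.
have e1' : 0 <= 1 - e by lra.
have half : 1 / 2 <= (1 - e) ^+ (N0 + N1).
  have := @bernoulli_ineq _ (- e) (N0 + N1) ltac:(lra); apply: le_trans.
  have : (N0 + N1)%:R * e <= n%:R * e by rewrite ler_wpM2r ?ler_nat// ltW.
  by rewrite {2}/e invfM mulrCA divff ?gt_eqF//; lra.
rewrite !exprMn mulrACA -exprD /c -!mulrA ler_wpM2l ?exprn_ge0//.
apply: (@le_trans _ _ ((q * (1 - e)) ^+ N0 * ((1 - q) * (1 - e)) ^+ N1)).
  rewrite !exprMn mulrACA -exprD mulrA ler_wpM2l ?mulr_ge0 ?exprn_ge0 ?subr_ge0//.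
  by rewrite -div1r.
have qe : 0 <= q * (1 - e) by rewrite mulr_ge0.
have qe' : 0 <= (1 - q) * (1 - e) by rewrite mulr_ge0// subr_ge0.
have y0 : 0 <= Ysplit v w by lra.
have y1 : 0 <= 1 - Ysplit v w by lra.
by apply: ler_pM; rewrite ?exprn_ge0 ?lerXn2r ?nnegrE.
Qed.

End beta_moments.

(** * Posterior probabilities from masses of trees *)

Section posterior_mass.
Context {R : realType} {d} {Om : measurableType d} (Q : probability Om R).
Variables (p : node -> R) (a : R).
Variables (S : node -> {RV Q >-> bool}) (Y : seq bool -> {RV Q >-> R}).
Hypothesis SY : opt_variables p a S Y.
Hypothesis a0 : 0 < a.
Variables (L n : nat) (X : n.-tuple R).
Hypothesis Xu : forall i, unit_itv (tnth X i).

Local Notation Ysplit := (Ysplit Y).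
Local Notation conf := (conf S L).
Local Notation itv01 := ([set` `]0%R, 1%R[] : set R).
Local Notation splitsf s := (splits L (fun v => v \in s)).

Definition draw : Om -> (R -> R) * tree :=
  opt_draw L (fun v w => S v w) (fun eps w => Y eps w).

Definition lik (w : Om) : R := likelihood (draw w).1 X.

Definition left_count (v : node) := ncount X (child v false).
Definition right_count (v : node) := ncount X (child v true).

(** The integrated likelihood of the split at v when its split variable is
    confined to A. It is a real number, the integrand being bounded. *)
Definition Wset (v : node) (A : set R) : R := fine (split_mass Y v (left_count v) (right_count v) A).

Definition Wtot (v : node) : R := Wset v setT.

Lemma WsetE v A : measurable A -> split_mass Y v (left_count v) (right_count v) A = (Wset v A)%:E.
Proof.
move=> mA; rewrite /Wset fineK// ge0_fin_numE.
  apply: (@le_lt_trans _ _ (2 ^+ left_count v * 2 ^+ right_count v)%:E); last exact: ltry.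
  apply: split_mass_le => // y /andP[y0 y1] _.
  by apply: ler_pM; rewrite ?exprn_ge0 ?lerXn2r ?nnegrE//; lra.
by apply: integral_ge0 => w _; rewrite lee_fin split_lik_ge0.
Qed.

Lemma Wset_ge0 v A : 0 <= Wset v A.
Proof.
by apply: fine_ge0; apply: integral_ge0 => w _; rewrite lee_fin split_lik_ge0.
Qed.

Lemma splits_conf w v :
  splits L (fun u => S u w) v = splitsf (conf w) v.
Proof.
case: (boolP ((v.1 < L)%N && (v.2 < 2 ^ v.1)%N)) => [/andP[vL v2]|]; last first.
  by rewrite negb_and => /orP[]/negbTE h; rewrite /splits h ?andbF.
apply: splits_ext => i iv; rewrite mem_conf mem_nodes ancestor_lt// andbT /=.
by rewrite (leq_trans iv (ltnW vL)).
Qed.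

(** The likelihood restricted to split variables in prescribed sets and in the
    open unit interval: a version of [lik], almost surely, that is nonnegative
    everywhere. *)
Definition likS (A : node -> set R) (w : Om) : R :=
  \prod_(v <- nodes L) (if splitsf (conf w) v
    then split_lik (left_count v) (right_count v) (A v) (Ysplit v w) else 1).

Lemma likE w : lik w = \prod_(v <- nodes L) (if splitsf (conf w) v
  then (2 * Ysplit v w) ^+ left_count v * (2 * (1 - Ysplit v w)) ^+ right_count v else 1).
Proof.
rewrite /lik /draw /opt_draw /= likelihood_prod// big_mkcond /=.
apply: eq_bigr => v _; rewrite splits_conf; case: ifP => // _.
have [_ _ Yt _] := SY.
rewrite big_bool /= !word_of_child Yt mulrC.
by [].
Qed.

Lemma lik_ae : {ae Q, forall w, lik w = likS (fun=> setT) w}.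
Proof.
have H : {ae Q, forall w, all (fun v => 0 < Ysplit v w < 1) (nodes L)}.
  elim: (enum_fset (nodes L)) => [|v s IH]; first exact: aeW.
  by apply: filterS2 (Ysplit_ae SY v) IH => w /= -> ->.
apply: filterS H => w /allP H; rewrite likE.
apply: eq_big_seq => v vL; case: ifP => // _.
by rewrite /split_lik setIT indicE mem_set ?mulr1//= in_itv/=; exact: H.
Qed.

Lemma likS_ge0 A w : 0 <= likS A w.
Proof. by rewrite prodr_ge0// => v _; case: ifP => // _; rewrite split_lik_ge0. Qed.

Lemma measurable_conf_eq (s : {fset node}) : measurable [set w | conf w = s].
Proof.
case: (boolP (s `<=` nodes L)%fset) => sL; last first.
  rewrite [X in measurable X](_ : _ = set0)//.
  rewrite -subset0 => w /= ws; move/negP: sL; apply; rewrite -ws.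
  by apply/fsubsetP => v; rewrite mem_conf => /andP[].
rewrite [X in measurable X](_ : _ =
    \bigcap_(v in [set` nodes L]) (S v @^-1` [set (v \in s)])).
  by apply: fin_bigcap_measurable => // v _; exact: measurable_split.
apply/seteqP; split => [w /= <- v /= vL|w /= H].
  by rewrite mem_conf vL.
apply/fsetP => v; rewrite mem_conf; case: (boolP (v \in nodes L)) => vL /=.
  exact: (H v vL).
by apply/esym/negbTE; apply: contra vL; exact: (fsubsetP sL).
Qed.

Lemma measurable_conf (P : pred {fset node}) : measurable [set w | P (conf w)].
Proof.
rewrite [X in measurable X](_ : _ = \bigcup_(s in [set` fpowerset (nodes L)])
    ([set w | conf w = s] `&` [set w | P s])).
  apply: fin_bigcup_measurable => // s _; apply: measurableI.
    exact: measurable_conf_eq.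
  by case: (boolP (P s)) => Ps;
    [rewrite (_ : mkset _ = setT)|rewrite (_ : mkset _ = set0)]; rewrite // -?subTset -?subset0 => w.
apply/seteqP; split => [w /= Pw|w [s _ /= [-> //]]].
exists (conf w) => //=; rewrite fpowersetE.
by apply/fsubsetP => v; rewrite mem_conf => /andP[].
Qed.

Lemma measurable_prod_conf (F : node -> Om -> R) :
  (forall v, measurable_fun setT (F v)) ->
  measurable_fun setT (fun w => \prod_(v <- nodes L)
    (if splitsf (conf w) v then F v w else 1)).
Proof.
move=> mF; apply: measurable_prod => v _.
apply: measurable_fun_if => //; last by apply: measurable_funTS; exact: mF.
apply: (measurable_fun_bool true).
by rewrite setTI; exact: (measurable_conf (fun s => splitsf s v)).
Qed.

Lemma measurable_Ysplit v : measurable_fun setT (Ysplit v).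
Proof. exact: measurable_funPT. Qed.

Lemma measurable_lik : measurable_fun setT lik.
Proof.
rewrite (funext likE).
apply: measurable_prod_conf => v.
apply: measurable_funM; apply: measurable_funX; apply: measurable_funM => //.
by apply: measurable_funB => //; exact: measurable_Ysplit.
Qed.

Lemma measurable_likS A : (forall v, measurable (A v)) ->
  measurable_fun setT (likS A).
Proof.
move=> mA; apply: measurable_prod_conf => v.
apply: measurableT_comp; [exact: measurable_split_lik|exact: measurable_Ysplit].
Qed.

Lemma integral_lik (E : set Om) : measurable E ->
  (\int[Q]_(w in E) (lik w)%:E = \int[Q]_(w in E) (likS (fun=> setT) w)%:E)%E.
Proof.
move=> mE; apply: ae_eq_integral => //.
- by apply/measurable_EFinP/measurable_funTS; exact: measurable_lik.
- by apply/measurable_EFinP/measurable_funTS; exact: measurable_likS.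
by apply: filterS lik_ae => w -> _.
Qed.

Lemma integral_likS (c : {fset node} -> R) (A : node -> set R) :
  (forall s, 0 <= c s) -> (forall v, measurable (A v)) ->
  (\int[Q]_w (c (conf w) * likS A w)%:E =
   (\sum_(s <- fpowerset (nodes L)) c s * \prod_(v <- nodes L)
     (split_prob p v (v \in s) * (if splitsf s v then Wset v (A v) else 1)))%:E)%E.
Proof.
move=> c0 mA.
pose H (s : {fset node}) v y := if splitsf s v then split_lik (left_count v) (right_count v) (A v) y else 1.
have HE s v : (\int[Q]_w (H s v (Ysplit v w))%:E =
    (if splitsf s v then Wset v (A v) else 1)%:E)%E.
  rewrite /H; case: ifP => _; first exact: WsetE.
  by rewrite integral_cst// mul1e; exact: probability_setT.
rewrite (opt_integral SY L c0 (H := H))//.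
- rewrite -sumEFin; apply: eq_bigr => s _; rewrite EFinM; congr (_ * _)%E.
  rewrite -prodEFin; apply: eq_bigr => v _.
  by rewrite HE EFinM.
- by move=> s v; rewrite /H; case: (splitsf s v) => //; exact: measurable_split_lik.
- by move=> s v y; rewrite /H; case: ifP => // _; exact: split_lik_ge0.
- by move=> s v; rewrite HE ltry.
Qed.

Local Notation mass := (mass L p Wtot).

Lemma integral_likT (P : pred {fset node}) :
  (\int[Q]_w ((P (conf w))%:R * likS (fun=> setT) w)%:E = (mass P)%:E)%E.
Proof.
rewrite (integral_likS (c := fun s => (P s)%:R))//; congr EFin.
rewrite /mass big_mkcond [RHS]big_mkcond /=.
by apply: eq_bigr => s _; case: ifP => _; rewrite ?mul1r ?mul0r.
Qed.

Lemma integral_likS1 : (\int[Q]_w (likS (fun=> setT) w)%:E = (mass xpredT)%:E)%E.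
Proof. by rewrite -integral_likT; apply: eq_integral => w _; rewrite mul1r. Qed.

Lemma split_prob_le1 v : 0 <= p v <= 1.
Proof.
by have := split_prob_ge0 SY v true; have := split_prob_ge0 SY v false => /=; lra.
Qed.

Hypothesis W0 : forall v, v \in nodes L -> 0 < Wtot v.

Lemma massT_gt0 : 0 < mass xpredT.
Proof.
pose s0 : {fset node} := [fset v in nodes L | (1/2 < p v)%R]%fset.
have s0P : s0 \in fpowerset (nodes L).
  by rewrite fpowersetE; apply/fsubsetP => v; rewrite !inE => /andP[].
rewrite /mass (big_fsetD1 _ s0P)/= ltr_wpDr//.
  by rewrite sumr_ge0// => s _; apply: config_weight_ge0 => // v _; exact: split_prob_le1.
rewrite /config_weight big_seq prodr_gt0// => v vL; rewrite mulr_gt0//; last first.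
  by case: ifP => // _; exact: W0.
have -> : (v \in s0) = (1/2 < p v) by rewrite in_fset /= inE vL.
rewrite /split_prob; have := split_prob_le1 v.
by case: (ltP (1/2) (p v)) => h /=; lra.
Qed.

(** Given the tree, the posterior keeps the split variables independent, and
    that of v falls into A with probability Wset v A / Wtot v. *)
Lemma mass_bad_split v (A : set R) : v \in nodes L -> measurable A ->
  (\int[Q]_w ((splitsf (conf w) v)%:R *
     likS (fun u => if u == v then A else setT) w)%:E <=
   (Wset v A / Wtot v * mass xpredT)%:E)%E.
Proof.
move=> vL mA; rewrite (integral_likS (c := fun s => (splitsf s v)%:R))//; last first.
  by move=> u; case: ifP.
rewrite lee_fin /mass mulr_sumr; apply: ler_sum => s _.
case: (boolP (splitsf s v)) => sv; last first.
  rewrite mul0r mulr_ge0 ?divr_ge0 ?Wset_ge0//.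
  by apply: config_weight_ge0 => // u _; exact: split_prob_le1.
rewrite mul1r /config_weight !(big_fsetD1 _ vL)/= eqxx sv.
set B := \prod_(i <- _) _; set B' := \prod_(i <- _) _.
have -> : B' = B.
  apply: eq_big_seq => u; rewrite in_fsetD1 => /andP[uv _].
  by rewrite (negbTE uv).
rewrite le_eqVlt; apply/orP; left; apply/eqP; field.
by rewrite gt_eqF// W0.
Qed.

(** Trees are compared through [mass] and split variables one at a time: a set of
    draws has small posterior probability as soon as each of them either has a
    split pattern in a set of small mass, or a split variable in a set that is
    unlikely given the two counts of that split. *)
Lemma posterior_le (B : set ((R -> R) * tree)) (P : pred {fset node})
    (bad : node -> set R) :
  measurable (draw @^-1` B) -> (forall v, measurable (bad v)) ->
  (forall w, (forall v, v \in nodes L -> splitsf (conf w) v -> 0 < Ysplit v w < 1) ->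
     B (draw w) ->
     P (conf w) \/ exists v, [/\ v \in nodes L, splitsf (conf w) v & bad v (Ysplit v w)]) ->
  posterior Q draw X B <=
  mass P / mass xpredT + \sum_(v <- nodes L) Wset v (bad v) / Wtot v.
Proof.
move=> mB mbad HB; rewrite /posterior /Rintegral !integral_lik//.
rewrite integral_likS1 /= ler_pdivrMr ?massT_gt0// mulrDl divfK ?gt_eqF ?massT_gt0//.
rewrite -lee_fin fineK; last first.
  rewrite ge0_fin_numE; last by apply: integral_ge0 => w _; rewrite lee_fin likS_ge0.
  apply: (@le_lt_trans _ _ (\int[Q]_w (likS (fun=> setT) w)%:E)%E).
    apply: ge0_subset_integral => //; last by move=> w _; rewrite lee_fin likS_ge0.
    by apply/measurable_EFinP; exact: measurable_likS.
  by rewrite integral_likS1 ltry.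
apply: (@le_trans _ _ (\int[Q]_w ((P (conf w))%:R * likS (fun=> setT) w)%:E +
  \sum_(v <- nodes L) \int[Q]_w ((splitsf (conf w) v)%:R *
     likS (fun u => if u == v then bad v else setT) w)%:E)%E); last first.
  rewrite integral_likT EFinD leeD2l// mulr_suml -sumEFin.
  rewrite big_seq [leRHS]big_seq; apply: lee_sum => v vL.
  exact: mass_bad_split.
have mb v u : measurable (if u == v then bad v else setT) by case: ifP.
have mP (P' : pred {fset node}) A : (forall v, measurable (A v)) ->
    measurable_fun setT (fun w => (P' (conf w))%:R * likS A w).
  move=> mA; apply: measurable_funM; last exact: measurable_likS.
  rewrite (_ : (fun w => _) = \1_[set w | P' (conf w)]).
    by apply/measurable_indicP; exact: measurable_conf.
  by apply/funext => w; rewrite indicE; congr ((nat_of_bool _)%:R);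
    apply/idP/idP; rewrite inE.
rewrite -ge0_integral_sum//; last 2 first.
- by move=> v; apply/measurable_EFinP; apply: (mP (fun s => splitsf s v)).
- by move=> v w _; rewrite lee_fin mulr_ge0// likS_ge0.
rewrite -ge0_integralD//; last 4 first.
- by move=> w _; rewrite lee_fin mulr_ge0// likS_ge0.
- by apply/measurable_EFinP; exact: mP.
- by move=> w _; apply: sume_ge0 => v _; rewrite lee_fin mulr_ge0// likS_ge0.
- apply: emeasurable_sum => v; apply/measurable_EFinP.
  by apply: (mP (fun s => splitsf s v)).
rewrite [leLHS]integral_mkcond; apply: ge0_le_integral => //.
- by move=> w _; rewrite patchE; case: ifP => // _; rewrite lee_fin likS_ge0.
- apply: (measurable_restrictT _ mB).1; apply/measurable_EFinP.
  by apply: measurable_funTS; exact: measurable_likS.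
- apply: emeasurable_funD; first by apply/measurable_EFinP; exact: mP.
  apply: emeasurable_sum => v; apply/measurable_EFinP.
  by apply: (mP (fun s => splitsf s v)).
move=> w _.
have sum0 : (0 <= \sum_(v <- nodes L) ((splitsf (conf w) v)%:R *
     likS (fun u => if u == v then bad v else setT) w)%:E)%E.
  by apply: sume_ge0 => v _; rewrite lee_fin mulr_ge0// likS_ge0.
have rhs0 : (0 <= ((P (conf w))%:R * likS (fun=> setT) w)%:E +
    \sum_(v <- nodes L) ((splitsf (conf w) v)%:R *
     likS (fun u => if u == v then bad v else setT) w)%:E)%E.
  by rewrite adde_ge0// lee_fin mulr_ge0// likS_ge0.
rewrite patchE; case: ifP => // /set_mem Bw.
case: (boolP (all (fun v => splitsf (conf w) v ==> (0 < Ysplit v w < 1)) (nodes L))).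
  move=> /allP HY; have HY' v : v \in nodes L -> splitsf (conf w) v -> 0 < Ysplit v w < 1.
    by move=> vL sv; have := HY v vL; rewrite sv.
  have [Pw|[v [vL sv bv]]] := HB w HY' Bw.
    by rewrite Pw mul1r leeDl.
  rewrite (big_fsetD1 _ vL)/= sv mul1r addeCA.
  rewrite [X in (X <= _)%E](_ : _ =
      (likS (fun u => if u == v then bad v else setT) w)%:E); last first.
    congr EFin; rewrite /likS; apply: eq_big_seq => u uL; case: ifP => // su.
    rewrite /split_lik; congr (_ * _); rewrite setIT !indicE.
    congr ((nat_of_bool _)%:R); apply/idP/idP; rewrite !inE; last by case.
    by move=> ?; split => //; case: eqP => // ->.
  rewrite leeDl//; apply: adde_ge0; first by rewrite lee_fin mulr_ge0// likS_ge0.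
  by apply: sume_ge0 => u _; rewrite lee_fin mulr_ge0// likS_ge0.
move=> /allPn[v vL]; rewrite negb_imply => /andP[sv Yv].
rewrite [X in (X <= _)%E](_ : _ = 0%E)//; congr EFin.
rewrite /likS (big_fsetD1 _ vL)/= sv {1}/split_lik indicE memNset ?mulr0 ?mul0r//.
by move=> [/=]; rewrite in_itv/= (negbTE Yv).
Qed.

Lemma posterior_ge0 (B : set ((R -> R) * tree)) :
  measurable (draw @^-1` B) -> 0 <= posterior Q draw X B.
Proof.
move=> mB; rewrite /posterior /Rintegral !integral_lik//.
by rewrite divr_ge0// fine_ge0// integral_ge0// => w _; rewrite lee_fin likS_ge0.
Qed.

Lemma posterior_setC (B : set ((R -> R) * tree)) :
  measurable (draw @^-1` B) ->
  posterior Q draw X B = 1 - posterior Q draw X (~` B).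
Proof.
move=> mB; have mBC : measurable (draw @^-1` (~` B)).
  by rewrite preimage_setC; exact: measurableC.
rewrite /posterior /Rintegral -/lik !integral_lik//.
have D0 := massT_gt0.
have split : (\int[Q]_w (likS (fun=> setT) w)%:E =
    \int[Q]_(w in draw @^-1` B) (likS (fun=> setT) w)%:E +
    \int[Q]_(w in draw @^-1` (~` B)) (likS (fun=> setT) w)%:E)%E.
  rewrite -ge0_integral_setU//.
  - by rewrite -preimage_setU setUv preimage_setT.
  - by apply/measurable_EFinP/measurable_funTS; exact: measurable_likS.
  - by move=> w _; rewrite lee_fin likS_ge0.
  - by rewrite preimage_setC; apply/disj_setPCl.
rewrite integral_likS1 in split *.
move: split; set I1 := integral _ _ _; set I2 := integral _ _ _ => split.
have I10 : (0 <= I1)%E by apply: integral_ge0 => w _; rewrite lee_fin likS_ge0.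
have I20 : (0 <= I2)%E by apply: integral_ge0 => w _; rewrite lee_fin likS_ge0.
case: I1 I10 split => [x| |]//; case: I2 I20 => [y| |]// _ _ [DE].
by rewrite /=; apply/eqP; rewrite eq_sym subr_eq -mulrDl -DE divff// gt_eqF.
Qed.

End posterior_mass.

(** * Haar sums and local averages *)

Section haar_basis.
Context {R : realType}.
Implicit Types (x : R) (m : node -> R).

Lemma sqrt_pow2 (l : nat) : (2 : R) `^ (l%:R / 2) * 2 `^ (l%:R / 2) = 2 ^+ l.
Proof.
rewrite -powRD; last by rewrite pnatr_eq0 implybT.
by rewrite -powR_mulrn//; congr (_ `^ _); lra.
Qed.

Lemma dyadicE (v : node) x :
  (x \in dyadic v) = (v.2%:R <= 2 ^+ v.1 * x < v.2.+1%:R).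
Proof.
by rewrite /dyadic in_itv /= ler_pdivrMr ?exprn_gt0// ltr_pdivlMr ?exprn_gt0// (mulrC x).
Qed.

Lemma child_bounds v : [/\ (child v false).2%:R = 2 * v.2%:R :> R,
  (child v true).2%:R = 2 * v.2%:R + 1 :> R & (child v true).2.+1%:R = 2 * v.2%:R + 2 :> R].
Proof.
have e0 : (2 * v.2)%N%:R = 2 * v.2%:R :> R by rewrite natrM.
have e1 : (2 * v.2).+1%:R = 2 * v.2%:R + 1 :> R by rewrite -natr1 e0.
by split => //; rewrite /= -natr1 e1 -addrA.
Qed.

(** Each Haar function is a signed and scaled indicator of two sibling cells,
    so its coefficients are differences of masses. *)
Lemma haarE l k x :
  haar l k x = 2 `^ (l%:R / 2) *
    ((x \in dyadic (child (l, k) true))%:R - (x \in dyadic (child (l, k) false))%:R).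
Proof.
have [e0 e1 e2] := child_bounds (l, k).
rewrite /haar /haar_mother !dyadicE e0 e2 !e1.
rewrite !in_itv /= exprS -mulrA; move: (2 ^+ l * x) (k%:R : R) => t u.
by congr (_ * ((nat_of_bool _)%:R - (nat_of_bool _)%:R));
  apply/idP/idP => /andP[? ?]; apply/andP; split; lra.
Qed.

(** Shared by the empirical measure and by the true law, whose Haar expansions
    are then treated at once. *)
Definition additive_mass m := forall v, (v.2 < 2 ^ v.1)%N ->
  m v = m (child v false) + m (child v true).

Definition haar_term m (v : node) x : R :=
  2 `^ (v.1%:R / 2) * (m (child v true) - m (child v false)) * haar v.1 v.2 x.

Lemma haar_term_node m x l : additive_mass m -> unit_itv x ->
  haar_term m (node_at x l) x =
  2 ^+ l.+1 * m (node_at x l.+1) - 2 ^+ l * m (node_at x l).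
Proof.
move=> madd xu; have x0 := unit_itv_ge0 xu.
rewrite /haar_term haarE /= -/(node_at x l) !mem_dyadic_child//= !eqxx /=.
rewrite (madd (node_at x l)) ?cell_lt// node_atS// exprS.
transitivity (2 ^+ l * (m (child (node_at x l) true) - m (child (node_at x l) false))
    * ((true == odd (cell x l.+1))%:R - (false == odd (cell x l.+1))%:R)).
  by rewrite -sqrt_pow2; ring.
by case: odd; rewrite /=; ring.
Qed.

Lemma haar_term_off m x l k : unit_itv x -> k != cell x l ->
  haar_term m (l, k) x = 0.
Proof.
move=> xu kx; have x0 := unit_itv_ge0 xu.
rewrite /haar_term haarE !mem_dyadic_child//= xpair_eqE eqxx (negbTE kx) /=.
by rewrite subrr !mulr0.
Qed.

(** At each level only the cell of x contributes, and the contributions are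
    increments of the local average, hence telescope. *)
Lemma haar_sum_tree m (I : pred node) (L j : nat) x : additive_mass m ->
  unit_itv x -> (j <= L.+1)%N -> (forall l, (l <= L)%N -> I (node_at x l) = (l < j)%N) ->
  \sum_(v <- nodes L | I v) haar_term m v x =
  2 ^+ j * m (node_at x j) - m (0, 0)%N.
Proof.
move=> madd xu jL Ix; rewrite big_mkcond big_nodes /=.
transitivity (\sum_(l < L.+1 | (l < j)%N)
    (2 ^+ l.+1 * m (node_at x l.+1) - 2 ^+ l * m (node_at x l))).
  rewrite [RHS]big_mkcond; apply: eq_bigr => l _.
  rewrite (big_level _ (F := fun v => if I v then haar_term m v x else 0) xu).
    by rewrite Ix ?haar_term_node// -ltnS.
  by move=> k _ kx; rewrite haar_term_off// if_same.
rewrite -(big_ord_widen _ (fun l => 2 ^+ l.+1 * m (node_at x l.+1) - 2 ^+ l * m (node_at x l)) jL).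
rewrite -(big_mkord xpredT (fun l => 2 ^+ l.+1 * m (node_at x l.+1) - 2 ^+ l * m (node_at x l))).
rewrite telescope_sumr//.
have c0 : cell x 0 = 0%N by apply/eqP; have := cell_lt 0 xu; rewrite expn0 ltnS leqn0.
by have -> : node_at x 0 = (0, 0)%N by [rewrite /node_at c0]; rewrite expr0 mul1r.
Qed.

End haar_basis.

Section holder_densities.
Context {R : realType}.
Variables (alpha K mu : R) (f : R -> R).
Hypothesis alpha0 : 0 < alpha.
Hypothesis K0 : 0 < K.
Hypothesis mu0 : 0 < mu.
Hypothesis fD : density_class alpha K mu f.

Local Notation lambda := (@lebesgue_measure R).

Definition scale (l : nat) : R := (2 ^- l) `^ alpha.

Lemma scale_ge0 l : 0 <= scale l. Proof. exact: powR_ge0. Qed.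

Lemma scale0 : scale 0 = 1. Proof. by rewrite /scale expr0 invr1 powR1. Qed.

Lemma holder_cell v x y : (v.2 < 2 ^ v.1)%N -> x \in dyadic v -> y \in dyadic v ->
  `|f x - f y| <= K * scale v.1.
Proof.
move=> v2 xv yv; have [_ _ fH] := fD.
have xu := dyadic_unit v2 xv; have yu := dyadic_unit v2 yv.
have [->|xy] := eqVneq x y; first by rewrite subrr normr0 mulr_ge0 ?scale_ge0 ?ltW.
have d0 : 0 < `|x - y| by rewrite normr_gt0 subr_eq0.
have := fH x y xu yu xy; rewrite ler_pdivrMr ?powR_gt0// => /le_trans; apply.
rewrite ler_wpM2l ?(ltW K0)// ge0_ler_powR ?nnegrE ?invr_ge0 ?exprn_ge0 ?(ltW alpha0)//.
have p0 : (0 : R) < 2 ^+ v.1 by rewrite exprn_gt0.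
rewrite -[2 ^- v.1]mul1r ler_pdivlMr// mulrC -[X in X * _](gtr0_norm p0) -normrM.
move: xv yv; rewrite !dyadicE -[v.2.+1]addn1 natrD mulrBr => /andP[h1 h2] /andP[h3 h4].
by rewrite ler_norml; apply/andP; split; lra.
Qed.

Lemma scale_cvg0 : scale @ \oo --> (0 : R).
Proof.
have E l : scale l = (2^-1 `^ alpha) ^+ l.
  rewrite /scale -exprVn -powR_mulrn ?powR_ge0// -powRrM mulrC powRrM.
  by rewrite powR_mulrn// invr_ge0.
rewrite (funext E); apply: cvg_expr.
rewrite ger0_norm ?powR_ge0//.
have := @gt0_ltr_powR R alpha alpha0 2^-1 1.
by rewrite !nnegrE powR1; apply; lra.
Qed.

Lemma measurable_unit_itv : measurable (@unit_itv R).
Proof. exact: measurable_itv. Qed.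

Lemma measurable_density : measurable_fun unit_itv f.
Proof.
pose g (l : nat) (x : R) : R := \sum_(k < 2 ^ l) f (lpoint (l, nat_of_ord k)) * \1_[set` dyadic (l, nat_of_ord k)] x.
have gE l x : unit_itv x -> g l x = f (lpoint (node_at x l)).
  move=> xu; have x0 := unit_itv_ge0 xu.
  rewrite /g (big_level _ (F := fun v => f (lpoint v) * \1_[set` dyadic v] x) xu).
    by rewrite indicE mem_set ?mulr1//; exact: node_at_dyadic.
  move=> k _ kx; rewrite indicE memNset ?mulr0//=.
  by apply/negP; rewrite mem_dyadic.
apply: (@measurable_fun_cvg _ _ _ unit_itv g).
  move=> l; apply: measurable_sum => k; apply: measurable_funM => //.
move=> x xu; have x0 := unit_itv_ge0 xu.
apply/cvgrPdist_le => e e0.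
have e1 : 0 < e / K by rewrite divr_gt0.
have /cvgr0Pnorm_le/(_ _ e1) := scale_cvg0; apply: filterS => l.
rewrite ger0_norm ?scale_ge0// => sl; rewrite gE//.
have h2 : ((node_at x l).2 < 2 ^ (node_at x l).1)%N by exact: cell_lt.
apply: le_trans (holder_cell h2 (node_at_dyadic l x0) (lpoint_dyadic _)) _.
by rewrite /= -ler_pdivlMl// mulrC.
Qed.

Lemma density_ge0 x : unit_itv x -> 0 <= f x.
Proof. by have [fmu _ _] := fD; move=> /fmu; exact/le_trans/ltW. Qed.

Lemma integrable_density : lambda.-integrable unit_itv (EFin \o f).
Proof.
apply/integrableP; split; first by apply/measurable_EFinP; apply: measurable_density.
have [_ f1 _] := fD; rewrite (_ : integral _ _ _ = 1%E) ?ltry// -[RHS]f1.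
apply: eq_integral => x /set_mem xu /=; rewrite ger0_norm//; exact: density_ge0.
Qed.

Lemma dyadic_sub v : (v.2 < 2 ^ v.1)%N -> [set` dyadic v] `<=` @unit_itv R.
Proof. by move=> v2 x; exact: dyadic_unit. Qed.

Lemma integrable_dyadic v : (v.2 < 2 ^ v.1)%N ->
  lambda.-integrable [set` dyadic v] (EFin \o f).
Proof.
move=> v2; apply: integrableS integrable_density => //; first exact: measurable_unit_itv.
exact: dyadic_sub.
Qed.

Definition pmass (v : node) : R := \int[lambda]_(x in [set` dyadic v]) f x.

Lemma lambda_dyadic v : lambda [set` dyadic v] = (2 ^- v.1)%:E.
Proof.
rewrite lebesgue_measure_itv/= lte_fin ltr_pM2r ?invr_gt0 ?exprn_gt0// ltr_nat leqnn.
by rewrite -EFinB -mulrBl -natr1 addrAC subrr add0r mul1r.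
Qed.

Lemma integrable_cst_dyadic v c : lambda.-integrable [set` dyadic v] (fun=> c%:E).
Proof.
apply/integrableP; split; first exact: measurable_cst.
rewrite /= integral_cst// [X in (_ * X)%E](_ : _ = (2 ^- v.1)%:E); last exact: lambda_dyadic.
by rewrite -EFinM ltry.
Qed.

Lemma pmass_le v c : (v.2 < 2 ^ v.1)%N -> (forall x, x \in dyadic v -> f x <= c) ->
  2 ^+ v.1 * pmass v <= c.
Proof.
move=> v2 fc; rewrite mulrC -ler_pdivlMr ?exprn_gt0//.
have -> : c / 2 ^+ v.1 = \int[lambda]_(x in [set` dyadic v]) c.
  rewrite Rintegral_cst//; congr (_ * _); exact: (esym (congr1 fine (lambda_dyadic v))).
apply: le_Rintegral => //; first exact: integrable_dyadic.
exact: integrable_cst_dyadic.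
Qed.

Lemma pmass_ge v c : (v.2 < 2 ^ v.1)%N -> (forall x, x \in dyadic v -> c <= f x) ->
  c <= 2 ^+ v.1 * pmass v.
Proof.
move=> v2 fc; rewrite mulrC -ler_pdivrMr ?exprn_gt0//.
have -> : c / 2 ^+ v.1 = \int[lambda]_(x in [set` dyadic v]) c.
  rewrite Rintegral_cst//; congr (_ * _); exact: (esym (congr1 fine (lambda_dyadic v))).
apply: le_Rintegral => //; last exact: integrable_dyadic.
exact: integrable_cst_dyadic.
Qed.

Lemma pmass_near v x : (v.2 < 2 ^ v.1)%N -> x \in dyadic v ->
  `|2 ^+ v.1 * pmass v - f x| <= K * scale v.1.
Proof.
move=> v2 xv; rewrite ler_norml lerBlDr lerBrDr; apply/andP; split.
  apply: pmass_ge => // y yv.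
  by have := holder_cell v2 xv yv; rewrite ler_norml => /andP[h1 h2]; lra.
apply: pmass_le => // y yv.
by have := holder_cell v2 xv yv; rewrite ler_norml => /andP[h1 h2]; lra.
Qed.

Lemma dyadic_root : dyadic (0, 0)%N = `[(0 : R), 1[.
Proof. by rewrite /dyadic /= expr0 mul0r divr1. Qed.

Lemma pmass_root : pmass (0, 0)%N = 1.
Proof.
by have [_ f1 _] := fD; rewrite /pmass dyadic_root /Rintegral -/unit_itv f1.
Qed.

(** A density takes a value at most 1 somewhere, and f oscillates by at most
    K. *)
Lemma density_le x : unit_itv x -> f x <= 1 + K.
Proof.
move=> xu; have xv : x \in dyadic (0, 0)%N by rewrite dyadic_root.
have := @pmass_near (0, 0)%N x isT xv.
rewrite /= expr0 mul1r pmass_root scale0 mulr1 ler_norml => /andP[h _]; lra.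
Qed.

Lemma pmass_bounds v : (v.2 < 2 ^ v.1)%N -> mu <= 2 ^+ v.1 * pmass v <= 1 + K.
Proof.
move=> v2; apply/andP; split.
  apply: pmass_ge => // x xv; have [fmu _ _] := fD; apply: fmu.
  exact: dyadic_unit xv.
apply: pmass_le => // x xv; apply: density_le; exact: dyadic_unit xv.
Qed.

Lemma dyadic_children v : [set` dyadic v] =
  [set` dyadic (child v false)] `|` [set` dyadic (child v true)] :> set R.
Proof.
have [e0 e1 e2] := @child_bounds R v.
have e3 : v.2.+1%:R = v.2%:R + 1 :> R by rewrite natr1.
apply/seteqP; split => x /=; rewrite !dyadicE e0 e2 !e1 e3 /= exprS -mulrA;
  move: (2 ^+ v.1 * x) (v.2%:R : R) => t u.
  move=> /andP[h1 h2]; case: (ltP (2 * t) (2 * u + 1)) => h.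
    by left; apply/andP; split; lra.
  by right; apply/andP; split; lra.
by move=> [] /andP[h1 h2]; apply/andP; split; lra.
Qed.

Lemma pmass_additive : additive_mass pmass.
Proof.
move=> v v2; rewrite {1}/pmass dyadic_children Rintegral_setU//.
- by rewrite -dyadic_children; exact: integrable_dyadic.
apply/eqP; rewrite -subset0 => x [/= h0 h1].
have x0 : 0 <= x.
  by apply: unit_itv_ge0; apply: dyadic_unit h0; exact: child_lt.
move: h0 h1; rewrite !mem_dyadic_child// => /andP[_ /eqP <-].
by rewrite andbF.
Qed.

Lemma inner_father : inner f haar_father = 1.
Proof.
have [_ f1 _] := fD; rewrite /inner /Rintegral -[RHS]/(fine 1%E) -f1; congr fine.
apply: eq_integral => x /set_mem xu; rewrite /haar_father.
by move: xu; rewrite /unit_itv /= => ->; rewrite mulr1.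
Qed.

Lemma inner_haar l k : (k < 2 ^ l)%N ->
  inner f (haar l k) =
  2 `^ (l%:R / 2) * (pmass (child (l, k) true) - pmass (child (l, k) false)).
Proof.
move=> kl; set v := (l, k).
have ci b : lambda.-integrable unit_itv
    (EFin \o (f \_ [set` dyadic (child v b)])).
  rewrite -restrict_EFin; apply/integrable_restrict => //; first exact: measurable_unit_itv.
  rewrite setIidr; first by apply: integrable_dyadic; exact: child_lt.
  by apply: dyadic_sub; exact: child_lt.
have cE b : pmass (child v b) = \int[lambda]_(x in unit_itv)
    (f \_ [set` dyadic (child v b)]) x.
  rewrite -Rintegral_mkcondr setIidr//.
  by apply: dyadic_sub; exact: child_lt.
have mu_itv : measurable (@unit_itv R : set (measurableTypeR R)).
  exact: measurable_unit_itv.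
rewrite !cE -RintegralB// -RintegralZl//; last first.
  have := integrableB mu_itv (ci true) (ci false).
  by apply: eq_integrable => // x _ /=; rewrite EFinB.
rewrite /inner; apply: eq_Rintegral => x _; rewrite haarE mulrCA; congr (_ * _).
by rewrite !patchE !mem_setE mulrBr; do 2 case: ifP => _; rewrite ?mulr1 ?mulr0.
Qed.

Lemma haar_projE j x : unit_itv x -> haar_proj j f x = 2 ^+ j * pmass (node_at x j).
Proof.
move=> xu; rewrite /haar_proj inner_father mul1r.
have -> : haar_father x = 1 :> R.
  by rewrite /haar_father; move: xu; rewrite /unit_itv /= => ->.
have := haar_sum_tree (L := j) (I := fun v => (v.1 < j)%N) pmass_additive xu (leqnSn j)
  (fun l _ => erefl).
rewrite pmass_root big_mkcond big_nodes /= => E.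
rewrite -[RHS](subrK 1) -E addrC; congr (_ + 1).
rewrite [RHS]big_ord_recr /= [X in _ = _ + X]big1 ?addr0; last by move=> k _; rewrite ltnn.
apply: eq_bigr => l _; rewrite ltn_ord; apply: eq_bigr => k _.
by rewrite inner_haar.
Qed.

End holder_densities.

(** * Deviations of the cell counts *)

Section cell_events.
Context {R : realType}.

(** Everything that is computed from the sample reads it only through finitely
    many dyadic cells, whence measurability of all the events. *)
Lemma measurable_cells n (L : nat) (E : set (n.-tuple (measurableTypeR R))) :
  (forall X X' : n.-tuple (measurableTypeR R), (forall (i : 'I_n) v, v \in nodes L ->
     ((tnth X i : R) \in dyadic v) = ((tnth X' i : R) \in dyadic v)) -> E X -> E X') ->
  measurable E.
Proof.
move=> EE.
pose sg (X : n.-tuple (measurableTypeR R)) : {ffun 'I_n * nodes L -> bool} :=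
  [ffun iu => (tnth X iu.1 : R) \in dyadic (val iu.2)].
have mD (v : node) (b : bool) : measurable [set x : measurableTypeR R | ((x : R) \in dyadic v) = b].
  case: b; first exact: measurable_itv.
  rewrite [X in measurable X](_ : _ = ~` [set` dyadic v]); first exact: measurableC.
  by apply/seteqP; split => x /=; [move=> ->|move/negP/negbTE].
have mt i : measurable_fun [set: n.-tuple (measurableTypeR R)] (@tnth _ (measurableTypeR R) ^~ i).
  exact: measurable_tnth.
have msg s : measurable [set X | sg X = s].
  rewrite [X in measurable X](_ : _ = \bigcap_(iu in [set: 'I_n * nodes L])
    ((@tnth _ (measurableTypeR R) ^~ iu.1) @^-1`
       [set x : measurableTypeR R | ((x : R) \in dyadic (val iu.2)) = s iu])).
    apply: fin_bigcap_measurable; first exact: finite_finset.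
    move=> iu _; rewrite -[X in measurable X]setTI; exact: mt.
  apply/seteqP; split => [X /= <- iu _ /=|X /= H]; first by rewrite ffunE.
  by apply/ffunP => iu; rewrite ffunE; exact: H.
rewrite [X in measurable X](_ : _ = \bigcup_(s in [set s | exists2 X, E X & sg X = s])
    [set X | sg X = s]).
  by apply: fin_bigcup_measurable => //; exact: finite_finset.
apply/seteqP; split => [X EX|X [s [X' EX' sE] /= sXs]]; first by exists (sg X) => //; exists X.
apply: EE EX' => i v vL; have := congr1 (fun g : {ffun _ -> bool} => g (i, [` vL]%fset)) sE.
by rewrite -sXs !ffunE.
Qed.

Lemma ncount_cells n (L : nat) (X X' : n.-tuple R) v : v \in nodes L ->
  (forall (i : 'I_n) v, v \in nodes L ->
     (tnth X i \in dyadic v) = (tnth X' i \in dyadic v)) ->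
  ncount X v = ncount X' v.
Proof.
move=> vL H; rewrite /ncount -!sum1_count !big_tuple !big_mkcond /=.
by rewrite [LHS]big_mkcond [RHS]big_mkcond; apply: eq_bigr => i _; rewrite H.
Qed.

End cell_events.

Section chernoff.
Context {R : realType}.
Variables (n : nat) (f : R -> R) (P0 : probability (n.-tuple (measurableTypeR R)) R).
Hypothesis fP : sample_law f P0.
Hypothesis f1 : (\int[lebesgue_measure]_(x in unit_itv) (f x)%:E = 1)%E.

Let q (A : set R) : \bar R := (\int[lebesgue_measure]_(x in A `&` unit_itv) (f x)%:E)%E.

Let tn (i : 'I_n) : n.-tuple (measurableTypeR R) -> R := fun X => tnth X i.

Lemma sample_marginal i (B : set R) : measurable B -> P0 (tn i @^-1` B) = q B.
Proof.
move=> mB; have := fP (A := fun j => if j == i then B else setT).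
move=> /(_ (fun j => ltac:(by case: ifP))).
rewrite (bigD1 i)//= eqxx big1 ?mule1; last first.
  by move=> j ji; rewrite (negbTE ji) setTI f1.
rewrite -/(q B) => <-; congr (P0 _); apply/seteqP; split => X /=.
  by move=> BX j; case: eqP => [->|].
by move=> /(_ i); rewrite eqxx.
Qed.

Lemma sample_indep : mutual_independence P0
  (fun i : 'I_n => preimage_set_system setT (tn i) measurable).
Proof.
move=> J E EG.
have : forall i, exists B : set R, measurable B /\ (i \in J -> E i = tn i @^-1` B).
  move=> i; case: (boolP (i \in J)) => iJ; last by exists setT; split.
  by have [B mB <-] := EG i iJ; exists B; split => //; rewrite setTI.
move=> /choice[B BE].
have mB i : measurable (B i) by have [] := BE i.
have := fP (A := fun j => if j \in J then B j else setT).
move=> /(_ (fun j => ltac:(by case: ifP))).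
rewrite (_ : [set X | _] = \bigcap_(i in [set` J]) E i); last first.
  apply/seteqP; split => X /= H.
    by move=> i /= iJ; have [_ ->//] := BE i; have := H i; rewrite iJ.
  move=> i; case: ifP => // iJ; have := H i iJ.
  by have [_ ->] := BE i.
move=> ->; rewrite (bigID (fun i => i \in J))/= [X in (_ * X)%E]big1 ?mule1; last first.
  by move=> i /negbTE ->; rewrite setTI f1.
rewrite -[LHS]big_filter (perm_big (enum_fset J)) /=; last first.
  apply: uniq_perm; rewrite ?fset_uniq ?filter_uniq ?index_enum_uniq// => i.
  by rewrite mem_filter mem_index_enum andbT.
apply: eq_big_seq => i iJ; rewrite iJ.
have [_ ->//] := BE i; exact/esym/sample_marginal.
Qed.

Lemma measurable_tn i (B : set R) : measurable B -> measurable (tn i @^-1` B).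
Proof. by move=> mB; rewrite -[X in measurable X]setTI; apply: measurable_tnth. Qed.

Variables (v : node) (pv : R).
Hypothesis qv : q [set` dyadic v] = pv%:E.
Hypothesis p01 : 0 <= pv <= 1.

(** The count is a sum of independent indicators, and its exponential a
    product. *)
Lemma sample_exp (lam : R) :
  (\int[P0]_X (expR (lam * (ncount X v)%:R))%:E =
   ((1 + pv * (expR lam - 1)) ^+ n)%:E)%E.
Proof.
pose D : set R := [set` dyadic v].
pose F (i : 'I_n) (X : n.-tuple (measurableTypeR R)) : R :=
  expR lam * \1_(tn i @^-1` D) X + \1_(~` (tn i @^-1` D)) X.
have mD i : measurable (tn i @^-1` D) by apply: measurable_tn; exact: measurable_itv.
have mDC i : measurable (~` (tn i @^-1` D)) by exact: measurableC.
have mF i : measurable_fun setT (F i).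
  apply: measurable_funD; last exact/measurable_indicP.
  by apply: measurable_funM => //; exact/measurable_indicP.
have F0 i X : 0 <= F i X by rewrite addr_ge0// mulr_ge0// expR_ge0.
have PD i : P0 (tn i @^-1` D) = pv%:E.
  by rewrite sample_marginal; [exact: qv|exact: measurable_itv].
have IF i : (\int[P0]_X (F i X)%:E = (1 + pv * (expR lam - 1))%:E)%E.
  rewrite /F; under eq_integral do rewrite EFinD EFinM.
  rewrite ge0_integralD//; last 2 first.
  - under eq_fun do rewrite -EFinM.
    by apply/measurable_EFinP; apply: measurable_funM => //; exact/measurable_indicP.
  - exact/measurable_EFinP/measurable_indicP.
  rewrite ge0_integralZl//; last exact/measurable_EFinP/measurable_indicP.
  rewrite !integral_indic// !setIT [X in (_ * X + _)%E]PD.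
  rewrite [X in (_ + X)%E](_ : _ = (1 - pv)%:E); last first.
    by rewrite EFinB -(PD i); exact: probability_setC.
  by rewrite -EFinM -EFinD; congr EFin; ring.
pose J := [fset i in enum 'I_n]%fset.
have pJ : perm_eq J (index_enum 'I_n).
  apply: uniq_perm; rewrite ?fset_uniq ?index_enum_uniq// => i.
  by rewrite in_fset mem_enum mem_index_enum.
have := integral_indep_prod (J := J) (F := F) sample_indep mF F0.
have Foo i : i \in J -> (\int[P0]_X (F i X)%:E < +oo)%E by rewrite IF ltry.
move=> /(_ Foo); rewrite (perm_big _ pJ) /=.
have -> : (\prod_(i : 'I_n) \int[P0]_X (F i X)%:E =
    ((1 + pv * (expR lam - 1)) ^+ n)%:E)%E.
  rewrite (eq_bigr (fun=> (1 + pv * (expR lam - 1))%:E)) => [|i _]; last exact: IF.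
  by rewrite prodEFin prodr_const card_ord.
move=> <-.
  apply: eq_integral => X _; congr EFin; rewrite (perm_big _ pJ) /=.
  rewrite /ncount -sum1_count big_tuple big_mkcond /= natr_sum mulr_sumr expR_sum.
  apply: eq_bigr => i _; rewrite /F !indicE in_setC.
  have -> : (X \in tn i @^-1` D) = ((tnth X i : R) \in dyadic v).
    by apply/idP/idP => [/set_mem//|h]; exact/mem_set.
  by case: (_ \in dyadic v); rewrite /= ?mulr1 ?mulr0 ?expR0 ?addr0 ?add0r.
move=> i B _ mB; have cst (b : bool) : measurable [set x : R | B (expR lam * (x \in D)%:R + (x \in ~` D)%:R)].
  rewrite [X in measurable X](_ : _ = (fun x : R => expR lam * \1_D x + \1_(~` D) x) @^-1` B).
    rewrite -[X in measurable X]setTI.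
    have mDD : measurable (D : set R) by exact: measurable_itv.
    have : measurable_fun setT (fun x : R => expR lam * \1_D x + \1_(~` D) x).
      apply: measurable_funD; last by apply/measurable_indicP; exact: measurableC.
      by apply: measurable_funM => //; exact/measurable_indicP.
    exact.
  by apply/seteqP; split => x /=; rewrite !indicE.
exists [set x : R | B (expR lam * (x \in D)%:R + (x \in ~` D)%:R)]; first exact: cst true.
rewrite setTI; apply/seteqP; split => X /=; rewrite /F !indicE !in_setC;
  by rewrite (_ : (X \in tn i @^-1` D) = (tn i X \in D))//; apply/idP/idP => [/set_mem h|/set_mem h]; exact/mem_set.
Qed.

Lemma expR_quadratic (x : R) : `|x| <= 1 / 2 -> expR x - 1 - x <= 2 * x ^+ 2.
Proof.
rewrite ler_norml => /andP[x1 x2].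
have h := expR_ge1Dx (- x); rewrite expRN in h.
have e0 := expR_gt0 x.
have h' : (1 - x) * expR x <= 1.
  by rewrite -ler_pdivlMr// div1r.
have h2 : 1 <= (1 - x) * (1 + x + 2 * x ^+ 2) by nra.
have x3 : 0 < 1 - x by lra.
have : (1 - x) * expR x <= (1 - x) * (1 + x + 2 * x ^+ 2) by lra.
by rewrite ler_pM2l//; lra.
Qed.

Hypothesis v2 : (v.2 < 2 ^ v.1)%N.

Lemma measurable_count (B : set R) :
  measurable [set X : n.-tuple (measurableTypeR R) | B (ncount X v)%:R].
Proof.
apply: (@measurable_cells R n v.1) => X X' XX' /=.
by rewrite (ncount_cells _ XX')// mem_nodes leqnn.
Qed.

(** Markov's inequality for the exponential of the count, with 1 + p (exp t -
    1) <= exp (p (t + 2 t^2)); the sign of lam selects the tail. *)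
Lemma chernoff (lam s : R) : `|lam| <= 1 / 2 ->
  (P0 [set X : n.-tuple (measurableTypeR R) |
     (s <= lam * ((ncount X v)%:R - n%:R * pv))%R] <=
   (expR (2 * (n%:R * pv) * lam ^+ 2 - s))%:E)%E.
Proof.
move=> l1; set A := [set X | _].
pose c := lam * (n%:R * pv) + s.
have mA : measurable A.
  exact: (measurable_count [set x | s <= lam * (x - n%:R * pv)]).
have mh : measurable_fun setT (fun X : n.-tuple (measurableTypeR R) =>
    expR (lam * (ncount X v)%:R)).
  move=> _ B mB; rewrite setTI.
  exact: (measurable_count [set x | B (expR (lam * x))]).
apply: (@le_trans _ _ (\int[P0]_X ((expR (- c))%:E * (expR (lam * (ncount X v)%:R))%:E))%E).
  rewrite -[leLHS]mul1e -integral_cst// [leLHS]integral_mkcond.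
  apply: ge0_le_integral => //.
  - by move=> X _; rewrite patchE; case: ifP => // _; rewrite lee_fin.
  - by apply: (measurable_restrictT _ mA).1; exact: measurable_cst.
  - by under eq_fun do rewrite -EFinM; apply/measurable_EFinP; exact: measurable_funM.
  move=> X _; rewrite patchE; case: ifP => [/set_mem AX|_]; last first.
    by rewrite -EFinM lee_fin mulr_ge0// expR_ge0.
  rewrite -EFinM lee_fin -expRD; rewrite /A /= in AX.
  by rewrite -[leLHS]expR0 ler_expR /c; lra.
rewrite ge0_integralZl//; last exact/measurable_EFinP.
rewrite sample_exp -EFinM lee_fin.
have h1 : (1 + pv * (expR lam - 1)) ^+ n <= expR (n%:R * (pv * (expR lam - 1))).
  have /andP[p0 p1] := p01.
  rewrite expRM_natl lerXn2r ?nnegrE ?expR_ge0//; last exact: expR_ge1Dx.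
  by have := expR_gt0 lam; nra.
apply: le_trans (ler_wpM2l (expR_ge0 _) h1) _.
rewrite -expRD ler_expR /c.
have h2 := expR_quadratic l1.
have n0 : (0 : R) <= n%:R * pv by have /andP[p0 _] := p01; rewrite mulr_ge0.
set t := n%:R * pv in n0 *; rewrite mulrA -/t; nra.
Qed.

End chernoff.

Section noise_level.
Context {R : realType}.
Variable n : nat.

(** The standard deviation of the empirical local average at level l, inflated
    by a logarithm. *)
Definition noise (l : nat) : R := Num.sqrt (2 ^+ l * ln n%:R / n%:R).

Hypothesis n2 : (1 < n)%N.

Lemma n_gt0 : 0 < n%:R :> R. Proof. by rewrite ltr0n ltnW. Qed.

Lemma ln_nat_gt0 : 0 < ln n%:R :> R. Proof. by rewrite ln_gt0// ltr1n. Qed.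

Lemma noise_gt0 l : 0 < noise l.
Proof.
by rewrite sqrtr_gt0 divr_gt0 ?n_gt0// mulr_gt0 ?exprn_gt0// ln_nat_gt0.
Qed.

Lemma noise_sq l : noise l ^+ 2 = 2 ^+ l * ln n%:R / n%:R.
Proof.
rewrite sqr_sqrtr// divr_ge0 ?(ltW n_gt0)// mulr_ge0 ?exprn_ge0//.
exact/ltW/ln_nat_gt0.
Qed.

Lemma noise_le l l' : (l <= l')%N -> noise l <= noise l'.
Proof.
move=> ll'; apply: ler_wsqrtr; rewrite ler_wpM2r ?invr_ge0 ?(ltW n_gt0)//.
by rewrite ler_wpM2r ?(ltW ln_nat_gt0)// ler_weXn2l// ler1n.
Qed.

Lemma noiseS_sq l : noise l.+1 ^+ 2 = 2 * noise l ^+ 2.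
Proof. by rewrite !noise_sq exprS; ring. Qed.

Lemma noiseS l : noise l.+1 <= 3 / 2 * noise l.
Proof. have := noiseS_sq l; have := noise_gt0 l; have := noise_gt0 l.+1; nra. Qed.

Lemma noiseS_ge l : 4 / 3 * noise l <= noise l.+1.
Proof. have := noiseS_sq l; have := noise_gt0 l; have := noise_gt0 l.+1; nra. Qed.

(** Noise levels grow geometrically along a branch, so that sums are dominated
    by the finest level. *)
Lemma noise_sum j : \sum_(l < j) noise l <= 3 * noise j.
Proof.
elim: j => [|j IH]; first by rewrite big_ord0 mulr_ge0// (ltW (noise_gt0 _)).
rewrite big_ord_recr /=; apply: le_trans (lerD IH (lexx _)) _.
by have := noiseS_ge j; lra.
Qed.

End noise_level.

Section good_samples.
Context {R : realType}.
Variables (alpha K mu : R) (f : R -> R) (n L : nat).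
Hypothesis alpha0 : 0 < alpha.
Hypothesis K0 : 0 < K.
Hypothesis mu0 : 0 < mu.
Hypothesis fD : density_class alpha K mu f.
Hypothesis n2 : (1 < n)%N.

Local Notation noise := (@noise R n).

(** Chosen so that the Chernoff exponent is at least 2 ln n, which pays for
    the union bound over the nodes. *)
Definition dev_cst : R := 2 * K + 4.

Definition havg (v : node) : R := 2 ^+ v.1 * pmass f v.

Definition emp_mass (X : n.-tuple R) (v : node) : R := (ncount X v)%:R / n%:R.

Definition emp_avg (X : n.-tuple R) (v : node) : R := 2 ^+ v.1 * emp_mass X v.

(** The only property of the sample that is used: no further probability is
    computed under the true law. *)
Definition good_sample (X : n.-tuple R) : Prop :=
  (forall i, unit_itv (tnth X i)) /\
  forall v, v \in nodes L -> `|emp_avg X v - havg v| <= dev_cst * noise v.1.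

Variable P0 : probability (n.-tuple (measurableTypeR R)) R.
Hypothesis fP : sample_law f P0.
Hypothesis small_noise : forall l, (l <= L)%N -> noise l <= 1 / 2.

Lemma pmassE v : (v.2 < 2 ^ v.1)%N ->
  (\int[lebesgue_measure]_(x in [set` dyadic v] `&` unit_itv) (f x)%:E = (pmass f v)%:E)%E.
Proof.
move=> v2; rewrite (setIidl (dyadic_sub v2)) /pmass /Rintegral fineK//.
apply: integrable_fin_num => //.
exact: (integrable_dyadic alpha0 K0 mu0 fD v2).
Qed.

Lemma pmass01 v : (v.2 < 2 ^ v.1)%N -> 0 <= pmass f v <= 1.
Proof.
move=> v2; have f0 := density_ge0 mu0 fD; have [_ f1 _] := fD.
rewrite -!lee_fin -pmassE//; apply/andP; split.
  by apply: integral_ge0 => x [_ xu]; rewrite lee_fin; exact: f0.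
rewrite -f1; apply: ge0_subset_integral => //.
- by apply: measurableI => //; exact: measurable_itv.
- exact: measurable_itv.
- by apply/measurable_EFinP; apply: measurable_density fD.
Qed.

Lemma node_deviation v : v \in nodes L ->
  (P0 [set X | (dev_cst * noise v.1 < `|emp_avg X v - havg v|)%R] <=
   (2 * expR (- (2 * ln n%:R)))%:E)%E.
Proof.
rewrite mem_nodes => /andP[vL v2]; have [_ f1 _] := fD.
have n0 : 0 < n%:R :> R := n_gt0 n2.
have e0 := @noise_gt0 R n n2 v.1; have e2 := @noise_sq R n n2 v.1.
have l0 : 0 < ln n%:R :> R := ln_nat_gt0 n2.
have evs := small_noise vL.
set ev := noise v.1 in evs e0 e2 *; set ell := ln n%:R in e2 l0 *.
have sn : `|ev| <= 1 / 2 by rewrite gtr0_norm.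
have sn' : `|- ev| <= 1 / 2 by rewrite normrN.
have C l (hl : `|l| <= 1 / 2) :=
  chernoff fP f1 (pmassE v2) (pmass01 v2) v2 (dev_cst * ell) hl.
have key : 2 * (n%:R * pmass f v) * ev ^+ 2 - dev_cst * ell <= - (2 * ell).
  have /andP[_ h] := pmass_bounds alpha0 K0 mu0 fD v2.
  rewrite e2 (_ : _ * (_ / _) = 2 * (2 ^+ v.1 * pmass f v) * ell).
    by rewrite /dev_cst; nra.
  by field; rewrite gt_eqF.
pose A l : set (n.-tuple (measurableTypeR R)) :=
  [set X | dev_cst * ell <= l * ((ncount X v)%:R - n%:R * pmass f v)].
have mA l : measurable (A l).
  exact: (measurable_count v2 [set x | dev_cst * ell <= l * (x - n%:R * pmass f v)]).
apply: (@le_trans _ _ (P0 (A ev `|` A (- ev)))).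
  apply: le_measure; rewrite ?inE; last 2 first.
  - exact: measurableU.
  - move=> X /= h.
    have dE : emp_avg X v - havg v =
        2 ^+ v.1 / n%:R * ((ncount X v)%:R - n%:R * pmass f v).
      by rewrite /emp_avg /emp_mass /havg; field; rewrite gt_eqF.
    have c0 : 0 < 2 ^+ v.1 / n%:R :> R by rewrite divr_gt0 ?exprn_gt0.
    have e2' : ev ^+ 2 = 2 ^+ v.1 / n%:R * ell by rewrite e2 mulrAC.
    rewrite dE in h; move: h e2' c0; rewrite /A /=.
    set t := _ - n%:R * _; set c := 2 ^+ v.1 / n%:R => h e2' c0.
    have h' : dev_cst * ell < ev * `|t|.
      rewrite normrM (gtr0_norm c0) in h.
      rewrite -(ltr_pM2l c0) [ltLHS](_ : _ = ev * (dev_cst * ev)); last first.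
        by rewrite mulrCA -e2'; ring.
      by rewrite [ltRHS]mulrCA ltr_pM2l.
    case: (lerP 0 t) => t0; [left|right]; rewrite /A /=.
      by rewrite ger0_norm// in h'; exact: ltW.
    by rewrite ltr0_norm// in h'; rewrite mulNr -mulrN; exact: ltW.
  apply: (measurable_count v2 [set x | dev_cst * ev < `|2 ^+ v.1 * (x / n%:R) - havg v|]).
apply: le_trans (measureU2 _ (mA _) (mA _)) _.
rewrite mulr_natl mulr2n EFinD; apply: leeD.
  apply: le_trans (C _ sn) _; rewrite lee_fin ler_expR; exact: key.
apply: le_trans (C _ sn') _; rewrite lee_fin ler_expR sqrrN; exact: key.
Qed.

Lemma measurable_good : measurable [set X : n.-tuple (measurableTypeR R) | good_sample X].
Proof.
apply: (@measurable_cells R n L) => X X' XX' [Xu XN]; split.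
  move=> i; have := XX' i (0, 0)%N; rewrite !dyadic_root mem_nodes => /(_ isT) E.
  by have := Xu i; rewrite /unit_itv /= E.
by move=> v vL; rewrite /emp_avg /emp_mass -(ncount_cells vL XX'); exact: XN.
Qed.

Lemma prob_not_good :
  (P0 (~` [set X | good_sample X]) <=
   (2 ^+ L.+1 * (2 * expR (- (2 * ln n%:R))))%:E)%E.
Proof.
have [_ f1 _] := fD.
pose A : set (n.-tuple (measurableTypeR R)) := [set X | forall i, unit_itv (tnth X i)].
pose B v : set (n.-tuple (measurableTypeR R)) :=
  [set X | dev_cst * noise v.1 < `|emp_avg X v - havg v|].
have PA : P0 A = 1%E.
  have := fP (A := fun=> unit_itv) => /(_ (fun=> measurable_itv _)).
  by rewrite /A => ->; rewrite big1// => i _; rewrite setIid.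
have mA : measurable A.
  apply: (@measurable_cells R n L) => X X' XX' Xu i.
  have := XX' i (0, 0)%N; rewrite !dyadic_root mem_nodes => /(_ isT) E.
  by have := Xu i; rewrite /unit_itv /= E.
have mB v : v \in nodes L -> measurable (B v).
  rewrite mem_nodes => /andP[_ v2].
  exact: (measurable_count v2 [set x | dev_cst * noise v.1 < `|2 ^+ v.1 * (x / n%:R) - havg v|]).
pose U (s : seq node) : set (n.-tuple (measurableTypeR R)) := [set X | exists2 v, v \in s & B v X].
have HU (s : seq node) : {subset s <= nodes L} -> measurable (U s) /\
    (P0 (U s) <= \sum_(v <- s) (2 * expR (- (2 * ln n%:R)))%:E)%E.
  elim: s => [|v s IH] sL.
    by rewrite (_ : U [::] = set0) ?measure0 ?big_nil//; apply/seteqP; split => // X [].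
  have vL : v \in nodes L by apply: sL; rewrite inE eqxx.
  have [mU PU] : measurable (U s) /\
      (P0 (U s) <= \sum_(v <- s) (2 * expR (- (2 * ln n%:R)))%:E)%E.
    by apply: IH => u us; apply: sL; rewrite inE us orbT.
  have -> : U (v :: s) = B v `|` U s.
    apply/seteqP; split => X /=.
      move=> [u]; rewrite inE => /orP[/eqP->|us] Bu; [by left|].
      by right; exists u.
    by move=> [Bv|[u us Bu]]; [exists v; rewrite ?inE ?eqxx|exists u; rewrite ?inE ?us ?orbT].
  split; first by apply: measurableU => //; exact: mB.
  rewrite big_cons; apply: le_trans (measureU2 _ (mB _ vL) mU) _.
  by apply: leeD => //; exact: node_deviation.
have [mU PU] := HU (nodes L) (fun _ h => h).
apply: (@le_trans _ _ (P0 (~` A `|` U (nodes L)))).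
  apply: le_measure; rewrite ?inE.
  - by apply: measurableC; exact: measurable_good.
  - by apply: measurableU => //; exact: measurableC.
  move=> X /= nG; apply: contrapT => /not_orP[/contrapT AX nU]; apply: nG; split=> //.
  by move=> v vL; rewrite leNgt; apply/negP => h; apply: nU; exists v.
apply: le_trans (measureU2 _ (measurableC mA) mU) _.
rewrite [X in (X + _)%E](_ : _ = 0%E); last first.
  by transitivity (1 - P0 A)%E; [exact: probability_setC|rewrite PA subee].
rewrite add0e; apply: le_trans PU _; rewrite sumEFin lee_fin.
by apply: (sum_nodes_le L xpredT); rewrite mulr_ge0// expR_ge0.
Qed.

End good_samples.

(** * The posterior on a good sample *)

Section split_masses_on_good_samples.
Context {R : realType} {d} {Om : measurableType d} (Q : probability Om R).
Variables (p : node -> R) (a : R).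
Variables (S : node -> {RV Q >-> bool}) (Y : seq bool -> {RV Q >-> R}).
Hypothesis SY : opt_variables p a S Y.
Hypothesis a0 : 0 < a.
Variables (alpha K mu : R) (f : R -> R) (n L : nat) (X : n.-tuple R).
Hypothesis alpha0 : 0 < alpha.
Hypothesis K0 : 0 < K.
Hypothesis mu0 : 0 < mu.
Hypothesis fD : density_class alpha K mu f.
Hypothesis n2 : (1 < n)%N.
Hypothesis XG : good_sample K f L X.
Hypothesis small_dev : forall l, (l <= L)%N -> dev_cst K * noise n l <= mu / 2.

Local Notation noise := (@noise R n).
Local Notation avg v := (emp_avg X v).
Local Notation Wtot := (Wtot Y X).
Local Notation Wset := (Wset Y X).
Local Notation beta := (@beta_margin R a n).
Local Notation ell := (ln n%:R : R).

Lemma mu_le : mu <= 1 + K.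
Proof. by have /andP[h1 h2] := pmass_bounds alpha0 K0 mu0 fD (v := (0, 0)%N) isT; lra. Qed.

Lemma emp_bounds v : v \in nodes L -> mu / 2 <= avg v <= 2 * (1 + K).
Proof.
move=> vL; have [_ /(_ _ vL)] := XG; rewrite ler_norml => /andP[h1 h2].
have vl : (v.1 <= L)%N by move: vL; rewrite mem_nodes => /andP[].
have v2 : (v.2 < 2 ^ v.1)%N by move: vL; rewrite mem_nodes => /andP[].
have h3 := small_dev vl.
have /andP[h4 h5] := pmass_bounds alpha0 K0 mu0 fD v2.
by have h6 := mu_le; rewrite /havg in h1 h2; apply/andP; split; lra.
Qed.

Lemma emp_gt0 v : v \in nodes L -> 0 < avg v.
Proof. by move=> /emp_bounds /andP[h _]; apply: lt_le_trans h; rewrite divr_gt0. Qed.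

Lemma ncount_children v : ncount X v = (left_count X v + right_count X v)%N.
Proof.
have H (x : R) : (x \in dyadic v : nat) =
    ((x \in dyadic (child v false)) + (x \in dyadic (child v true)))%N.
  have [e0 e1 e2] := @child_bounds R v.
  have e3 : v.2.+1%:R = v.2%:R + 1 :> R by rewrite natr1.
  rewrite !dyadicE e0 e2 !e1 e3 /= exprS -mulrA.
  move: (2 ^+ v.1 * x) (v.2%:R : R) => t u.
  case: (leP u t) => h1; case: (ltP t (u + 1)) => h2; case: (leP (2 * u) (2 * t)) => h3;
    case: (ltP (2 * t) (2 * u + 1)) => h4; case: (ltP (2 * t) (2 * u + 2)) => h5 //=; exfalso; lra.
have E u : ncount X u = (\sum_(i < n) (tnth X i \in dyadic u))%N.
  apply: esym; rewrite /ncount -sum1_count big_tuple big_mkcond /=.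
  rewrite [RHS]big_mkcond /=; by apply: eq_bigr => i _; case: (tnth X i \in _).
by rewrite /left_count /right_count !E -big_split /=; apply: eq_bigr => i _; exact: H.
Qed.

Lemma emp_add v : avg v = (avg (child v false) + avg (child v true)) / 2.
Proof.
rewrite /emp_avg /emp_mass ncount_children natrD /= exprS.
by rewrite -/(left_count X v) -/(right_count X v); lra.
Qed.

Definition emp_split (v : node) : R := avg (child v false) / (2 * avg v).

Lemma avg_ge0 v : 0 <= avg v.
Proof. by rewrite mulr_ge0 ?exprn_ge0// divr_ge0. Qed.

Lemma emp_split01 v : v \in nodes L -> 0 <= emp_split v <= 1.
Proof.
move=> /emp_gt0 v0; have := emp_add v; have := avg_ge0 (child v false).
have := avg_ge0 (child v true) => h1 h0 E.
apply/andP; split; first by rewrite divr_ge0// mulr_ge0// ltW.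
have v1 : 0 < 2 * avg v by lra.
by rewrite /emp_split ler_pdivrMr//; lra.
Qed.

Lemma countE v : (ncount X v)%:R = n%:R / 2 ^+ v.1 * avg v.
Proof.
by rewrite /emp_avg /emp_mass; field; rewrite ?gt_eqF ?exprn_gt0// ltr0n ltnW.
Qed.

Lemma emp_splitE v : v \in nodes L ->
  (left_count X v)%:R = (left_count X v + right_count X v)%:R * emp_split v.
Proof.
move=> vL; have v0 := emp_gt0 vL.
rewrite -ncount_children countE /emp_split /left_count countE /= exprS.
by field; rewrite ?gt_eqF ?exprn_gt0//.
Qed.

Lemma count_noise v : (left_count X v + right_count X v)%:R * noise v.1 ^+ 2 = avg v * ell.
Proof.
rewrite -ncount_children countE (@noise_sq R n n2).
by field; rewrite ?gt_eqF ?exprn_gt0// ltr0n ltnW.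
Qed.

Lemma count_le_n v : (left_count X v + right_count X v <= n)%N.
Proof. by rewrite -ncount_children /ncount (leq_trans (count_size _ _))// size_tuple. Qed.

(** The empirical Haar coefficient at v in units of noise; up to constants,
    its square times ln n is the log-likelihood gain of the split at v. *)
Definition gap (v : node) : R := (avg (child v false) - avg (child v true)) / noise v.1.

Lemma emp_split_half v : v \in nodes L ->
  (left_count X v + right_count X v)%:R * (emp_split v - 1 / 2) ^+ 2 = ell * gap v ^+ 2 / (16 * avg v).
Proof.
move=> vL; have v0 := emp_gt0 vL; have e0 := @noise_gt0 R n n2 v.1.
have NE : (left_count X v + right_count X v)%:R = avg v * ell / noise v.1 ^+ 2.
  by rewrite -count_noise mulfK// gt_eqF// exprn_gt0.
rewrite NE /emp_split /gap.
have -> : avg (child v true) = 2 * avg v - avg (child v false) by rewrite (emp_add v); field.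
by field; rewrite ?gt_eqF.
Qed.

Lemma prod_split (N0 N1 : nat) (y : R) :
  (2 * y) ^+ N0 * (2 * (1 - y)) ^+ N1 = 2 ^+ (N0 + N1) * (y ^+ N0 * (1 - y) ^+ N1).
Proof. by rewrite !exprMn exprD mulrACA. Qed.

Let peak v : R := 2 ^+ (left_count X v + right_count X v) *
  (emp_split v ^+ left_count X v * (1 - emp_split v) ^+ right_count X v).

Lemma peak_ge0 v : v \in nodes L -> 0 <= peak v.
Proof.
move=> /emp_split01 /andP[h0 h1].
by rewrite mulr_ge0 ?exprn_ge0// mulr_ge0 ?exprn_ge0// subr_ge0.
Qed.

(** The likelihood of one split falls off like a Gaussian around the empirical
    split, where it has its peak. *)
Lemma Wset_le_peak v (A : set R) (t : R) : v \in nodes L -> measurable A ->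
  (forall y, A y -> t <= (emp_split v - y) ^+ 2) ->
  Wset v A <= peak v * expR (- ((left_count X v + right_count X v)%:R * t / 2)).
Proof.
move=> vL mA At; have q01 := emp_split01 vL.
rewrite -lee_fin -WsetE//; apply: split_mass_le => //; last first.
  by rewrite mulr_ge0 ?peak_ge0 ?expR_ge0.
move=> y /andP[y0 y1] Ay; rewrite prod_split /peak -[leRHS]mulrA ler_wpM2l ?exprn_ge0//.
have y01 : 0 <= y <= 1 by rewrite !ltW.
apply: le_trans (bernoulli_lik_le y01 q01 (emp_splitE vL)) _.
have /andP[h0 h1] := q01.
rewrite ler_wpM2l ?mulr_ge0 ?exprn_ge0 ?subr_ge0// ler_expR lerN2.
by rewrite ler_wpM2r ?invr_ge0// ler_wpM2l// At.
Qed.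

Lemma Wtot_ge_peak v : v \in nodes L -> peak v * beta <= Wtot v.
Proof.
move=> vL; rewrite -lee_fin -WsetE//.
apply: (split_mass_ge SY a0 v) => //; [exact: ltnW|exact: count_le_n|exact: emp_split01].
Qed.

Lemma Wtot_le v : v \in nodes L -> Wtot v <= expR (ell * gap v ^+ 2 / (2 * mu)).
Proof.
move=> vL; have v0 := emp_gt0 vL.
apply: le_trans (Wset_le_peak vL measurableT (t := 0) (fun y _ => sqr_ge0 _)) _.
rewrite mulr0 mul0r oppr0 expR0 mulr1.
apply: le_trans (bernoulli_chi2_le (emp_split01 vL) (emp_splitE vL)) _.
rewrite ler_expR (_ : (2 * _ - 1) ^+ 2 = 4 * (emp_split v - 1 / 2) ^+ 2); last by field.
rewrite mulrCA emp_split_half//.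
have /andP[h _] := emp_bounds vL.
have g0 : 0 <= ell * gap v ^+ 2 by rewrite mulr_ge0 ?sqr_ge0// (ltW (@ln_nat_gt0 R n n2)).
rewrite (_ : 4 * _ = ell * gap v ^+ 2 * (4 * avg v)^-1); last first.
  by field; rewrite gt_eqF.
have x1 : 0 < 4 * avg v by lra.
have m1 : 0 < 2 * mu by rewrite mulr_gt0.
by rewrite ler_wpM2l// lef_pV2 ?posrE//; lra.
Qed.

Lemma beta_gt0 : 0 < beta.
Proof.
rewrite divr_gt0 ?(beta_cst_gt0 SY)// powR_gt0// mulr_gt0// ltr0n; exact: ltnW.
Qed.

(** The peak dominates the value 1 taken by the likelihood at the even split
    1/2, by the Gaussian factor that separates 1/2 from the empirical split. *)
Lemma peak_ge v : v \in nodes L -> expR (ell * gap v ^+ 2 / (64 * (1 + K))) <= peak v.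
Proof.
move=> vL; have v0 := emp_gt0 vL; have q01 := emp_split01 vL.
have h01 : 0 <= (1 / 2 : R) <= 1 by apply/andP; split; lra.
have := bernoulli_lik_le h01 q01 (emp_splitE vL).
rewrite (_ : 1 - 1 / 2 = 1 / 2 :> R); last by field.
rewrite -exprD -(ler_pM2l (exprn_gt0 (left_count X v + right_count X v) (ltr0Sn R 1))) -exprMn.
rewrite (_ : 2 * (1 / 2) = 1 :> R) ?expr1n; last by field.
rewrite mulrA -/(peak v) expRN ler_pdivlMr ?expR_gt0// (mul1r (expR _)) => h.
apply: le_trans h; rewrite ler_expR emp_split_half//.
have /andP[_ h] := emp_bounds vL.
have g0 : 0 <= ell * gap v ^+ 2 by rewrite mulr_ge0 ?sqr_ge0// (ltW (@ln_nat_gt0 R n n2)).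
rewrite (_ : _ / 2 = ell * gap v ^+ 2 * (32 * avg v)^-1); last first.
  by field; rewrite gt_eqF.
have x1 : 0 < 32 * avg v by lra.
have m1 : 0 < 64 * (1 + K) by rewrite mulr_gt0// addr_gt0.
by rewrite ler_wpM2l// lef_pV2 ?posrE//; lra.
Qed.

Lemma Wtot_ge v : v \in nodes L ->
  beta * expR (ell * gap v ^+ 2 / (64 * (1 + K))) <= Wtot v.
Proof.
move=> vL; apply: le_trans (Wtot_ge_peak vL).
by rewrite mulrC ler_wpM2r ?(ltW beta_gt0)// peak_ge.
Qed.

Lemma Wtot_ge_beta v : v \in nodes L -> beta <= Wtot v.
Proof.
move=> vL; apply: le_trans (Wtot_ge vL); rewrite ler_peMr ?(ltW beta_gt0)//.
rewrite -[leLHS]expR0 ler_expR; apply: divr_ge0.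
  by rewrite mulr_ge0 ?sqr_ge0// (ltW (@ln_nat_gt0 R n n2)).
by rewrite mulr_ge0// addr_ge0// ltW.
Qed.

Lemma Wtot_gt0 v : v \in nodes L -> 0 < Wtot v.
Proof. by move=> vL; exact: lt_le_trans beta_gt0 (Wtot_ge_beta vL). Qed.

Definition far (c : R) (v : node) : set R :=
  [set y | c * noise v.1 < `|emp_split v - y|].

Lemma measurable_far c v : measurable (far c v).
Proof.
rewrite [X in measurable X](_ : _ = (fun y => `|emp_split v - y|) @^-1` `]c * noise v.1, +oo[).
  rewrite -[X in measurable X]setTI.
  have : measurable_fun setT (fun y : R => `|emp_split v - y|).
    by apply: measurableT_comp => //; exact: measurable_funB.
  by apply => //.
by apply/seteqP; split => y /=; rewrite in_itv/= andbT.
Qed.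

(** The peak cancels in the ratio; the count at v times the squared noise is
    of order ln n. *)
Lemma Wfar_le c v : v \in nodes L -> 0 <= c ->
  Wset v (far c v) / Wtot v <= beta^-1 * expR (- (ell * (mu * c ^+ 2 / 4))).
Proof.
move=> vL c0; have e0 := @noise_gt0 R n n2 v.1.
have b0 := beta_gt0; have p0 : 0 < peak v by apply: lt_le_trans (expR_gt0 _) (peak_ge vL).
rewrite ler_pdivrMr ?Wtot_gt0//.
have h1 : Wset v (far c v) <= peak v * expR (- ((left_count X v + right_count X v)%:R * (c * noise v.1) ^+ 2 / 2)).
  apply: Wset_le_peak => //; first exact: measurable_far.
  move=> y /= fy; rewrite -(real_normK (num_real (emp_split v - y))).
  by rewrite ler_sqr ?nnegrE ?mulr_ge0 ?(ltW e0)// ltW.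
apply: le_trans h1 _.
have h2 : peak v <= beta^-1 * Wtot v.
  by rewrite -ler_pdivrMl ?invr_gt0// invrK mulrC; exact: Wtot_ge_peak.
rewrite [leRHS]mulrAC; apply: ler_pM => //; rewrite ?(ltW p0) ?expR_ge0//.
rewrite ler_expR lerN2.
rewrite (_ : _%:R * (c * noise v.1) ^+ 2 / 2 =
  c ^+ 2 * ((left_count X v + right_count X v)%:R * noise v.1 ^+ 2) / 2); last by ring.
rewrite count_noise.
have /andP[h _] := emp_bounds vL.
have c2 : 0 <= ell * c ^+ 2 by rewrite mulr_ge0 ?sqr_ge0// (ltW (@ln_nat_gt0 R n n2)).
by nra.
Qed.

End split_masses_on_good_samples.

Section scales.
Context {R : realType}.
Variables (alpha K mu : R) (f : R -> R).
Hypothesis alpha0 : 0 < alpha.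
Hypothesis K0 : 0 < K.
Hypothesis mu0 : 0 < mu.
Hypothesis fD : density_class alpha K mu f.

Lemma scale_le l l' : (l <= l')%N -> scale alpha l' <= scale alpha l.
Proof.
move=> ll'; rewrite ge0_ler_powR ?nnegrE ?invr_ge0 ?exprn_ge0 ?(ltW alpha0)//.
by rewrite lef_pV2 ?posrE ?exprn_gt0// ler_weXn2l// ler1n.
Qed.

Lemma scale_sq (l : nat) (y : R) : 0 < y -> y <= (2 ^+ l) `^ (2 * alpha + 1) ->
  scale alpha l ^+ 2 <= 2 ^+ l / y.
Proof.
move=> y0; have p0 : (0 : R) < 2 ^+ l by rewrite exprn_gt0.
have s0 : 0 < scale alpha l by rewrite /scale powR_gt0// invr_gt0.
rewrite powRD; last by rewrite (gt_eqF p0) implybT.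
rewrite powRr1 ?(ltW p0)// mulrC => h.
have E : (2 ^+ l) `^ (2 * alpha) = scale alpha l ^- 2.
  have sE : scale alpha l = (2 ^+ l) `^ (- alpha).
    by rewrite /scale -(powR_inv1 (ltW p0)) -powRrM mulN1r.
  rewrite sE expr2 -powRD; last by rewrite (gt_eqF p0) implybT.
  by rewrite -powRN; congr (_ `^ _); ring.
rewrite E in h; rewrite ler_pdivlMr// mulrC -ler_pdivlMr ?exprn_gt0//.
Qed.

Lemma havg_gap v : (v.2 < 2 ^ v.1)%N ->
  `|havg f (child v false) - havg f (child v true)| <= 3 * K * scale alpha v.1.
Proof.
move=> v2.
have inv b : (lpoint (child v b) : R) \in dyadic v.
  have /seteqP[_ h] := @dyadic_children R v.
  by apply: h; case: b; [right|left]; exact: lpoint_dyadic.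
have h b : `|havg f (child v b) - f (lpoint (child v b))| <= K * scale alpha v.1.
  apply: le_trans (pmass_near alpha0 K0 mu0 fD (child_lt b v2) (lpoint_dyadic _)) _.
  by rewrite ler_wpM2l ?(ltW K0)// scale_le.
have h3 := holder_cell alpha0 K0 fD v2 (inv false) (inv true).
have h1 := h false; have h2 := h true.
rewrite !ler_norml in h1 h2 h3 *.
move: h1 h2 h3 => /andP[a1 a2] /andP[b1 b2] /andP[c1 c2].
by apply/andP; split; lra.
Qed.

End scales.

Section typical_draws.
Context {R : realType} {d} {Om : measurableType d} (Q : probability Om R).
Variables (Gamma a : R).
Variables (S : node -> {RV Q >-> bool}) (Y : seq bool -> {RV Q >-> R}).
Local Notation p := (fun u : node => Gamma ^- u.1).
Hypothesis SY : opt_variables p a S Y.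
Hypothesis a0 : 0 < a.
Variables (alpha K mu : R) (f : R -> R) (n L : nat) (X : n.-tuple R).
Hypothesis alpha0 : 0 < alpha.
Hypothesis K0 : 0 < K.
Hypothesis mu0 : 0 < mu.
Hypothesis fD : density_class alpha K mu f.
Hypothesis n2 : (1 < n)%N.
Hypothesis XG : good_sample K f L X.
Hypothesis small_dev : forall l, (l <= L)%N -> dev_cst K * noise n l <= mu / 2.

Local Notation noise := (@noise R n).
Local Notation beta := (@beta_margin R a n).
Local Notation ell := (ln n%:R : R).
Local Notation conf := (conf S L).
Local Notation splitsw w := (splits L (fun u => u \in conf w)).
Local Notation splitsf s := (splits L (fun u => u \in s)).
Local Notation Wtot := (Wtot Y X).

Variables (C1 m : nat) (tau C4 : R).
Hypothesis C1_ge : (3 * K + 3 * dev_cst K) ^+ 2 / (2 * mu) <= C1%:R.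
Hypothesis Gamma2 : 2 <= Gamma.
Hypothesis Gamma_ge : 2 ^+ (6 * (C1 + 2)) <= Gamma.
Hypothesis m0 : (0 < m)%N.
Hypothesis m_ge : n%:R / ell <= (2 ^+ m) `^ (2 * alpha + 1).
Hypothesis m_ge' : n%:R <= 2 ^+ (6 * m) :> R.
Hypothesis tau0 : 0 < tau.
Hypothesis tau_ge : 6 * dev_cst K <= tau * Num.sqrt ell.
Hypothesis C40 : 0 <= C4.
Hypothesis theta_le : L.+1%:R * ((4 * Gamma ^+ L / beta) ^+ L.+1 *
  expR (- (tau ^+ 2 * ell ^+ 2 / (256 * (1 + K))))) <= n%:R ^- 2.
Hypothesis far_le : beta^-1 * expR (- (ell * (mu * C4 ^+ 2 / 4))) <= n%:R ^- 2.

Lemma dev_cst_gt0 : 0 < dev_cst K.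
Proof. by rewrite addr_gt0// mulr_gt0. Qed.

Lemma gap_near v : v \in nodes L -> (v.1 < L)%N ->
  `|gap X v - (havg f (child v false) - havg f (child v true)) / noise v.1| <=
  3 * dev_cst K.
Proof.
rewrite mem_nodes => /andP[_ v2] vL; have e0 := @noise_gt0 R n n2 v.1.
have h b : `|emp_avg X (child v b) - havg f (child v b)| <= dev_cst K * (3 / 2 * noise v.1).
  have [_ H] := XG; apply: le_trans (H (child v b) _) _.
    by rewrite mem_nodes child_lt// andbT.
  by rewrite ler_wpM2l ?(ltW dev_cst_gt0)//; exact: noiseS.
rewrite /gap -mulrBl normrM normfV (gtr0_norm e0) ler_pdivrMr//.
have h1 := h false; have h2 := h true.
rewrite !ler_norml in h1 h2 *.
by move: h1 h2 => /andP[a1 a2] /andP[b1 b2]; apply/andP; split; lra.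
Qed.

Lemma p_gt0 v : 0 < p v. Proof. by rewrite invr_gt0 exprn_gt0//; have := Gamma2; lra. Qed.

Lemma p_le_half v : (0 < v.1)%N -> p v <= 1 / 2.
Proof.
move=> v0; have G1 : 1 <= Gamma by have := Gamma2; lra.
rewrite div1r lef_pV2 ?posrE ?exprn_gt0//; last by have := Gamma2; lra.
by apply: le_trans Gamma2 _; apply: ler_eXnr.
Qed.

(** From level m on the bias is below the noise, so a split gains at most n^C1
    in likelihood, while its prior probability, at most Gamma^-m, does not
    exceed n^-(C1 + 2). *)
Lemma deep_factor v : v \in nodes L -> (m <= v.1 < L)%N ->
  2 * (p v * Wtot v) <= 2 * n%:R ^- 2.
Proof.
move=> vL /andP[mv vl]; rewrite ler_wpM2l//.
have v2 : (v.2 < 2 ^ v.1)%N by move: vL; rewrite mem_nodes => /andP[].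
have n0 : 0 < n%:R :> R := @n_gt0 R n n2.
have l0 : 0 < ell := @ln_nat_gt0 R n n2.
have e0 := @noise_gt0 R n n2 v.1.
have sn : scale alpha v.1 <= noise v.1.
  rewrite -ler_sqr ?nnegrE ?powR_ge0 ?(ltW e0)// (@noise_sq R n n2).
  rewrite -[2 ^+ v.1 * ell / n%:R]mulrA -[ell / n%:R]invf_div.
  apply: scale_sq; first by rewrite divr_gt0.
  apply: le_trans m_ge _.
  rewrite ge0_ler_powR ?nnegrE ?exprn_ge0 ?ler_weXn2l ?ler1n//.
  by rewrite addr_ge0// mulr_ge0// ltW.
have g : `|gap X v| <= 3 * K + 3 * dev_cst K.
  have h1' := le_trans (lerB_dist _ _) (gap_near vL vl).
  have h2 := havg_gap alpha0 K0 mu0 fD v2.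
  have h3 : `|(havg f (child v false) - havg f (child v true)) / noise v.1| <= 3 * K.
    rewrite normrM normfV (gtr0_norm e0) ler_pdivrMr//; apply: le_trans h2 _.
    by rewrite ler_wpM2l// mulr_ge0// ltW.
  by rewrite lerBlDr in h1'; apply: le_trans h1' _; rewrite addrC lerD.
have G0 : 0 < Gamma by have := Gamma2; lra.
have hW : Wtot v <= n%:R ^+ C1.
  apply: le_trans (Wtot_le Y alpha0 K0 mu0 fD n2 XG small_dev vL) _.
  rewrite -[leRHS]lnK ?posrE ?exprn_gt0// ler_expR lnXn//.
  rewrite -[leRHS]mulr_natr -mulrA ler_wpM2l ?(ltW l0)//.
  apply: le_trans C1_ge; rewrite ler_wpM2r ?invr_ge0 ?mulr_ge0 ?(ltW mu0)//.
  by rewrite -(real_normK (num_real (gap X v))) lerXn2r ?nnegrE//; apply: le_trans g.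
have hp : p v <= n%:R ^- (C1 + 2).
  rewrite lef_pV2 ?posrE ?exprn_gt0//.
  apply: (@le_trans _ _ ((2 ^+ (6 * m)) ^+ (C1 + 2))).
    by rewrite lerXn2r ?nnegrE// ?exprn_ge0// ltW.
  rewrite -exprM mulnAC exprM.
  apply: (@le_trans _ _ (Gamma ^+ m)).
    by rewrite lerXn2r ?nnegrE ?exprn_ge0// ltW.
  by apply: ler_weXn2l => //; have := Gamma2; lra.
apply: le_trans (ler_pM (ltW (p_gt0 v)) (Wset_ge0 _ _ _ _) hp hW) _.
rewrite exprD invfM mulrAC mulVf ?mul1r//.
by rewrite gt_eqF// exprn_gt0.
Qed.

(** A Haar coefficient of the truth that exceeds the noise by a factor of
    order sqrt (ln n). The extra factor is what lets the likelihood gain exp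
    (c (ln n)^2) beat the product of all prior costs along a branch. *)
Definition signal (v : node) : bool :=
  tau * Num.sqrt ell * noise v.1 <=
  `|havg f (child v false) - havg f (child v true)|.

Lemma signal_gap v : v \in nodes L -> (v.1 < L)%N -> signal v ->
  tau ^+ 2 * ell / 4 <= gap X v ^+ 2.
Proof.
move=> vL vl sv; have h1 := gap_near vL vl.
have l0 : 0 < ell := @ln_nat_gt0 R n n2.
have e0 := @noise_gt0 R n n2 v.1.
have h2 : tau * Num.sqrt ell <= `|(havg f (child v false) - havg f (child v true)) / noise v.1|.
  by rewrite normrM normfV (gtr0_norm e0) ler_pdivlMr.
have h3 : tau * Num.sqrt ell / 2 <= `|gap X v|.
  have h3 := le_trans (lerB_dist _ _) (eqbRL (congr1 (fun z => z <= _) (distrC _ _)) h1).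
  by have := tau_ge; lra.
rewrite -(real_normK (num_real (gap X v))).
rewrite (_ : _ / 4 = (tau * Num.sqrt ell / 2) ^+ 2).
  by rewrite lerXn2r ?nnegrE// divr_ge0// mulr_ge0 ?sqrtr_ge0// ltW.
by rewrite !exprMn sqr_sqrtr ?(ltW l0)// exprVn; field.
Qed.

(** The prior cost of prolonging a tree along a branch is at most exponential
    in the square of ln n, both for the Gamma factors and for the Beta
    margins; a signal gains exp (c tau^2 (ln n)^2) in likelihood. *)
Lemma signal_split v : v \in nodes L -> (v.1 < L)%N -> signal v ->
  mass L p Wtot (fun s => ~~ splitsf s v) <= n%:R ^- 2 * mass L p Wtot xpredT.
Proof.
move=> vL vl sv.
have W0 := Wtot_gt0 SY a0 alpha0 K0 mu0 fD n2 XG small_dev.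
have v2 : (v.2 < 2 ^ v.1)%N by move: vL; rewrite mem_nodes => /andP[].
have G1 : 1 <= Gamma by have := Gamma2; lra.
have G0 : 0 < Gamma by have := Gamma2; lra.
have b0 : 0 < beta := beta_gt0 SY n2.
have l0 : 0 < ell := @ln_nat_gt0 R n n2.
have p01 u : u \in nodes L -> 0 <= p u <= 1.
  by move=> _; rewrite (ltW (p_gt0 u))/= invf_le1 ?exprn_gt0// exprn_ege1.
have b1 : beta <= 1.
  have rL : ((0, 0)%N : node) \in nodes L by rewrite mem_nodes.
  have := Wtot_ge_peak SY a0 alpha0 K0 mu0 fD n2 XG small_dev rL.
  have := Wset_le_peak Y alpha0 K0 mu0 fD n2 XG small_dev rL measurableT (t := 0)
    (fun y _ => sqr_ge0 _).
  rewrite mulr0 mul0r oppr0 expR0 mulr1 => h1 h2.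
  have pk := peak_ge alpha0 K0 mu0 fD n2 XG small_dev rL.
  have p0 := lt_le_trans (expR_gt0 _) pk.
  by rewrite -(ler_pM2l p0) mulr1; apply: le_trans h2 h1.
have th := theta_le; set rho := 4 * Gamma ^+ L / beta in th *.
have rho1 : 1 <= rho.
  rewrite /rho ler_pdivlMr// mul1r; apply: le_trans b1 _.
  have GL : 1 <= Gamma ^+ L by rewrite exprn_ege1.
  by lra.
have Hr u (x : R) : (u.1 <= L)%N -> 0 < x -> beta * x <= Wtot u ->
    4 / (p u * Wtot u) <= rho / x.
  move=> uL x0 hx; have Wp : 0 < Wtot u by apply: lt_le_trans hx; rewrite mulr_gt0.
  rewrite ler_pdivrMr ?mulr_gt0 ?p_gt0// /rho.
  have hG : Gamma ^+ u.1 <= Gamma ^+ L by apply: ler_weXn2l.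
  rewrite (_ : 4 * Gamma ^+ L / beta / x * (Gamma ^- u.1 * Wtot u) =
    4 * (Gamma ^+ L / Gamma ^+ u.1) * (Wtot u / (beta * x))); last first.
    by field; rewrite !gt_eqF ?exprn_gt0.
  have r1 : 1 <= Gamma ^+ L / Gamma ^+ u.1 by rewrite ler_pdivlMr ?mul1r//; exact: exprn_gt0.
  have r2 : 1 <= Wtot u / (beta * x) by rewrite ler_pdivlMr ?mul1r//; exact: mulr_gt0.
  by nra.
have aN i : (i <= v.1)%N -> ancestor v i \in nodes L.
  move=> iv; rewrite mem_nodes (ancestor_lt v2 iv) andbT /=.
  exact: leq_trans (ltnW vl).
set T := expR (- (tau ^+ 2 * ell ^+ 2 / (256 * (1 + K)))) in th *.
have hk : 4 / (p v * Wtot v) <= rho * T.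
  rewrite /T expRN; apply: Hr (ltnW vl) (expR_gt0 _) _.
  apply: le_trans (Wtot_ge SY a0 alpha0 K0 mu0 fD n2 XG small_dev vL).
  rewrite ler_wpM2l ?(ltW b0)// ler_expR.
  have M0 : 0 < 1 + K by rewrite addr_gt0.
  rewrite (_ : tau ^+ 2 * ell ^+ 2 / _ = ell * (tau ^+ 2 * ell / 4) / (64 * (1 + K))).
    rewrite ler_wpM2r ?invr_ge0 ?mulr_ge0 ?(ltW M0)//.
    by rewrite ler_wpM2l ?(ltW l0)//; exact: signal_gap.
  by field; rewrite gt_eqF.
have hr i : (i < v.1)%N -> 4 / (p (ancestor v i) * Wtot (ancestor v i)) <= rho.
  move=> iv; rewrite -[leRHS]divr1; apply: Hr => //=.
    exact: ltnW (leq_trans iv (ltnW vl)).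
  rewrite mulr1.
  exact: (Wtot_ge_beta SY a0 alpha0 K0 mu0 fD n2 XG small_dev (aN _ (ltnW iv))).
have T0 : 0 < T := expR_gt0 _.
have rho0 : 0 <= rho by lra.
have := mass_nosplit_le p01 W0 vL vl p_gt0 p_le_half rho1 (mulr_ge0 rho0 (ltW T0)) hr hk.
move/le_trans; apply; rewrite ler_wpM2r ?mass_ge0//; apply: le_trans th.
rewrite (mulrA (rho ^+ v.1)) -exprSr; apply: ler_pM => //.
- by rewrite mulr_ge0 ?exprn_ge0// ltW.
- by rewrite ler_nat ltnS ltnW.
by rewrite ler_wpM2r ?(ltW T0)//; apply: ler_weXn2l => //; exact: leqW.
Qed.

Definition typical (w : Om) : Prop :=
  [/\ forall v, splitsw w v -> (v.1 < m)%N,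
      forall v, v \in nodes L -> (v.1 < L)%N -> signal v -> splitsw w v &
      forall v, splitsw w v -> 0 < Ysplit Y v w < 1 /\
        `|emp_split X v - Ysplit Y v w| <= C4 * noise v.1].

(** Three separate reasons: splits beyond level m are too costly under the
    prior, missing a signal is too costly in likelihood, and every split
    variable sees enough observations to be pinned down. *)
Lemma posterior_atypical (B : set ((R -> R) * tree)) :
  measurable (draw S Y L @^-1` B) ->
  (forall w, typical w -> ~ B (draw S Y L w)) ->
  posterior Q (draw S Y L) X B <= 2 ^+ L.+1 * (4 * n%:R ^- 2).
Proof.
move=> mB HB; have [Xu _] := XG.
have W0 := Wtot_gt0 SY a0 alpha0 K0 mu0 fD n2 XG small_dev.
have n0 : 0 < n%:R :> R := @n_gt0 R n n2.
have G1 : 1 <= Gamma by have := Gamma2; lra.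
have p01 u : u \in nodes L -> 0 <= p u <= 1.
  by move=> _; rewrite (ltW (p_gt0 u))/= invf_le1 ?exprn_gt0 ?exprn_ege1//; have := Gamma2; lra.
have D0 := massT_gt0 SY W0.
pose deep (s : {fset node}) := has (fun u => (m <= u.1)%N && splitsf s u) (nodes L).
pose miss (s : {fset node}) :=
  has (fun u => ((u.1 < L)%N && signal u) && ~~ splitsf s u) (nodes L).
pose bad v : set R := if (v.1 < L)%N then far X C4 v else set0.
apply: le_trans (posterior_le SY Xu W0 (P := fun s => deep s || miss s) (bad := bad) mB _ _) _.
- by move=> v; rewrite /bad; case: ifP => // _; exact: measurable_far.
- move=> w HY Bw; apply: contrapT => /not_orP[nP nb]; apply: HB Bw; split.
  + move=> v sv; rewrite ltnNge; apply/negP => mv; apply: nP; apply/orP; left.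
    apply/hasP; exists v; last by rewrite mv.
    by move: sv => /and3P[vL v2 _]; rewrite mem_nodes ltnW.
  + move=> v vL vl sv; apply/negPn/negP => ns; apply: nP; apply/orP; right.
    by apply/hasP; exists v => //; rewrite vl sv.
  + move=> v sv; have vN : v \in nodes L.
      by move: (sv) => /and3P[vL v2 _]; rewrite mem_nodes ltnW.
    split; first exact: HY.
    rewrite leNgt; apply/negP => h; apply: nb; exists v; split => //.
    by rewrite /bad; move: (sv) => /and3P[-> _ _].
have far0 v : Wset Y X v set0 = 0.
  rewrite /Wset /split_mass; under eq_integral do
    rewrite /split_lik setI0 indic0 mulr0.
  by rewrite integral0.
have h1 : mass L p Wtot (fun s => deep s || miss s) <=
    mass L p Wtot deep + mass L p Wtot miss.
  have := @mass_has R L p Wtot p01 W0 bool [:: true; false] xpredT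
    (fun s => deep s || miss s) (fun b => if b then deep else miss).
  by rewrite !big_cons big_nil addr0; apply => s /=; rewrite orbF.
have h2 : mass L p Wtot deep <= 2 ^+ L.+1 * (2 * n%:R ^- 2 * mass L p Wtot xpredT).
  apply: mass_deep_le => //.
  - by move=> v _ mv; apply: p_le_half; exact: leq_trans mv.
  - exact: deep_factor.
have h3 : mass L p Wtot miss <= 2 ^+ L.+1 * (n%:R ^- 2 * mass L p Wtot xpredT).
  apply: (@le_trans _ _ (\sum_(v <- nodes L | (v.1 < L)%N && signal v)
      mass L p Wtot (fun s => ~~ splitsf s v))).
    by apply: mass_has => // s.
  apply: le_trans (sum_nodes_le L (fun v => (v.1 < L)%N && signal v) _); last first.
    by rewrite mulr_ge0 ?(ltW D0)// invr_ge0 exprn_ge0// ltW.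
  rewrite big_seq_cond [leRHS]big_seq_cond; apply: ler_sum => v /andP[vL /andP[vl sv]].
  exact: signal_split.
have h4 : \sum_(v <- nodes L) Wset Y X v (bad v) / Wtot v <= 2 ^+ L.+1 * n%:R ^- 2.
  have c0 : 0 <= n%:R ^- 2 :> R by rewrite invr_ge0 exprn_ge0// ltW.
  apply: le_trans (sum_nodes_le L xpredT c0).
  rewrite big_seq [leRHS]big_seq; apply: ler_sum => v vL; rewrite /bad.
  case: ifP => _; last by rewrite far0 mul0r.
  apply: le_trans far_le.
  exact: (Wfar_le SY a0 alpha0 K0 mu0 fD n2 XG small_dev vL C40).
have h5 : mass L p Wtot (fun s => deep s || miss s) / mass L p Wtot xpredT <=
    2 ^+ L.+1 * (3 * n%:R ^- 2).
  rewrite ler_pdivrMr//; apply: le_trans h1 _; lra.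
lra.
Qed.

End typical_draws.

(** * Estimator and draws as stopped histograms *)

Section estimator_and_draws.
Context {R : realType}.
Variables (alpha K mu : R) (f : R -> R) (n L : nat) (X : n.-tuple R).
Hypothesis alpha0 : 0 < alpha.
Hypothesis K0 : 0 < K.
Hypothesis mu0 : 0 < mu.
Hypothesis fD : density_class alpha K mu f.
Hypothesis n2 : (1 < n)%N.
Hypothesis XG : good_sample K f L X.
Hypothesis small_dev : forall l, (l <= L)%N -> dev_cst K * noise n l <= mu / 2.

Local Notation noise := (@noise R n).
Local Notation ell := (ln n%:R : R).

Lemma emp_mass_additive : additive_mass (emp_mass X).
Proof. by move=> v _; rewrite /emp_mass ncount_children natrD mulrDl. Qed.

Lemma emp_mass_root : emp_mass X (0, 0)%N = 1.
Proof.
have [Xu _] := XG; rewrite /emp_mass.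
have -> : ncount X (0, 0)%N = n.
  rewrite /ncount -[RHS](size_tuple X); apply/eqP; rewrite -all_count.
  apply/all_tnthP => i; rewrite dyadic_root; exact: Xu.
by rewrite divff// pnatr_eq0 -lt0n ltnW.
Qed.

(** The estimator uses the Haar coefficients of the empirical measure, which
    telescope along each branch of the tree: it is the histogram on the
    leaves. *)
Lemma median_estimatorE (post : set ((R -> R) * tree) -> R) (x : R) j :
  @level_max R n = L ->
  unit_itv x -> (j <= L)%N ->
  (forall l, (node_at x l \in median_int n post) = (l < j)%N) ->
  median_estimator X post x = emp_avg X (node_at x j).
Proof.
move=> nL xu jL Ix; rewrite /median_estimator.
have := haar_sum_tree (I := fun v => v \in median_int n post) emp_mass_additive xu
  (leqW jL) (fun l _ => Ix l).
rewrite emp_mass_root => /eqP; rewrite eq_sym subr_eq => /eqP E.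
rewrite /emp_avg E addrC; congr (_ + 1).
have -> : \sum_(v <- nodes L | v \in median_int n post) haar_term (emp_mass X) v x =
    \sum_(v <- median_int n post) haar_term (emp_mass X) v x.
  rewrite -big_filter; apply: perm_big; apply: uniq_perm.
  - by rewrite filter_uniq ?fset_uniq.
  - exact: fset_uniq.
  move=> v; rewrite mem_filter; apply/andP/idP => [[]//|vI]; split => //.
  by move: vI; rewrite /median_int in_fset /= inE nL => /andP[].
apply: eq_bigr => v _; rewrite /haar_term /emp_mass; congr (_ * _ * _).
by rewrite -mulrBl.
Qed.

Lemma node_at_nodes (x : R) l : unit_itv x -> (l <= L)%N -> node_at x l \in nodes L.
Proof. by move=> xu lL; rewrite mem_nodes lL /= cell_lt. Qed.

Lemma emp_avg_near (x : R) j : unit_itv x -> (j <= L)%N ->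
  `|emp_avg X (node_at x j) - havg f (node_at x j)| <= dev_cst K * noise j.
Proof. by move=> xu jL; have [_ H] := XG; apply: H; exact: node_at_nodes. Qed.

Lemma havg_add v : (v.2 < 2 ^ v.1)%N ->
  havg f v = (havg f (child v false) + havg f (child v true)) / 2.
Proof.
move=> v2; rewrite /havg (pmass_additive alpha0 K0 mu0 fD v2) /= exprS; lra.
Qed.

Lemma havg_step (x : R) l : unit_itv x ->
  `|havg f (node_at x l.+1) - havg f (node_at x l)| =
  `|havg f (child (node_at x l) false) - havg f (child (node_at x l) true)| / 2.
Proof.
move=> xu; have x0 := unit_itv_ge0 xu.
have E := havg_add (v := node_at x l) (cell_lt l xu).
rewrite node_atS// E.
have h2 (z : R) : `|z| / 2 = `|z / 2| by rewrite normrM normfV (gtr0_norm (ltr0Sn R 1)).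
rewrite h2; case: odd; move: (havg _ (child _ false)) (havg _ (child _ true)) => c0 c1.
  by rewrite distrC; congr `|_|; lra.
by congr `|_|; lra.
Qed.

Variable tau : R.
Hypothesis tau0 : 0 < tau.

Local Notation signal := (@signal R f n tau).

(** Bias of a histogram whose tree contains the signals: along the branch of x
    all further Haar coefficients are below the threshold, up to level J, where
    the regularity of f takes over. *)
Lemma bias_le (x : R) j J : unit_itv x ->
  (forall l, (j <= l < J)%N -> ~~ signal (node_at x l)) ->
  `|havg f (node_at x j) - f x| <=
  3 / 2 * (tau * Num.sqrt ell) * noise J + K * scale alpha J.
Proof.
move=> xu ns; have x0 := unit_itv_ge0 xu.
have t0 : 0 <= tau * Num.sqrt ell by rewrite mulr_ge0 ?sqrtr_ge0// ltW.
have near l : `|havg f (node_at x l) - f x| <= K * scale alpha l.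
  exact: (@pmass_near R alpha K mu f alpha0 K0 mu0 fD (node_at x l) x (cell_lt l xu) (node_at_dyadic l x0)).
case: (leqP J j) => Jj.
  apply: le_trans (near j) _; apply: le_trans (_ : _ <= K * scale alpha J) _.
    by rewrite ler_wpM2l ?(ltW K0)// (scale_le alpha0).
  rewrite lerDr; apply: mulr_ge0; last exact: ltW (@noise_gt0 R n n2 _).
  by apply: mulr_ge0 => //; rewrite divr_ge0.
have tel : `|havg f (node_at x j) - havg f (node_at x J)| <=
    \sum_(l < J) tau * Num.sqrt ell / 2 * noise l.
  have Hk k : (j + k <= J)%N -> `|havg f (node_at x j) - havg f (node_at x (j + k))| <=
     \sum_(j <= l < j + k) tau * Num.sqrt ell / 2 * noise l.
    elim: k => [|k IH] kJ; first by rewrite addn0 subrr normr0 big_geq.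
    rewrite addnS big_nat_recr ?leq_addr//=.
    have := ler_normD (havg f (node_at x j) - havg f (node_at x (j + k)))
      (havg f (node_at x (j + k)) - havg f (node_at x (j + k).+1)).
    rewrite addrA subrK => /le_trans; apply; apply: lerD.
      by apply: IH; apply: leq_trans kJ; rewrite addnS.
    rewrite distrC havg_step// mulrAC ler_wpM2r// ltW//.
    by have := ns (j + k)%N; rewrite leq_addr -addnS kJ /signal -ltNge; exact.
  have := Hk (J - j)%N; rewrite subnKC ?(ltnW Jj)// => /(_ (leqnn _)) /le_trans; apply.
  rewrite -(big_mkord xpredT (fun l => tau * Num.sqrt ell / 2 * noise l)).
  rewrite (@big_cat_nat _ _ _ j 0 J) //=; last exact: ltnW.
  by rewrite lerDr sumr_ge0// => l _; rewrite mulr_ge0 ?divr_ge0 ?(ltW (@noise_gt0 R n n2 _)).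
rewrite -mulr_sumr in tel.
have s3 := @noise_sum R n n2 J.
have h := ler_normD (havg f (node_at x j) - havg f (node_at x J)) (havg f (node_at x J) - f x).
rewrite addrA subrK in h; apply: le_trans h _; apply: lerD (near J).
apply: le_trans tel _.
rewrite (_ : 3 / 2 * _ * _ = tau * Num.sqrt ell / 2 * (3 * noise J)); last by ring.
by rewrite ler_wpM2l// divr_ge0.
Qed.

Variable C4 : R.
Hypothesis C40 : 0 <= C4.

(** Bounds the relative error of a split variable of a typical draw, in units
    of noise. *)
Definition ratio_cst : R := (C4 + 4 * dev_cst K / mu) * (2 * (1 + K) / mu).

Lemma ratio_cst_ge0 : 0 <= ratio_cst.
Proof.
have c0 : 0 < dev_cst K by rewrite addr_gt0// mulr_gt0.
have c1 := ltW c0; have m1 := ltW mu0; have k1 := ltW K0.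
by rewrite mulr_ge0// ?divr_ge0// ?addr_ge0// ?divr_ge0// ?mulr_ge0// ?addr_ge0.
Qed.

Lemma havg_gt0 v : (v.2 < 2 ^ v.1)%N -> 0 < havg f v.
Proof.
by move=> v2; have /andP[h _] := pmass_bounds alpha0 K0 mu0 fD v2; exact: lt_le_trans h.
Qed.

Lemma emp_split_near v : v \in nodes L -> (v.1 < L)%N ->
  `|emp_split X v - havg f (child v false) / (2 * havg f v)| <=
  4 * dev_cst K / mu * noise v.1.
Proof.
move=> vL vl; have v2 : (v.2 < 2 ^ v.1)%N by move: vL; rewrite mem_nodes => /andP[].
have e0 := @noise_gt0 R n n2 v.1.
have c0 : 0 < dev_cst K by rewrite addr_gt0// mulr_gt0.
have [_ H] := XG.
have h0 : `|emp_avg X (child v false) - havg f (child v false)| <= dev_cst K * (3 / 2 * noise v.1).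
  apply: le_trans (H (child v false) _) _.
    by rewrite mem_nodes child_lt// andbT.
  by rewrite ler_wpM2l ?(ltW c0)//; exact: noiseS.
have h1 := H v vL.
have /andP[b1 _] := emp_bounds alpha0 K0 mu0 fD XG small_dev vL.
have a1 : 0 < havg f v := havg_gt0 v2.
have a2 : 0 < havg f (child v true) := havg_gt0 (child_lt true v2).
have a3 : 0 < havg f (child v false) := havg_gt0 (child_lt false v2).
have E := havg_add v2.
have m0 := mu0.
move: h0 h1 b1 a1 a2 a3 E; rewrite /emp_split.
set A0 := emp_avg X (child v false); set A := emp_avg X v.
set B0 := havg f (child v false); set B1 := havg f (child v true); set B := havg f v.
move=> h0 h1 b1 a1 a2 a3 E.
have A0' : 0 < A by apply: lt_le_trans b1; rewrite divr_gt0.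
have -> : A0 / (2 * A) - B0 / (2 * B) =
    ((A0 - B0) + (B0 / B) * (B - A)) / (2 * A).
  by field; rewrite !gt_eqF.
have r : 0 <= B0 / B <= 2.
  by rewrite divr_ge0 ?(ltW a1) ?(ltW a3)//= ler_pdivrMr//; lra.
rewrite normrM normfV (gtr0_norm (mulr_gt0 (ltr0Sn R 1) A0')) ler_pdivrMr; last exact: (mulr_gt0 (ltr0Sn R 1) A0').
have num : `|(A0 - B0) + B0 / B * (B - A)| <= 4 * dev_cst K * noise v.1.
  apply: le_trans (ler_normD _ _) _; rewrite normrM.
  have /andP[r1 r2] := r; rewrite (ger0_norm r1) (distrC B A).
  have := ler_pM r1 (normr_ge0 _) r2 h1.
  have : 0 <= dev_cst K * noise v.1 by rewrite mulr_ge0// ltW.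
  move: h0; rewrite (mulrCA (dev_cst K)) -(mulrA 4).
  by move: (dev_cst K * noise v.1) (B0 / B * _) => t u; lra.
apply: le_trans num _.
have ce : 0 <= 4 * dev_cst K * noise v.1 by rewrite !mulr_ge0// ltW.
rewrite (_ : _ / mu * _ * _ = 4 * dev_cst K * noise v.1 * (2 * A / mu)); last by field; rewrite gt_eqF.
by rewrite ler_peMr// ler_pdivlMr//; lra.
Qed.

Lemma split_ratio v (y : R) (b : bool) : v \in nodes L -> (v.1 < L)%N ->
  `|emp_split X v - y| <= C4 * noise v.1 ->
  `|(if b then 1 - y else y) / (havg f (child v b) / (2 * havg f v)) - 1| <=
  ratio_cst * noise v.1.
Proof.
move=> vL vl hy; have v2 : (v.2 < 2 ^ v.1)%N by move: vL; rewrite mem_nodes => /andP[].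
have e0 := @noise_gt0 R n n2 v.1.
have a1 : 0 < havg f v := havg_gt0 v2.
have a2 : 0 < havg f (child v b) := havg_gt0 (child_lt b v2).
have h1 := emp_split_near vL vl.
set r := havg f (child v b) / (2 * havg f v).
have r0 : 0 < r by rewrite divr_gt0// mulr_gt0.
have d1 : `|(if b then 1 - y else y) - r| <= (C4 + 4 * dev_cst K / mu) * noise v.1.
  have -> : `|(if b then 1 - y else y) - r| =
      `|y - havg f (child v false) / (2 * havg f v)|.
    rewrite /r; case: b {a2 r0 r} => //; rewrite -[RHS]normrN; congr `|_|.
    have -> : havg f (child v true) = 2 * havg f v - havg f (child v false).
      by rewrite (havg_add v2); field.
    by field; rewrite gt_eqF.
  have := ler_normD (y - emp_split X v) (emp_split X v - havg f (child v false) / (2 * havg f v)).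
  rewrite addrA subrK (distrC y (emp_split X v)) => /le_trans; apply; rewrite [leRHS]mulrDl.
exact: (lerD hy h1).
rewrite -[X in _ - X](divff (lt0r_neq0 r0)) -mulrBl normrM normfV (gtr0_norm r0).
rewrite ler_pdivrMr//; apply: le_trans d1 _.
have ri : mu / (2 * (1 + K)) <= r.
  have /andP[b1 _] := pmass_bounds alpha0 K0 mu0 fD (child_lt b v2).
  have /andP[_ b2] := pmass_bounds alpha0 K0 mu0 fD v2.
  have k0 : 0 < 1 + K by rewrite addr_gt0.
  rewrite /r ler_pdivlMr; last exact: (mulr_gt0 (ltr0Sn R 1) a1).
  rewrite mulrAC ler_pdivrMr; last exact: (mulr_gt0 (ltr0Sn R 1) k0).
  have m0 := mu0; rewrite -!/(havg f _) in b1 b2; nra.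
have c0 : 0 < dev_cst K by rewrite addr_gt0// mulr_gt0.
have cst0 : 0 <= (C4 + 4 * dev_cst K / mu) * noise v.1.
  by rewrite mulr_ge0 ?(ltW e0)// addr_ge0// divr_ge0 ?mulr_ge0 ?(ltW c0) ?(ltW mu0).
have k0 : 0 < 1 + K by rewrite addr_gt0.
rewrite /ratio_cst (_ : _ * noise v.1 * r =
  (C4 + 4 * dev_cst K / mu) * noise v.1 * (2 * (1 + K) / mu * r)); last by ring.
rewrite ler_peMr// -(ler_pM2l (divr_gt0 mu0 (mulr_gt0 (ltr0Sn R 1) k0))) mulr1.
rewrite mulrA (_ : mu / (2 * (1 + K)) * (2 * (1 + K) / mu) = 1) ?mul1r//.
by field; rewrite !gt_eqF.
Qed.

Hypothesis small_ratio : 6 * ratio_cst * noise L <= 1.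

(** The height of a draw on a leaf is a product of split variables, compared
    factor by factor with the product defining the local average of f. *)
Lemma draw_near (x : R) (j : nat) (y : nat -> R) : unit_itv x -> (j <= L)%N ->
  (forall i, (i < j)%N -> `|emp_split X (node_at x i) - y i| <= C4 * noise i) ->
  `|\prod_(i < j) (2 * (if odd (cell x i.+1) then 1 - y i else y i)) -
    havg f (node_at x j)| <= 6 * ratio_cst * (1 + K) * noise j.
Proof.
move=> xu jL Hy; have x0 := unit_itv_ge0 xu.
pose h j := \prod_(i < j) (2 * (if odd (cell x i.+1) then 1 - y i else y i)).
have g0 i : 0 < havg f (node_at x i) := @havg_gt0 (node_at x i) (cell_lt i xu).
have c0 := ratio_cst_ge0.
have sm i : (i <= L)%N -> 2 * \sum_(k < i) ratio_cst * noise k <= 6 * ratio_cst * noise i.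
  move=> iL; rewrite -mulr_sumr.
  have := ler_wpM2l c0 (@noise_sum R n n2 i); lra.
have sm1 i : (i <= L)%N -> 2 * \sum_(k < i) ratio_cst * noise k <= 1.
  move=> iL; apply: le_trans (sm i iL) _; apply: le_trans small_ratio.
  apply: ler_wpM2l; last exact: (@noise_le R n n2).
  by apply: mulr_ge0.
have H i : (i <= j)%N -> `|h i / havg f (node_at x i) - 1| <= 2 * \sum_(k < i) ratio_cst * noise k.
  elim: i => [|i IH] ij.
    rewrite /h !big_ord0 mulr0.
    have -> : havg f (node_at x 0) = 1.
      rewrite /havg expr0 mul1r -(pmass_root fD) /node_at; congr (pmass f (_, _)).
      by apply/eqP; have := cell_lt 0 xu; rewrite expn0 ltnS leqn0.
    by rewrite divr1 subrr normr0.
  have iL : (i < L)%N by exact: leq_trans jL.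
  have nL : node_at x i \in nodes L by apply: node_at_nodes => //; exact: ltnW.
  have dr := split_ratio (odd (cell x i.+1)) nL iL (Hy i ij).
  rewrite -node_atS// in dr.
  have IHi := IH (ltnW ij); have s1 := sm1 i (ltnW iL).
  have -> : h i.+1 / havg f (node_at x i.+1) = h i / havg f (node_at x i) *
      ((if odd (cell x i.+1) then 1 - y i else y i) /
       (havg f (node_at x i.+1) / (2 * havg f (node_at x i)))).
    rewrite /h big_ord_recr /=; field.
    by rewrite !gt_eqF.
  rewrite big_ord_recr /= in IHi s1 *.
  move: dr IHi s1; set u := h i / _; set z := _ / _; set s := \sum_(k < i) _; set t := ratio_cst * _.
  move=> dr IHi s1.
  have t0 : 0 <= t by apply: le_trans dr.
  have u2 : `|u| <= 2.
    have := ler_normD (u - 1) 1; rewrite subrK normr1; lra.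
  rewrite (_ : u * z - 1 = (u - 1) + u * (z - 1)); last by ring.
  apply: le_trans (ler_normD _ _) _; rewrite normrM.
  have := ler_pM (normr_ge0 _) (normr_ge0 _) u2 dr; lra.
have Hj := le_trans (H j (leqnn _)) (sm j jL).
have hj := g0 j.
have -> : \prod_(i < j) (2 * (if odd (cell x i.+1) then 1 - y i else y i)) - havg f (node_at x j)
    = (h j / havg f (node_at x j) - 1) * havg f (node_at x j).
  by rewrite mulrBl mul1r divfK ?gt_eqF.
rewrite normrM (gtr0_norm hj) mulrAC.
have /andP[_ b2] := @pmass_bounds R alpha K mu f alpha0 K0 mu0 fD (node_at x j) (cell_lt j xu).
by apply: ler_pM => //; exact: ltW.
Qed.

End estimator_and_draws.

(** * The median tree and the confidence set *)

Section self_similarity.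
Context {R : realType}.
Variables (alpha K mu eta tau : R) (f : R -> R) (n j0 : nat).
Hypothesis alpha0 : 0 < alpha.
Hypothesis K0 : 0 < K.
Hypothesis mu0 : 0 < mu.
Hypothesis fD : density_class alpha K mu f.
Hypothesis n2 : (1 < n)%N.
Hypothesis tau0 : 0 < tau.

Local Notation ell := (ln n%:R : R).

Lemma scaleE l : scale alpha l = 2 `^ (- (l%:R * alpha)) :> R.
Proof.
rewrite /scale -mulNr powRrM; congr (_ `^ _).
by rewrite powRN powR_mulrn.
Qed.

(** Without a signal at the levels from J to J + h, the histogram of level J
    would be closer to f than self-similarity permits. *)
Lemma signal_exists (J h : nat) : self_similar j0 alpha K eta f -> (j0 <= J)%N ->
  3 / 2 * (tau * Num.sqrt ell) * @noise R n (J + h) + K * scale alpha (J + h) <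
    eta * scale alpha J ->
  exists (x : R) l, [/\ unit_itv x, (J <= l < J + h)%N & @signal R f n tau (node_at x l)].
Proof.
move=> [_ fS] jJ Hh; apply: contrapT => nex.
have := fS J jJ; rewrite -scaleE leNgt => /negP; apply.
apply: (@le_lt_trans _ _ (3 / 2 * (tau * Num.sqrt ell) * @noise R n (J + h) + K * scale alpha (J + h))%:E); last by rewrite lte_fin.
apply: ub_ereal_sup => _ /= [x xu <-]; rewrite lee_fin.
rewrite (haar_projE alpha0 K0 mu0 fD J xu).
apply: (bias_le alpha0 K0 mu0 fD n2 tau0 (J := (J + h)%N) (j := J) xu).
by move=> l lJ; apply/negP => sg; apply: nex; exists x, l.
Qed.

End self_similarity.

Section median_region.
Context {R : realType} {d} {Om : measurableType d} (Q : probability Om R).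
Variables (p : node -> R) (a : R).
Variables (S : node -> {RV Q >-> bool}) (Y : seq bool -> {RV Q >-> R}).
Hypothesis SY : opt_variables p a S Y.
Variables (alpha K mu : R) (f : R -> R) (n L : nat) (X : n.-tuple R).
Hypothesis alpha0 : 0 < alpha.
Hypothesis K0 : 0 < K.
Hypothesis mu0 : 0 < mu.
Hypothesis fD : density_class alpha K mu f.
Hypothesis n2 : (1 < n)%N.
Hypothesis XG : good_sample K f L X.
Hypothesis small_dev : forall l, (l <= L)%N -> dev_cst K * noise n l <= mu / 2.
Hypothesis nL : @level_max R n = L.
Hypothesis W0 : forall v, v \in nodes L -> 0 < Wtot Y X v.

Local Notation noise := (@noise R n).
Local Notation ell := (ln n%:R : R).
Local Notation conf := (conf S L).
Local Notation splitsw w := (splits L (fun u => u \in conf w)).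
Local Notation draw := (draw S Y L).
Local Notation post := (posterior Q draw X).

Variables (m : nat) (tau C4 bad : R).
Hypothesis tau0 : 0 < tau.
Hypothesis C40 : 0 <= C4.
Hypothesis mL : (m <= L)%N.
Hypothesis bad_lt : bad < 1 / 2.

Local Notation signal := (@signal R f n tau).
Local Notation typical := (typical S Y f L X m tau C4).

Hypothesis atypical : forall B : set ((R -> R) * tree), measurable (draw @^-1` B) ->
  (forall w, typical w -> ~ B (draw w)) -> post B <= bad.

Let Xu i : unit_itv (tnth X i). Proof. by have [] := XG. Qed.

Lemma posterior_typical (B : set ((R -> R) * tree)) : measurable (draw @^-1` B) ->
  (forall w, typical w -> B (draw w)) -> 1 - bad <= post B <= 1.
Proof.
move=> mB HB; have mBC : measurable (draw @^-1` (~` B)).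
  by rewrite preimage_setC; exact: measurableC.
rewrite (posterior_setC SY Xu W0 mB) lerB//=; last first.
  by apply: atypical => // w /HB h /=; exact.
by rewrite gerBl (posterior_ge0 SY Xu mBC).
Qed.

Lemma mem_tree_int_draw w v : (v \in tree_int (draw w).2) = splitsw w v.
Proof. by rewrite mem_tree_int_grow splits_conf. Qed.

Lemma measurable_split_event v :
  measurable (draw @^-1` [set fT | v \in tree_int fT.2]).
Proof.
rewrite [X in measurable X](_ : _ = [set w | splitsw w v]).
  exact: (measurable_conf S L (fun s => splits L (fun u => u \in s) v)).
by apply/seteqP; split => w; rewrite /= mem_tree_int_draw.
Qed.

(** Needed for the median tree to be a tree: a node is split no more often
    than its ancestors. *)
Lemma posterior_mono (B B' : set ((R -> R) * tree)) :
  measurable (draw @^-1` B) -> measurable (draw @^-1` B') ->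
  draw @^-1` B `<=` draw @^-1` B' -> post B <= post B'.
Proof.
move=> mB mB' BB'; pose D := B' `&` ~` B.
have mBC : measurable (draw @^-1` (~` B)).
  by rewrite preimage_setC; exact: measurableC.
have mBC' : measurable (draw @^-1` (~` B')).
  by rewrite preimage_setC; exact: measurableC.
rewrite /posterior /Rintegral !(integral_lik SY L Xu)//.
have D0 := massT_gt0 SY W0.
have mS := measurable_likS S Y L X (fun v => @measurableT _ R).
have i1 : (\int[Q]_(w in setT) (likS S Y L X (fun=> setT) w)%:E < +oo)%E.
  by rewrite (integral_likS1 SY)// ltry.
have le1 (C : set Om) : measurable C ->
    (\int[Q]_(w in C) (likS S Y L X (fun=> setT) w)%:E \is a fin_num)%E.
  move=> mC; rewrite ge0_fin_numE; last first.
    by apply: integral_ge0 => w _; rewrite lee_fin likS_ge0.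
  apply: le_lt_trans i1; apply: ge0_subset_integral => //.
    exact/measurable_EFinP.
  by move=> w _; rewrite lee_fin likS_ge0.
rewrite ler_wpM2r//.
  by rewrite invr_ge0 fine_ge0// integral_ge0// => w _; rewrite lee_fin likS_ge0.
apply: fine_le; rewrite ?le1//; apply: ge0_subset_integral => //.
  by apply/measurable_EFinP/measurable_funTS.
by move=> w _; rewrite lee_fin likS_ge0.
Qed.

Lemma mem_median_int v : (v \in median_int n post) =
  (v \in nodes L) && (2^-1 < post [set fT | v \in tree_int fT.2]).
Proof. by rewrite /median_int in_fset /= inE nL. Qed.

Lemma median_signal v : v \in nodes L -> (v.1 < L)%N -> signal v ->
  v \in median_int n post.
Proof.
move=> vL vl sv; rewrite mem_median_int vL /=.
have /andP[h _] : 1 - bad <= post [set fT | v \in tree_int fT.2] <= 1.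
  apply: posterior_typical; first exact: measurable_split_event.
  by move=> w [_ + _] => /(_ v vL vl sv); rewrite /= mem_tree_int_draw.
by apply: lt_le_trans h; have := bad_lt; lra.
Qed.

(** What all typical draws share, the median tree shares: typical draws have
    posterior probability more than 1/2. *)
Lemma median_typical (P : pred node) :
  (forall w v, typical w -> splitsw w v -> P v) ->
  forall v, v \in median_int n post -> P v.
Proof.
move=> HP v; rewrite mem_median_int => /andP[vL hv]; apply/negPn/negP => nP.
suff : post [set fT | v \in tree_int fT.2] <= bad by have := bad_lt; lra.
apply: atypical; first exact: measurable_split_event.
by move=> w tw /=; rewrite mem_tree_int_draw => /(HP w v tw); apply/negP.
Qed.

Lemma median_lt_m v : v \in median_int n post -> (v.1 < m)%N.
Proof. by apply: (@median_typical (fun v => v.1 < m)%N) => w u [+ _ _]; apply. Qed.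

Lemma median_ancestor v i : (i <= v.1)%N -> v \in median_int n post ->
  ancestor v i \in median_int n post.
Proof.
move=> iv; rewrite !mem_median_int => /andP[vL hv].
have /andP[v1 v2] : (v.1 <= L)%N && (v.2 < 2 ^ v.1)%N by rewrite -mem_nodes.
rewrite mem_nodes ancestor_lt// (leq_trans iv v1) /=.
apply: (lt_le_trans hv); apply: posterior_mono; [exact: measurable_split_event..|].
by move=> w /=; rewrite !mem_tree_int_draw; exact: splits_ancestor.
Qed.

Lemma median_branch (x : R) : unit_itv x ->
  exists2 j, (j <= L)%N & forall l, (node_at x l \in median_int n post) = (l < j)%N.
Proof.
move=> xu; apply: (@branch_length R (fun v => v \in median_int n post)).
- exact: unit_itv_ge0.
- by move=> v /median_lt_m h; exact: leq_trans mL.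
- by move=> v i; exact: median_ancestor.
Qed.

Local Notation dm := (depth (median_tree n post)).

Lemma depth_gt v : v \in median_int n post -> (v.1 < dm)%N.
Proof.
move=> vI; have h : child v false \in median_tree n post.
  by rewrite mem_tree_of_int parent_child vI orbT.
exact: (@leq_bigmax_seq _ (enum_fset (median_tree n post)) xpredT (fun u : node => u.1) _ h isT).
Qed.

Lemma depth_le_m : (dm <= m)%N.
Proof.
rewrite /depth big_seq; apply: (big_ind (fun k => (k <= m)%N)) => //.
  by move=> k l km lm; rewrite geq_max km.
move=> u; rewrite mem_tree_of_int => /orP[/eqP-> //|/andP[u0 /median_lt_m]].
by rewrite /parent /= prednK.
Qed.

Lemma branch_le_depth (x : R) j :
  (forall l, (node_at x l \in median_int n post) = (l < j)%N) -> (j <= dm)%N.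
Proof.
case: j => // j /(_ j); rewrite ltnSn => h; exact: (depth_gt (v := node_at x j)).
Qed.

Lemma band_radiusE (v : nat -> R) : band_radius v n post = v n * noise dm.
Proof.
rewrite /band_radius /noise -mulrA; congr (_ * _).
have n0 : 0 < n%:R :> R := @n_gt0 R n n2.
have l0 : 0 < ell := @ln_nat_gt0 R n n2.
have -> : 2 `^ (dm%:R / 2) = Num.sqrt (2 ^+ dm) :> R.
  by rewrite -powR12_sqrt ?exprn_ge0// -powR_mulrn// -powRrM.
by rewrite -sqrtrM ?divr_ge0 ?(ltW n0) ?(ltW l0)// mulrC mulrA.
Qed.

Variables (J : nat) (v : nat -> R) (Cb Cm : R).
Hypothesis signal_J : exists (x : R) l, [/\ unit_itv x, (J <= l < L)%N & signal (node_at x l)].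
Hypothesis scale_J : K * scale alpha J <= Cb * Num.sqrt ell * noise J.
Hypothesis noise_m : noise m <= Cm * Num.sqrt ell * noise J.
Hypothesis small_ratio : 6 * ratio_cst K mu C4 * noise L <= 1.
Hypothesis v_big : (6 * ratio_cst K mu C4 * (1 + K) * Cm + (3 * tau + 2 * Cb)) *
  Num.sqrt ell + dev_cst K <= v n.
Hypothesis Cb0 : 0 <= Cb.
Hypothesis Cm0 : 0 <= Cm.

Let JL : (J < L)%N.
Proof. by have [x [l [_ /andP[/leq_ltn_trans h lL] _]]] := signal_J; exact: h lL. Qed.

(** Self-similarity forces a signal at level J or beyond, and the median tree
    splits it: this is why the depth of the tree, and with it the radius,
    adapts to the truth from below. *)
Lemma J_le_depth : (J <= dm)%N.
Proof.
have [x [l [xu /andP[Jl lL] sg]]] := signal_J.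
have /depth_gt /= h : node_at x l \in median_int n post.
  by apply: median_signal => //; apply: node_at_nodes => //; exact: ltnW.
by apply: leq_trans Jl _; exact: ltnW.
Qed.

(** Both the estimator and a typical draw are histograms along x that stop only
    after the last signal; beyond it f moves by less than the radius. *)
Lemma stopped_bias (x : R) (I : pred node) j : unit_itv x ->
  (forall u, u \in nodes L -> (u.1 < L)%N -> signal u -> I u) ->
  (forall l, I (node_at x l) = (l < j)%N) ->
  `|havg f (node_at x j) - f x| <= (3 / 2 * tau + Cb) * Num.sqrt ell * noise J.
Proof.
move=> xu sI Ij; apply: le_trans (bias_le alpha0 K0 mu0 fD n2 tau0 (J := J) xu _) _.
  move=> l /andP[jl lJ]; apply/negP => sg.
  have lL : (l < L)%N := ltn_trans lJ JL.
  have := sI (node_at x l) (node_at_nodes xu (ltnW lL)) lL sg.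
  by rewrite Ij ltnNge jl.
by have h := scale_J; rewrite !mulrDl; apply: lerD; rewrite // !mulrA.
Qed.

Let noise_mono l l' : (l <= l')%N -> noise l <= noise l'.
Proof. exact: (@noise_le R n n2). Qed.

Let noise0 l : 0 <= noise l. Proof. exact: ltW (@noise_gt0 R n n2 l). Qed.

Let cD0 : 0 < dev_cst K. Proof. by rewrite addr_gt0// mulr_gt0. Qed.

Let ratio0 : 0 <= ratio_cst K mu C4. Proof. exact: ratio_cst_ge0. Qed.

Let c60 : 0 <= 6 * ratio_cst K mu C4 * (1 + K).
Proof. by apply: mulr_ge0; [exact: mulr_ge0|rewrite addr_ge0// ltW]. Qed.

Lemma estimator_near (x : R) : unit_itv x ->
  `|median_estimator X post x - f x| <=
  dev_cst K * noise dm + (3 / 2 * tau + Cb) * Num.sqrt ell * noise dm.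
Proof.
move=> xu; have [j jL Hj] := median_branch xu.
rewrite (median_estimatorE n2 XG nL xu jL (fun l => Hj l)).
have h1 := emp_avg_near XG xu jL.
have h2 := stopped_bias xu (fun u => @median_signal u) Hj.
have h := ler_normD (emp_avg X (node_at x j) - havg f (node_at x j)) (havg f (node_at x j) - f x).
rewrite addrA subrK in h; apply: (le_trans h); apply: lerD.
  apply: (le_trans h1); rewrite ler_wpM2l ?(ltW cD0)//; apply: noise_mono.
  exact: branch_le_depth Hj.
apply: (le_trans h2); rewrite ler_wpM2l ?noise_mono ?J_le_depth// mulr_ge0 ?sqrtr_ge0// addr_ge0//.
by rewrite mulr_ge0 ?(ltW tau0)// divr_ge0.
Qed.

Lemma draw_density_near (w : Om) (x : R) : typical w -> unit_itv x ->
  `|(draw w).1 x - f x| <=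
  6 * ratio_cst K mu C4 * (1 + K) * noise m + (3 / 2 * tau + Cb) * Num.sqrt ell * noise dm.
Proof.
move=> [tm ts tY] xu; have x0 := unit_itv_ge0 xu.
have [j jL Hj] := @splits_branch R L (S^~ w) x x0.
have Hj' l : splitsw w (node_at x l) = (l < j)%N by rewrite -splits_conf.
have E : (draw w).1 x = \prod_(i < j) (2 * (if odd (cell x i.+1)
    then 1 - Ysplit Y (node_at x i) w else Ysplit Y (node_at x i) w)).
  rewrite /draw /opt_draw /= (opt_density_path _ xu jL Hj); apply: eq_bigr => i _.
  rewrite node_atS// word_of_child /Ysplit; case: odd => //.
  by have [_ _ Yt _] := SY; rewrite Yt.
have h1 := draw_near alpha0 K0 mu0 fD n2 XG small_dev C40 small_ratio xu jL
  (y := fun i => Ysplit Y (node_at x i) w).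
have {}h1 : `|(draw w).1 x - havg f (node_at x j)| <= 6 * ratio_cst K mu C4 * (1 + K) * noise j.
  rewrite E; apply: h1 => i ij; have := tY (node_at x i); rewrite Hj' ij => /(_ isT)[_].
  by [].
have h2 := stopped_bias xu ts Hj'.
have jm : (j <= m)%N.
  by case: j {jL h1 h2 E} Hj Hj' => // j _ /(_ j); rewrite ltnSn => /tm.
have h := ler_normD ((draw w).1 x - havg f (node_at x j)) (havg f (node_at x j) - f x).
rewrite addrA subrK in h; apply: (le_trans h); apply: lerD.
  by apply: (le_trans h1); rewrite ler_wpM2l ?noise_mono.
apply: (le_trans h2); rewrite ler_wpM2l ?noise_mono ?J_le_depth// mulr_ge0 ?sqrtr_ge0// addr_ge0//.
by rewrite mulr_ge0 ?(ltW tau0)// divr_ge0.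
Qed.

Lemma confidence_setP (g : R -> R) : confidence_set v X post g <->
  forall x, unit_itv x -> `|g x - median_estimator X post x| <= v n * noise dm.
Proof.
rewrite /confidence_set /= band_radiusE /sup_dist; split => [h x xu|h].
  rewrite -lee_fin; apply: le_trans h; apply: ereal_sup_ubound.
  by exists x.
by apply: ub_ereal_sup => _ [x xu <-]; rewrite lee_fin; exact: h.
Qed.

Let s0 : 0 <= Num.sqrt ell. Proof. exact: sqrtr_ge0. Qed.

Lemma truth_in_band : confidence_set v X post f.
Proof.
apply/confidence_setP => x xu; rewrite distrC; apply: (le_trans (estimator_near xu)).
rewrite -mulrDl ler_wpM2r//; apply: le_trans v_big.
have c1 : 0 <= 6 * ratio_cst K mu C4 * (1 + K) * Cm * Num.sqrt ell.
  by apply: mulr_ge0 => //; exact: mulr_ge0.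
have c2 : 0 <= (3 / 2 * tau + Cb) * Num.sqrt ell.
  by rewrite mulr_ge0// addr_ge0// mulr_ge0 ?(ltW tau0)// divr_ge0.
lra.
Qed.

Lemma draw_in_band w : typical w -> confidence_set v X post (draw w).1.
Proof.
move=> tw; apply/confidence_setP => x xu.
have h1 := draw_density_near tw xu; have h2 := estimator_near xu.
have h := ler_distD (f x) ((draw w).1 x) (median_estimator X post x).
rewrite (distrC (f x)) in h.
have h3 : 6 * ratio_cst K mu C4 * (1 + K) * noise m <=
    6 * ratio_cst K mu C4 * (1 + K) * Cm * Num.sqrt ell * noise dm.
  rewrite -2![leRHS]mulrA ler_wpM2l//; apply: (le_trans noise_m).
  by rewrite mulrA ler_wpM2l ?mulr_ge0// noise_mono// J_le_depth.
have h4 : ((6 * ratio_cst K mu C4 * (1 + K) * Cm + (3 * tau + 2 * Cb)) *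
  Num.sqrt ell + dev_cst K) * noise dm <= v n * noise dm by rewrite ler_wpM2r.
apply: le_trans h4; apply: (le_trans h); apply: (le_trans (lerD h1 h2)).
apply: (le_trans (lerD (lerD h3 (lexx _)) (lexx _))).
move: (noise dm) (dev_cst K) (ratio_cst K mu C4) (Num.sqrt ell) => x1 x2 x3 x4.
by rewrite le_eqVlt; apply/orP; left; apply/eqP; field.
Qed.

Lemma dyadic_cell (x y : R) u : unit_itv x -> unit_itv y -> cell x L = cell y L ->
  (u.1 <= L)%N -> (x \in dyadic u) = (y \in dyadic u).
Proof.
move=> xu yu xy uL; rewrite !mem_dyadic ?unit_itv_ge0//.
by rewrite -(cell_ancestor (l := L))// ?unit_itv_ge0// xy cell_ancestor// unit_itv_ge0.
Qed.

Lemma draw_cell w (x y : R) : unit_itv x -> unit_itv y -> cell x L = cell y L ->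
  (draw w).1 x = (draw w).1 y.
Proof.
move=> xu yu xy; rewrite /draw /opt_draw /= !opt_density_prod//.
apply: eq_bigr => u /and3P[uL _ _]; apply: eq_bigr => b _.
by rewrite (dyadic_cell xu yu xy).
Qed.

Lemma estimator_cell (x y : R) : unit_itv x -> unit_itv y -> cell x L = cell y L ->
  median_estimator X post x = median_estimator X post y.
Proof.
move=> xu yu xy.
have cE l : (l <= L)%N -> node_at x l = node_at y l.
  move=> lL; congr (_, _); rewrite -(cell_ancestor (l := L))// ?unit_itv_ge0// xy.
  by rewrite cell_ancestor// unit_itv_ge0.
have [j jL Hj] := median_branch xu; have [k kL Hk] := median_branch yu.
(* the branches of x and y leave the median tree at the same level *)
have jk : j = k.
  apply/eqP; rewrite eqn_leq; apply/andP; split; rewrite leqNgt; apply/negP => h.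
    by have := Hj k; rewrite h cE// Hk ltnn.
  by have := Hk j; rewrite h -cE// Hj ltnn.
rewrite (median_estimatorE n2 XG nL xu jL (fun l => Hj l)).
by rewrite (median_estimatorE n2 XG nL yu kL (fun l => Hk l)) -jk cE.
Qed.

Lemma measurable_draw_at (x : R) : unit_itv x ->
  measurable_fun setT (fun w => (draw w).1 x).
Proof.
move=> xu; rewrite (_ : (fun w => _) = fun w => \prod_(u <- nodes L)
    (if splitsw w u then \prod_(b : bool) (2 * Y (word_of (child u b)) w) ^+ (x \in dyadic (child u b))
     else 1)).
  apply: measurable_prod_conf => u; apply: measurable_prod => b _.
  by apply: measurable_funX; apply: measurable_funM => //; exact: measurable_funPT.
apply/funext => w; rewrite /draw /opt_draw /= opt_density_prod// big_mkcond /=.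
by apply: eq_bigr => u _; rewrite splits_conf.
Qed.

(** A draw and the estimator are constant on the cells of level L, so that the
    supremum in the definition of the set is a maximum over these cells. *)
Lemma measurable_band :
  measurable (draw @^-1` [set fT | confidence_set v X post fT.1]).
Proof.
pose pt (k : 'I_(2 ^ L)) : R := lpoint (L, k : nat).
have ptu k : unit_itv (pt k).
  exact: (@dyadic_unit R (L, k : nat) _ (ltn_ord k) (lpoint_dyadic _)).
have ptc k : cell (pt k) L = k.
  apply/eqP; rewrite eq_sym.
  have := lpoint_dyadic (R := R) (L, k : nat).
  by rewrite mem_dyadic ?unit_itv_ge0//; exact: ptu.
rewrite [X in measurable X](_ : _ = \bigcap_(k in [set: 'I_(2 ^ L)])
  [set w | `|(draw w).1 (pt k) - median_estimator X post (pt k)| <= v n * noise dm]).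
  apply: fin_bigcap_measurable => // k _.
  have mf : measurable_fun setT (fun w => `|(draw w).1 (pt k) - median_estimator X post (pt k)|).
    apply: measurableT_comp => //; apply: measurable_funB => //.
    exact: measurable_draw_at.
  rewrite -[X in measurable X]setTI.
  have := mf measurableT [set` `]-oo, (v n * noise dm)]] (measurable_itv _).
  by congr measurable; apply/seteqP; split => w /=; rewrite in_itv.
apply/seteqP; split => [w /= /confidence_setP h k _ /=|w h /=]; first exact: h.
apply/confidence_setP => x xu.
have c := cell_lt L xu.
have xk : cell x L = cell (pt (Ordinal c)) L by rewrite ptc.
have h' : `|(draw w).1 (pt (Ordinal c)) - median_estimator X post (pt (Ordinal c))| <=
    v n * noise dm := h (Ordinal c) I.
by rewrite -(draw_cell w xu (ptu _) xk) -(estimator_cell xu (ptu _) xk) in h'.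
Qed.

Lemma posterior_band :
  1 - bad <= post [set fT | confidence_set v X post fT.1] <= 1.
Proof. by apply: posterior_typical; [exact: measurable_band|exact: draw_in_band]. Qed.

Lemma diameter_le : 0 <= v n ->
  (sup_diameter (confidence_set v X post) <= (2 * (v n * noise m))%:E)%E.
Proof.
move=> v0; apply: ub_ereal_sup => _ [[g1 g2] /= [/confidence_setP h1 /confidence_setP h2] <-].
apply: ub_ereal_sup => _ [x xu <-]; rewrite lee_fin.
have h := ler_distD (median_estimator X post x) (g1 x) (g2 x).
rewrite (distrC (median_estimator X post x) (g2 x)) in h.
have h3 : v n * noise dm <= v n * noise m by rewrite ler_wpM2l// noise_mono// depth_le_m.
have := h1 x xu; have := h2 x xu; lra.
Qed.

End median_region.

(** * Resolution levels for large samples *)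

Lemma le_of_eq {R : realType} (x y : R) : x = y -> x <= y.
Proof. by move->. Qed.

Lemma pow_between {R : realType} (y b : R) : 1 <= y -> 1 <= b <= 3 ->
  exists j, y <= (2 ^+ j) `^ b <= 8 * y.
Proof.
move=> y1 /andP[b1 b3].
have p1 j : (1 : R) <= 2 ^+ j by rewrite exprn_ege1// ler1n.
have ex : exists j, y <= (2 ^+ j) `^ b.
  exists (Num.truncn y).+1; apply: le_trans (_ : 2 ^+ (Num.truncn y).+1 <= _); last first.
    by rewrite -[leLHS]powRr1 ?ler_powR// (le_trans ler01).
  have /andP[_ h] := truncn_itv (le_trans ler01 y1); apply: ltW; apply: (lt_le_trans h).
  by rewrite -natrX ler_nat ltnW// ltn_expl.
case: (ex_minnP ex) => j yj jmin; exists j; rewrite yj /=.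
case: j yj jmin => [|j] yj jmin.
  rewrite expr0 powR1; lra.
have h : (2 ^+ j) `^ b < y.
  by rewrite ltNge; apply/negP => /jmin; rewrite ltnn.
rewrite exprS powRM ?exprn_ge0//; apply: ler_pM; rewrite ?powR_ge0 ?(ltW h)//.
apply: (@le_trans _ _ (2 `^ 3%:R)); first by rewrite ler_powR// ler1n.
by rewrite powR_mulrn//; lra.
Qed.

Section large_samples.
Context {R : realType}.
Variable n : nat.
Hypothesis n2 : (1 < n)%N.
Local Notation ell := (ln n%:R : R).
Hypothesis ell_ge : 216 <= ell.

Local Notation noise := (@noise R n).
Variable L : nat.
Hypothesis nL : @level_max R n = L.
Local Notation z := (n%:R / ell ^+ 2 : R).

Lemma nat_expR_ln : n%:R = expR ell. Proof. by rewrite lnK// posrE ltr0n ltnW. Qed.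

Lemma ell0 : 0 < ell. Proof. have := ell_ge; lra. Qed.

Lemma sqrt_n_ge : ell ^+ 2 <= expR (ell / 2).
Proof.
have -> : ell / 2 = (ell / 6) * 3%:R by lra.
rewrite expRM_natr; have h := expR_ge1Dx (ell / 6); have l := ell_ge.
have h' : (ell / 6) ^+ 3 <= expR (ell / 6) ^+ 3.
  by rewrite lerXn2r ?nnegrE ?expR_ge0//; lra.
apply: le_trans h'; rewrite exprMn [X in _ <= X * _]exprS.
by move: (sqr_ge0 ell); move: (ell ^+ 2) => t t0; nra.
Qed.

Lemma z_ge : expR (ell / 2) <= z.
Proof.
rewrite ler_pdivlMr ?exprn_gt0 ?ell0//.
apply: le_trans (ler_wpM2l (expR_ge0 _) sqrt_n_ge) _.
by rewrite [leRHS]nat_expR_ln -expRD; apply: le_of_eq; congr expR; field.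
Qed.

Lemma z_ge_ell : ell / 2 <= z.
Proof. by apply: le_trans z_ge; have := expR_ge1Dx (ell / 2); lra. Qed.

Lemma z_ge1 : 1 <= z. Proof. have := z_ge_ell; have := ell_ge; lra. Qed.

Lemma level_maxP : 2 ^+ L <= z < 2 ^+ L.+1.
Proof.
have l2 : 0 < ln 2 :> R by rewrite ln_gt0// ltr1n.
have z0 : 0 < z := lt_le_trans ltr01 z_ge1.
have /truncn_itv : 0 <= ln z / ln 2 by rewrite divr_ge0 ?(ltW l2) ?ln_ge0 ?z_ge1.
rewrite -/(level_max n) nL; move: L => k; rewrite ler_pdivlMr// ltr_pdivrMr// => /andP[h1 h2].
have k0 i : (2 : R) ^+ i \is Num.pos by rewrite posrE exprn_gt0.
have zp : z \is Num.pos by rewrite posrE.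
rewrite -(ler_ln (k0 k) zp) -(ltr_ln zp (k0 k.+1)) !lnXn//.
by rewrite -(mulr_natl _ k) -(mulr_natl _ k.+1) h1.
Qed.

Lemma noise_top l : (l <= L)%N -> noise l ^+ 2 <= ell^-1.
Proof.
move=> lL; have /andP[h _] := level_maxP.
have n0 : 0 < n%:R :> R := @n_gt0 R n n2.
rewrite (@noise_sq R n n2) ler_pdivrMr//.
have h' : 2 ^+ l <= z by apply: le_trans h; rewrite ler_weXn2l// ler1n.
rewrite ler_pdivlMr ?exprn_gt0 ?ell0// in h'.
by rewrite [leRHS]mulrC ler_pdivlMr ?ell0// -mulrA -expr2.
Qed.

Lemma noise_small l (c : R) : 0 < c -> (l <= L)%N -> c ^- 2 <= ell -> noise l <= c.
Proof.
move=> c0 lL hc; rewrite -ler_sqr ?nnegrE ?(ltW c0) ?(ltW (@noise_gt0 R n n2 _))//.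
apply: le_trans (noise_top lL) _.
by rewrite -[leRHS]invrK lef_pV2 ?posrE ?invr_gt0 ?exprn_gt0 ?ell0.
Qed.

Lemma pow2_le_n : 2 ^+ L <= n%:R :> R.
Proof.
have /andP[h _] := level_maxP; apply: (le_trans h).
have n0 : 0 < n%:R :> R := @n_gt0 R n n2.
rewrite ler_pdivrMr ?(exprn_gt0 _ ell0)// ler_peMr ?(ltW n0)//.
by apply: exprn_ege1; have := ell_ge; lra.
Qed.

Lemma pow2_le : 2 ^+ L.+1 * n%:R ^- 2 <= 2 / n%:R :> R.
Proof.
have n0 : 0 < n%:R :> R := @n_gt0 R n n2.
have := pow2_le_n; move: L => k h.
rewrite exprS -mulrA ler_wpM2l// ler_pdivrMr ?(exprn_gt0 _ n0)// expr2 mulKf//.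
by rewrite gt_eqF.
Qed.

Lemma level_max_le : L.+1%:R <= 3 * ell :> R.
Proof.
have h2 := pow2_le_n; have n0 : 0 < n%:R :> R := @n_gt0 R n n2.
move: L h2 => k h2.
have kp : (2 : R) ^+ k \is Num.pos by rewrite posrE exprn_gt0.
have np : n%:R \is @Num.pos R by rewrite posrE.
rewrite -(ler_ln kp np) lnXn// -(mulr_natl _ k) in h2.
have l2 : 1 / 2 <= ln 2 :> R.
  rewrite -ler_expR lnK ?posrE//; have := @expR_quadratic R (1 / 2).
  by rewrite ger0_norm// ?divr_ge0// lexx => /(_ isT); lra.
have := ell_ge; rewrite -(@natr1 _ k).
have : 0 <= k%:R :> R by rewrite ler0n.
move: (k%:R : R) h2 l2 => t h2 l2 t0 l0.
have l2' : 0 <= ln 2 - 1 / 2 :> R by lra.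
have := mulr_ge0 t0 l2'; lra.
Qed.

Variables (alpha1 alpha : R).
Hypothesis alpha10 : 0 < alpha1.
Hypothesis alpha_itv : alpha1 <= alpha <= 1.

Let b : R := 2 * alpha + 1.

Let b_itv : 1 <= b <= 3.
Proof. by have := alpha_itv; have := alpha10; rewrite /b => ? /andP[? ?]; apply/andP; split; lra. Qed.

Let b0 : 0 < b. Proof. by have /andP[? _] := b_itv; lra. Qed.

Let p0 (j : nat) : (0 : R) < 2 ^+ j. Proof. by rewrite exprn_gt0. Qed.

(** The exponent b is at least 1 + 2 alpha1, and the surplus 2 alpha1 absorbs
    the factor w. *)
Lemma level_lt (j : nat) (y w : R) : 1 <= y -> (2 ^+ j) `^ b <= w * y ->
  w < y `^ (2 * alpha1) -> 2 ^+ j < y.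
Proof.
move=> y1 h1 h2; rewrite ltNge; apply/negP => h.
have y0 : 0 < y by exact: lt_le_trans y1.
have := le_trans (ge0_ler_powR (ltW b0) _ _ h) h1.
rewrite !nnegrE !(ltW y0) !(ltW (p0 _)) => /(_ isT isT).
rewrite /b powRD; last by rewrite (gt_eqF y0) implybT.
rewrite powRr1 ?(ltW y0)// ler_pM2r// leNgt => /negP; apply.
apply: (lt_le_trans h2); rewrite ler_powR// ler_wpM2l//.
by have /andP[] := alpha_itv.
Qed.

(** The level at which the squared bias 2^(-2 m alpha) and the squared noise
    balance. *)
Lemma stop_level : 32 / alpha1 ^+ 2 < ell ->
  exists m : nat, [/\ (0 < m)%N, (m <= L)%N,
    n%:R / ell <= (2 ^+ m) `^ b, (2 ^+ m) `^ b <= 8 * (n%:R / ell) &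
    n%:R <= 2 ^+ (6 * m) :> R].
Proof.
move=> la; have n0 : 0 < n%:R :> R := @n_gt0 R n n2.
have l0 := ell0; have lg := ell_ge.
have nl : n%:R / ell = ell * z by field; rewrite gt_eqF.
have y1 : 1 < n%:R / ell by rewrite nl; have := z_ge1; nra.
have [m /andP[h1 h2]] := pow_between (ltW y1) b_itv; exists m; split => //.
- by rewrite lt0n; apply/eqP => m0; move: h1; rewrite m0 expr0 powR1 leNgt y1.
- rewrite -ltnS; have /andP[_ h] := level_maxP.
  have : (2 ^+ m : R) < 2 ^+ L.+1.
    apply: lt_trans h; apply: (@level_lt m z (8 * ell) z_ge1).
      by apply: (le_trans h2); rewrite nl mulrA.
    have e1 : expR (ell * alpha1) <= z `^ (2 * alpha1).
      have -> : ell * alpha1 = (ell / 2) * (2 * alpha1) by field.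
      rewrite expRM; apply: ge0_ler_powR; rewrite ?nnegrE ?expR_ge0 ?(le_trans ler01 z_ge1) ?z_ge//.
      by rewrite mulr_ge0// ltW.
    apply: lt_le_trans e1.
    have -> : ell * alpha1 = (ell * alpha1 / 2) * 2%:R by lra.
    rewrite expRM_natr.
    have e2 : ell * alpha1 / 2 <= expR (ell * alpha1 / 2).
      by have := expR_ge1Dx (ell * alpha1 / 2); lra.
    have e3 : 0 <= ell * alpha1 / 2 by rewrite divr_ge0 ?mulr_ge0// ltW.
    apply: (@lt_le_trans _ _ ((ell * alpha1 / 2) ^+ 2)); last by rewrite lerXn2r ?nnegrE ?expR_ge0.
    rewrite ltr_pdivrMr ?exprn_gt0// in la.
    by rewrite !exprMn exprVn; move: (alpha1 ^+ 2) la => t la; nra.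
  by rewrite ltr_eXn2l// ltr1n.
have h3 : n%:R / ell <= (2 ^+ m) ^+ 3.
  apply: (le_trans h1); rewrite -[leRHS](powR_mulrn _ (ltW (p0 m))); apply: ler_powR.
    by rewrite exprn_ege1// ler1n.
  by have /andP[_] := b_itv.
rewrite (_ : (6 * m = m * 3 * 2)%N); last by rewrite -mulnA mulnC.
rewrite 2!exprM; apply: le_trans (_ : (n%:R / ell) ^+ 2 <= _).
  have -> : (n%:R / ell) ^+ 2 = n%:R * z by field; rewrite gt_eqF.
  by rewrite ler_peMr ?(ltW n0)// z_ge1.
by rewrite lerXn2r ?nnegrE ?exprn_ge0// divr_ge0// ltW.
Qed.

(** A level coarser than the balance by a power of ln n, where the bias still
    exceeds the threshold for signals. *)
Lemma signal_level (c : R) (h j0 : nat) : 0 < c ->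
  2 * (8 ^+ j0.+1 / c + 2 ^+ h * (8 * c * 2 ^+ h + 1) `^ ((2 * alpha1)^-1) + 2 ^+ h) < ell ->
  exists J : nat, [/\ (j0 <= J)%N, (J + h <= L)%N,
    c * z <= (2 ^+ J) `^ b & (2 ^+ J) `^ b <= 8 * (c * z)].
Proof.
move=> c0 lh; have zl := z_ge_ell.
have q0 : 0 <= (8 * c * 2 ^+ h + 1) `^ ((2 * alpha1)^-1) by exact: powR_ge0.
have d0 : 0 <= 8 ^+ j0.+1 / c by rewrite divr_ge0 ?exprn_ge0// ltW.
have g0 : 0 <= 2 ^+ h * (8 * c * 2 ^+ h + 1) `^ ((2 * alpha1)^-1) by rewrite mulr_ge0// ltW.
have ph := p0 h.
have z1 : 8 ^+ j0.+1 / c < z by lra.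
have z2 : (8 * c * 2 ^+ h + 1) `^ ((2 * alpha1)^-1) < z / 2 ^+ h.
  by rewrite ltr_pdivlMr// mulrC; lra.
have z3 : 1 <= z / 2 ^+ h by rewrite ler_pdivlMr// mul1r; lra.
rewrite ltr_pdivrMr// mulrC in z1.
have y1 : 1 <= c * z.
  by apply: le_trans (ltW z1); rewrite exprn_ege1// ler1n.
have [J /andP[h1 h2]] := pow_between y1 b_itv; exists J; split => //.
- rewrite leqNgt; apply/negP => Jj; have := lt_le_trans z1 h1; rewrite ltNge => /negP; apply.
  apply: (@le_trans _ _ ((2 ^+ J) `^ 3%:R)).
    rewrite ler_powR//; first by rewrite exprn_ege1// ler1n.
    by have /andP[_] := b_itv.
  rewrite powR_mulrn ?(ltW (p0 _))// -exprM mulnC exprM.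
  rewrite (_ : 2 ^+ 3 = 8 :> R); last by rewrite -natrX.
  by rewrite ler_weXn2l ?ler1n// ltnW// ltnW.
rewrite -ltnS; have /andP[_ hL] := level_maxP.
have : (2 ^+ (J + h) : R) < 2 ^+ L.+1.
  apply: lt_trans hL; rewrite exprD -ltr_pdivlMr//.
  apply: (@level_lt J (z / 2 ^+ h) (8 * c * 2 ^+ h) z3).
    apply: (le_trans h2); apply: le_of_eq; field.
    by rewrite !gt_eqF// ?ell0.
  apply: (@lt_le_trans _ _ (8 * c * 2 ^+ h + 1)); first by rewrite ltrDl.
  have w0 : 0 <= 8 * c * 2 ^+ h + 1 by rewrite addr_ge0// mulr_ge0 ?mulr_ge0// ltW.
  have -> : 8 * c * 2 ^+ h + 1 = ((8 * c * 2 ^+ h + 1) `^ ((2 * alpha1)^-1)) `^ (2 * alpha1).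
    by rewrite -powRrM mulVf ?gt_eqF ?mulr_gt0// powRr1.
  rewrite ge0_ler_powR ?nnegrE ?(ltW z2) ?(le_trans _ z3)//.
  by rewrite mulr_ge0// ltW.
by rewrite ltr_eXn2l// ltr1n.
Qed.

(** At the balance the noise is the minimax rate, by definition of the level
    m. *)
Lemma stop_noise_le_rate m : (2 ^+ m) `^ b <= 8 * (n%:R / ell) ->
  noise m <= 3 * rate n alpha.
Proof.
move=> hm; have n0 : 0 < n%:R :> R := @n_gt0 R n n2; have l0 := ell0.
have r0 : 0 <= rate n alpha :> R by exact: powR_ge0.
have y0 : 0 < n%:R / ell by rewrite divr_gt0.
have y1 : 0 < ell / n%:R by rewrite divr_gt0.
rewrite -ler_sqr ?nnegrE ?mulr_ge0 ?(ltW (@noise_gt0 R n n2 _))//.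
rewrite (@noise_sq R n n2) -mulrA.
have h : 2 ^+ m <= 8 * (n%:R / ell) `^ b^-1.
  have bi : 0 <= b^-1 by rewrite invr_ge0 ltW.
  have := @ge0_ler_powR R b^-1 bi ((2 ^+ m) `^ b) (8 * (n%:R / ell)).
  rewrite !nnegrE powR_ge0 mulr_ge0 ?(ltW y0)// => /(_ isT isT hm).
  rewrite -powRrM mulfV ?gt_eqF// powRr1 ?(ltW (p0 _))// => /le_trans; apply.
  rewrite powRM ?(ltW y0)// ler_wpM2r ?powR_ge0//.
  rewrite -[leRHS]powRr1// ler_powR ?ler1n// invf_le1//.
  by have /andP[] := b_itv.
apply: le_trans (ler_wpM2r (ltW y1) h) _.
rewrite exprMn /rate.
have -> : ((ell / n%:R) `^ (alpha / (2 * alpha + 1))) ^+ 2 = (n%:R / ell) `^ b^-1 * (ell / n%:R).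
  rewrite -[n%:R / ell]invf_div -(powR_inv1 (ltW y1)) -powRrM.
  rewrite -[X in _ = _ * X]powRr1 ?(ltW y1)// -powRD; last by rewrite (gt_eqF y1) implybT.
  rewrite -powR_mulrn ?powR_ge0// -powRrM; congr (_ `^ _).
  by rewrite /b; field; rewrite gt_eqF.
rewrite [leRHS]mulrA ler_wpM2r ?(ltW y1)// ler_wpM2r ?powR_ge0//; lra.
Qed.

(** The scales 2^m and 2^J differ by at most a factor of order ln n, because b
    >= 1: the price is one factor sqrt (ln n), which the radius affords. *)
Lemma noise_ratio m J (c : R) : 0 < c -> c <= 8 * ell ->
  (2 ^+ m) `^ b <= 8 * (n%:R / ell) -> c * z <= (2 ^+ J) `^ b ->
  noise m <= Num.sqrt (8 / c) * Num.sqrt ell * noise J.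
Proof.
move=> c0 cl hm hJ; have n0 : 0 < n%:R :> R := @n_gt0 R n n2; have l0 := ell0.
have w0 : 0 <= 8 / c by rewrite divr_ge0// ltW.
rewrite -ler_sqr ?nnegrE ?mulr_ge0 ?sqrtr_ge0 ?(ltW (@noise_gt0 R n n2 _))//.
rewrite 2!exprMn !(@noise_sq R n n2) !sqr_sqrtr ?(ltW l0)//.
rewrite -![2 ^+ _ * ell / _]mulrA [leRHS]mulrA.
rewrite ler_pM2r ?divr_gt0// -ler_pdivrMr//.
have y0 : 0 <= 2 ^+ m / 2 ^+ J :> R by rewrite divr_ge0 ?(ltW (p0 _)).
case: (lerP (2 ^+ m / 2 ^+ J) (1 : R)) => h.
  by apply: (le_trans h); rewrite mulrAC ler_pdivlMr// mul1r.
apply: (@le_trans _ _ ((2 ^+ m / 2 ^+ J) `^ b)).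
  rewrite -[leLHS]powRr1//; apply: ler_powR; first exact: ltW.
  by have /andP[] := b_itv.
have e : (2 ^+ m) `^ b = (2 ^+ m / 2 ^+ J) `^ b * (2 ^+ J) `^ b :> R.
  by rewrite -powRM ?(ltW (p0 _))// divfK// gt_eqF.
rewrite e in hm.
have q0 : 0 < c * z by rewrite mulr_gt0// (lt_le_trans ltr01 z_ge1).
have h4 := le_trans (ler_wpM2l (powR_ge0 _ b) hJ) hm.
rewrite -ler_pdivlMr// in h4; apply: (le_trans h4); apply: le_of_eq; field.
by rewrite !gt_eqF.
Qed.

Lemma scale_le_noise (J : nat) (K c : R) : 0 < K -> 0 < c -> c * z <= (2 ^+ J) `^ b ->
  K * scale alpha J <= K / Num.sqrt c * Num.sqrt ell * noise J.
Proof.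
move=> K0 c0 hJ; have n0 : 0 < n%:R :> R := @n_gt0 R n n2; have l0 := ell0.
have s0 : 0 < Num.sqrt c by rewrite sqrtr_gt0.
rewrite -!mulrA ler_wpM2l ?(ltW K0)//.
have e0 := ltW (@noise_gt0 R n n2 J).
rewrite -ler_sqr ?nnegrE ?powR_ge0 ?mulr_ge0 ?sqrtr_ge0 ?invr_ge0//.
rewrite 2!exprMn (@noise_sq R n n2) exprVn !sqr_sqrtr ?(ltW l0) ?(ltW c0)//.
have q0 : 0 < c * z by rewrite mulr_gt0// (lt_le_trans ltr01 z_ge1).
have a0 : 0 < alpha by have /andP[h _] := alpha_itv; apply: lt_le_trans h.
apply: (le_trans (scale_sq q0 hJ)); apply: le_of_eq; field.
by rewrite !gt_eqF.
Qed.

Lemma noise_le_scale (J : nat) (c : R) : 0 < c -> (2 ^+ J) `^ b <= 8 * (c * z) ->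
  Num.sqrt ell * noise J <= Num.sqrt (8 * c) * scale alpha J.
Proof.
move=> c0 hJ; have n0 : 0 < n%:R :> R := @n_gt0 R n n2; have l0 := ell0.
have e0 := ltW (@noise_gt0 R n n2 J).
rewrite -ler_sqr ?nnegrE ?powR_ge0 ?mulr_ge0 ?sqrtr_ge0 ?invr_ge0 ?powR_ge0//.
rewrite 2!exprMn (@noise_sq R n n2) !sqr_sqrtr ?(ltW l0) ?mulr_ge0 ?(ltW c0)//.
have sE : scale alpha J ^+ 2 = ((2 ^+ J) `^ (2 * alpha))^-1.
  rewrite -powRN /scale -powR_inv1 ?(ltW (p0 _))// -powRrM -powR_mulrn ?powR_ge0// -powRrM.
  by congr (_ `^ _); ring.
have q : 0 < (2 ^+ J) `^ (2 * alpha) :> R by rewrite powR_gt0.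
rewrite sE ler_pdivlMr//.
move: hJ; rewrite /b powRD; last by rewrite (gt_eqF (p0 _)) implybT.
rewrite powRr1 ?(ltW (p0 _))// => hJ.
have z0 : 0 < ell ^+ 2 / n%:R by rewrite divr_gt0 ?exprn_gt0.
have := ler_wpM2r (ltW z0) hJ.
have -> : 8 * (c * z) * (ell ^+ 2 / n%:R) = 8 * c by field; rewrite !gt_eqF.
by apply: le_trans; apply: le_of_eq; field; rewrite gt_eqF.
Qed.

Lemma noise_shift J h : noise (J + h) <= 2 ^+ h * noise J.
Proof.
elim: h => [|h IH]; first by rewrite addn0 mul1r.
rewrite addnS; apply: le_trans (@noiseS R n n2 _) _.
by rewrite exprS; have := @noise_gt0 R n n2 (J + h); have := p0 h; nra.
Qed.

(** Self-similarity dominates both the threshold and the regularity of f a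
    fixed number h of levels further. *)
Lemma signal_strength (J h : nat) (K eta tau c : R) : 0 < K -> 0 < eta -> 0 < tau ->
  K * scale alpha1 h <= eta / 4 -> Num.sqrt (8 * c) = eta / (3 * tau * 2 ^+ h) ->
  0 < c -> (2 ^+ J) `^ b <= 8 * (c * z) ->
  3 / 2 * (tau * Num.sqrt ell) * noise (J + h) + K * scale alpha (J + h) <
    eta * scale alpha J.
Proof.
move=> K0 eta0 tau0 hh hc c0 hJ.
have s0 : 0 < scale alpha J by rewrite powR_gt0// invr_gt0.
have a0 : 0 < alpha by have /andP[h' _] := alpha_itv; apply: lt_le_trans h'.
have e1 : K * scale alpha (J + h) <= eta / 4 * scale alpha J.
  have -> : scale alpha (J + h) = scale alpha h * scale alpha J.
    by rewrite /scale addnC exprD invfM powRM ?invr_ge0 ?(ltW (p0 _)).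
  rewrite mulrA ler_wpM2r ?(ltW s0)//; apply: le_trans hh; rewrite ler_wpM2l ?(ltW K0)//.
  apply: ger_powR; last by have /andP[] := alpha_itv.
  by rewrite invr_gt0 p0 invf_le1 ?p0// exprn_ege1// ler1n.
have e2 := noise_le_scale c0 hJ; rewrite hc in e2.
have e3 : 3 / 2 * (tau * Num.sqrt ell) * noise (J + h) <= eta / 2 * scale alpha J.
  apply: (@le_trans _ _ (3 / 2 * tau * 2 ^+ h * (Num.sqrt ell * noise J))).
    rewrite (_ : 3 / 2 * tau * 2 ^+ h * (Num.sqrt ell * noise J) =
      3 / 2 * (tau * Num.sqrt ell) * (2 ^+ h * noise J)); last by ring.
    rewrite ler_wpM2l ?noise_shift// !mulr_ge0 ?sqrtr_ge0// ?(ltW tau0)//.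
  have t0 : 0 <= 3 / 2 * tau * 2 ^+ h by rewrite !mulr_ge0// ltW.
  apply: (le_trans (ler_wpM2l t0 e2)); apply: le_of_eq; field.
  by rewrite !gt_eqF.
nra.
Qed.

End large_samples.

(** * Uniform conclusion *)

Section sample_cells.
Context {R : realType} {d} {Om : measurableType d} (Q : probability Om R).
Variables (S : node -> {RV Q >-> bool}) (Y : seq bool -> {RV Q >-> R}).
Variables (n : nat) (X X' : n.-tuple R).
Local Notation L := (@level_max R n).
Hypothesis XX' : forall (i : 'I_n) v, v \in nodes L.+1 ->
  (tnth X i \in dyadic v) = (tnth X' i \in dyadic v).

(** Draws are constant on cells, so that the likelihood reads the sample only
    through the cells of its points. *)
Lemma opt_posterior_cells : opt_posterior S Y X = opt_posterior S Y X'.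
Proof.
apply/funext => B; rewrite /opt_posterior /posterior.
set Z := opt_draw _ _ _.
suff -> : (fun w => likelihood (Z w).1 X) = (fun w => likelihood (Z w).1 X') by [].
apply/funext => w; apply: eq_bigr => i _; apply: eq_big_seq => v.
rewrite in_fset /= inE => /andP[+ _]; rewrite mem_grow_tree => /and3P[vL v2 _].
by rewrite XX'// mem_nodes v2 andbT ltnW.
Qed.

Lemma opt_confidence_set_cells (v : nat -> R) :
  opt_confidence_set S Y v X = opt_confidence_set S Y v X'.
Proof.
rewrite /opt_confidence_set opt_posterior_cells /confidence_set.
suff -> : median_estimator X (opt_posterior S Y X') = median_estimator X' (opt_posterior S Y X').
  by [].
apply/funext => x; congr (1 + _); apply: eq_big_seq => u.
rewrite /median_int in_fset /= inE => /andP[+ _]; rewrite mem_nodes => /andP[uL u2].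
have E b : nobs X (child u b) = nobs X' (child u b).
  by rewrite /nobs; congr _%:R; apply: (ncount_cells _ XX'); rewrite mem_nodes child_lt// andbT.
by have := E false; have := E true; rewrite /child /= => -> ->.
Qed.

End sample_cells.

Section numerical_conditions.
Context {R : realType}.
Variables (n : nat) (a : R).
Hypothesis n2 : (1 < n)%N.
Hypothesis a0 : 0 < a.
Local Notation ell := (ln n%:R : R).
Hypothesis ell_ge1 : 1 <= ell.
Local Notation Ca := (2 + 2 * a).
Local Notation beta := (@beta_margin R a n).

Hypothesis B0 : 0 < beta_cst a.
Hypothesis B_le : 8 `^ (1 + 2 * a) * beta_cst a <= ell.

Let nE' : n%:R = expR ell. Proof. exact: nat_expR_ln. Qed.

Lemma beta_margin_gt0 : 0 < beta.
Proof. by rewrite divr_gt0// powR_gt0// mulr_gt0// ltr0n ltnW. Qed.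

Lemma beta_inv_le : beta^-1 <= expR (Ca * ell).
Proof.
have n0 : 0 < n%:R :> R := @n_gt0 R n n2.
rewrite /beta_margin invfM invrK powRN invrK powRM ?(ltW n0)//.
have -> : n%:R `^ (1 + 2 * a) = expR (ell * (1 + 2 * a)) by rewrite expRM -nE'.
rewrite mulrAC; apply: (@le_trans _ _ (expR ell * expR (ell * (1 + 2 * a)))).
  rewrite ler_wpM2r ?expR_ge0//; apply: (le_trans B_le).
  by have := expR_ge1Dx ell; lra.
by rewrite -expRD; apply: le_of_eq; congr expR; ring.
Qed.

Lemma expR_n2 : expR (- (2 * ell)) = n%:R ^- 2.
Proof.
rewrite expRN; congr (_^-1).
by rewrite mulrC expRM_natr -nE'.
Qed.

Lemma far_bound (mu C4 : R) : Ca + 2 <= mu * C4 ^+ 2 / 4 ->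
  beta^-1 * expR (- (ell * (mu * C4 ^+ 2 / 4))) <= n%:R ^- 2.
Proof.
move=> h; apply: le_trans (ler_wpM2r (expR_ge0 _) beta_inv_le) _.
rewrite -expRD -expR_n2 ler_expR; have := ell_ge1.
by move: (mu * C4 ^+ 2 / 4) h ell => t h l; nra.
Qed.

(** A branch has at most 3 ln n nodes, each costing a factor exponential in ln
    n, whence 3 D (ln n)^2 in the exponent, to be beaten by the signal. *)
Lemma theta_bound (L : nat) (Gamma K tau : R) : 1 <= Gamma -> 0 < K ->
  L.+1%:R <= 3 * ell ->
  3 * (4 + 3 * ln Gamma + Ca) + 5 <= tau ^+ 2 / (256 * (1 + K)) ->
  L.+1%:R * ((4 * Gamma ^+ L / beta) ^+ L.+1 *
    expR (- (tau ^+ 2 * ell ^+ 2 / (256 * (1 + K))))) <= n%:R ^- 2.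
Proof.
move=> G1 K0 Ll hT; have b0 := beta_margin_gt0; have l1 := ell_ge1.
have G0 : 0 < Gamma by exact: lt_le_trans G1.
have lG : 0 <= ln Gamma by exact: ln_ge0.
set D := 4 + 3 * ln Gamma + Ca in hT *.
have D0 : 0 <= D by rewrite /D; have := a0; lra.
have GL : Gamma ^+ L <= expR (3 * ln Gamma * ell).
  have -> : Gamma ^+ L = expR (ln Gamma * L%:R) by rewrite expRM_natr lnK.
  rewrite ler_expR.
  have Ll' : L%:R <= 3 * ell by apply: le_trans Ll; rewrite ler_nat.
  rewrite (_ : 3 * ln Gamma * ell = ln Gamma * (3 * ell)); last by ring.
  exact: ler_wpM2l.
have base : 4 * Gamma ^+ L / beta <= expR (D * ell).
  have -> : D * ell = 4 * ell + 3 * ln Gamma * ell + Ca * ell by rewrite /D; ring.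
  rewrite !expRD; apply: ler_pM; rewrite ?beta_inv_le ?invr_ge0 ?(ltW b0)//.
    by rewrite mulr_ge0// exprn_ge0// ltW.
  apply: ler_pM => //; first by rewrite exprn_ge0// ltW.
  by have := expR_ge1Dx (4 * ell); lra.
have base0 : 0 <= 4 * Gamma ^+ L / beta.
  by rewrite divr_ge0 ?(ltW b0)// mulr_ge0// exprn_ge0// ltW.
have pw : (4 * Gamma ^+ L / beta) ^+ L.+1 <= expR (D * ell * (3 * ell)).
  apply: (@le_trans _ _ (expR (D * ell) ^+ L.+1)).
    by rewrite lerXn2r ?nnegrE ?expR_ge0.
  by rewrite -expRM_natr ler_expR ler_wpM2l// mulr_ge0//; lra.
have lin : L.+1%:R <= expR (3 * ell).
  by apply: (le_trans Ll); have := expR_ge1Dx (3 * ell); lra.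
apply: le_trans (ler_pM _ _ lin (ler_wpM2r (expR_ge0 _) pw)) _ => //.
  by rewrite mulr_ge0 ?expR_ge0 ?exprn_ge0.
rewrite -!expRD -expR_n2 ler_expR.
rewrite (_ : tau ^+ 2 * ell ^+ 2 / (256 * (1 + K)) = tau ^+ 2 / (256 * (1 + K)) * ell ^+ 2); last first.
  by rewrite mulrAC.
move: (tau ^+ 2 / (256 * (1 + K))) hT => T hT.
have h2 := ler_wpM2r (sqr_ge0 ell) hT.
move: h2 l1; move: (ell : R) => l h2 l1; nra.
Qed.

End numerical_conditions.

Section fixed_sample_size.
Context {R : realType} {d} {Om : measurableType d} (Q : probability Om R).
Variables (Gamma a : R).
Variables (S : node -> {RV Q >-> bool}) (Y : seq bool -> {RV Q >-> R}).
Local Notation p := (fun u : node => Gamma ^- u.1).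
Hypothesis SY : opt_variables p a S Y.
Hypothesis a0 : 0 < a.
Variables (alpha1 alpha2 K mu eta : R) (j0 : nat).
Hypothesis alpha10 : 0 < alpha1.
Hypothesis alpha2_le : alpha2 <= 1.
Hypothesis K0 : 0 < K.
Hypothesis mu0 : 0 < mu.
Hypothesis eta0 : 0 < eta.
Variables (C1 h : nat) (tau C4 c : R).
Hypothesis C1_ge : (3 * K + 3 * dev_cst K) ^+ 2 / (2 * mu) <= C1%:R.
Hypothesis Gamma_ge : 2 ^+ (6 * (C1 + 2)) <= Gamma.
Hypothesis tau0 : 0 < tau.
Hypothesis tau_big : 3 * (4 + 3 * ln Gamma + (2 + 2 * a)) + 5 <= tau ^+ 2 / (256 * (1 + K)).
Hypothesis C40 : 0 <= C4.
Hypothesis C4_big : 2 + 2 * a + 2 <= mu * C4 ^+ 2 / 4.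
Hypothesis h_big : K * scale alpha1 h <= eta / 4.
Hypothesis c0 : 0 < c.
Hypothesis cE : Num.sqrt (8 * c) = eta / (3 * tau * 2 ^+ h).

(** The multiple of sqrt (ln n) that v n must exceed: the deviation of draws,
    the two biases of estimator and draw, and the deviation of the estimator. *)
Definition radius_cst : R :=
  6 * ratio_cst K mu C4 * (1 + K) * Num.sqrt (8 / c) +
  (3 * tau + 2 * (K / Num.sqrt c)) + dev_cst K.

Variables (v : nat -> R) (n : nat).
Local Notation ell := (ln n%:R : R).
Hypothesis n2 : (1 < n)%N.
Hypothesis ell_ge : 216 <= ell.
Hypothesis ell_dev : (mu / 2 / dev_cst K) ^- 2 <= ell.
Hypothesis ell_ratio : ((6 * ratio_cst K mu C4 + 1)^-1) ^- 2 <= ell.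
Hypothesis ell_tau : (6 * dev_cst K / tau) ^+ 2 <= ell.
Hypothesis ell_beta : 8 `^ (1 + 2 * a) * beta_cst a <= ell.
Hypothesis ell_stop : 32 / alpha1 ^+ 2 < ell.
Hypothesis ell_signal :
  2 * (8 ^+ j0.+1 / c + 2 ^+ h * (8 * c * 2 ^+ h + 1) `^ ((2 * alpha1)^-1) + 2 ^+ h) < ell.
Hypothesis ell_c : c <= ell.
Hypothesis v_big : radius_cst <= v n / Num.sqrt ell.

Variables (alpha : R) (f0 : R -> R) (P0 : probability (n.-tuple (measurableTypeR R)) R).
Hypothesis f0P : true_law j0 alpha1 alpha2 K mu eta alpha f0 P0.

(** On good samples everything holds with certainty, so one event serves the
    three conclusions. *)
Lemma good_event : exists G : set (n.-tuple (measurableTypeR R)),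
  [/\ measurable G, (P0 (~` G) <= (4 / n%:R)%:E)%E &
  forall X, G X ->
    [/\ (sup_diameter (opt_confidence_set S Y v X) <= (6 * (v n * rate n alpha))%:E)%E,
        opt_confidence_set S Y v X f0 &
        `| opt_posterior S Y X [set fT | opt_confidence_set S Y v X fT.1] - 1| <= 8 / n%:R]].
Proof.
have [/andP[al1 al2] fS fD fP] := f0P.
have alpha0 : 0 < alpha := lt_le_trans alpha10 al1.
have al_itv : alpha1 <= alpha <= 1 by rewrite al1 (le_trans al2 alpha2_le).
have n0 : 0 < n%:R :> R := @n_gt0 R n n2.
have l1 : 1 <= ell by have := ell_ge; lra.
have l0 : 0 < ell by lra.
have D0 : 0 < dev_cst K by rewrite addr_gt0// mulr_gt0.
have r0 : 0 <= ratio_cst K mu C4 by exact: ratio_cst_ge0.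
have B0 := beta_cst_gt0 SY.
have [L nL] : exists L, @level_max R n = L by exists (@level_max R n).
have [m [m0 mL m1 m8 m6]] := stop_level n2 ell_ge nL alpha10 al_itv ell_stop.
have [J [jJ JhL J1 J8]] := signal_level n2 ell_ge nL alpha10 al_itv c0 ell_signal.
have small_dev l : (l <= L)%N -> dev_cst K * noise n l <= mu / 2.
  move=> lL; rewrite mulrC -ler_pdivlMr//.
  by apply: (noise_small n2 ell_ge nL _ lL ell_dev); rewrite !divr_gt0.
have small_noise l : (l <= L)%N -> noise n l <= 1 / 2 :> R.
  move=> lL; apply: (noise_small n2 ell_ge nL _ lL); first by rewrite divr_gt0.
  by rewrite div1r exprVn invrK; have := ell_ge; lra.
have small_ratio : 6 * ratio_cst K mu C4 * noise n L <= 1.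
  have r1 : 0 < 6 * ratio_cst K mu C4 + 1 by rewrite ltr_wpDl// mulr_ge0.
  have r2 : 0 < (6 * ratio_cst K mu C4 + 1)^-1 by rewrite invr_gt0.
  have h1 := noise_small n2 ell_ge nL r2 (leqnn L) ell_ratio.
  have e0 := @noise_gt0 R n n2 L.
  rewrite -(ler_pM2l r1) mulfV ?gt_eqF// mulrDl mul1r in h1; lra.
have sl1 : 1 <= Num.sqrt ell by have := ler_wsqrtr l1; rewrite sqrtr1.
have sl0 : 0 < Num.sqrt ell by lra.
have tau_ge : 6 * dev_cst K <= tau * Num.sqrt ell.
  rewrite [leRHS]mulrC -ler_pdivrMr//.
  rewrite -ler_sqr ?nnegrE ?(ltW sl0) ?divr_ge0 ?mulr_ge0 ?(ltW D0) ?(ltW tau0)//.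
  by rewrite sqr_sqrtr ?(ltW l0).
have Gamma2 : 2 <= Gamma.
  apply: le_trans Gamma_ge; rewrite -[leLHS]expr1; apply: ler_weXn2l; rewrite ?ler1n//.
  by rewrite muln_gt0 addn2.
have Gamma1 : 1 <= Gamma by lra.
have theta_le := theta_bound n2 a0 l1 B0 ell_beta Gamma1 K0 (level_max_le n2 ell_ge nL) tau_big.
have far_le := far_bound n2 l1 ell_beta C4_big.
exists [set X | good_sample K f0 L X]; split.
- exact: measurable_good.
- apply: (le_trans (prob_not_good alpha0 K0 mu0 fD n2 fP small_noise)).
  rewrite lee_fin expR_n2// mulrCA; have := pow2_le n2 ell_ge nL.
  by move: (2 ^+ L.+1 * _) => t; lra.
move=> X /= XG.
have W0 u (uL : u \in nodes L) := Wtot_gt0 SY a0 alpha0 K0 mu0 fD n2 XG small_dev uL.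
have atyp := posterior_atypical SY a0 alpha0 K0 mu0 fD n2 XG small_dev C1_ge Gamma2 Gamma_ge
  m0 m1 m6 tau0 tau_ge C40 theta_le far_le.
set bad := 2 ^+ L.+1 * _ in atyp.
have bad_le : bad <= 8 / n%:R.
  by rewrite /bad mulrCA; have := pow2_le n2 ell_ge nL; move: (2 ^+ L.+1 * _) => t; lra.
have bad_lt : bad < 1 / 2.
  apply: (le_lt_trans bad_le); rewrite ltr_pdivrMr//.
  by rewrite (nat_expR_ln n2); have := expR_ge1Dx ell; have := ell_ge; lra.
have [x [l [xu /andP[Jl lJ] sg]]] := signal_exists alpha0 K0 mu0 fD n2 tau0 fS jJ
  (signal_strength n2 ell_ge alpha10 al_itv K0 eta0 tau0 h_big cE c0 J8).
have signal_J : exists (x : R) l, [/\ unit_itv x, (J <= l < L)%N & signal f0 n tau (node_at x l)].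
  by exists x, l; split => //; rewrite Jl (leq_trans lJ).
have scale_J := scale_le_noise n2 ell_ge alpha10 al_itv K0 c0 J1.
have c8 : c <= 8 * ell by have := ell_c; lra.
have noise_m := noise_ratio n2 ell_ge alpha10 al_itv c0 c8 m8 J1.
have Cb0 : 0 <= K / Num.sqrt c by rewrite divr_ge0 ?sqrtr_ge0// ltW.
have Cm0 : 0 <= Num.sqrt (8 / c) by exact: sqrtr_ge0.
have v_big' : (6 * ratio_cst K mu C4 * (1 + K) * Num.sqrt (8 / c) + (3 * tau + 2 * (K / Num.sqrt c))) *
    Num.sqrt ell + dev_cst K <= v n.
  have := v_big; rewrite ler_pdivlMr// => hv; apply: le_trans hv.
  by rewrite /radius_cst [leRHS]mulrDl lerD2l ler_peMr// ltW.
have v0 : 0 <= v n.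
  apply: le_trans v_big'; rewrite addr_ge0 ?(ltW D0)// mulr_ge0 ?(ltW sl0)//.
  apply: addr_ge0; last by rewrite addr_ge0// mulr_ge0// ltW.
  apply: mulr_ge0 => //; apply: mulr_ge0; last by rewrite addr_ge0// ltW.
  exact: mulr_ge0.
have postE : opt_posterior S Y X = posterior Q (draw S Y L) X by rewrite /opt_posterior nL.
rewrite /opt_confidence_set postE; split.
- have dl := diameter_le n2 nL bad_lt atyp v0.
  apply: (le_trans dl).
  rewrite lee_fin; have := ler_wpM2l v0 (stop_noise_le_rate n2 ell_ge alpha10 al_itv m8).
  by lra.
- exact: (truth_in_band SY alpha0 K0 mu0 fD n2 XG nL W0 tau0 C40 mL bad_lt atyp
    signal_J scale_J v_big' Cb0 Cm0).
have /andP[b1 b2] := posterior_band SY alpha0 K0 mu0 fD n2 XG small_dev nL W0 tau0 C40 mL bad_lt atyp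
    signal_J scale_J noise_m small_ratio v_big' Cb0 Cm0.
rewrite ler_norml; apply/andP; split; last by have := divr_ge0 (ler0n R 8) (ltW n0); lra.
lra.
Qed.

End fixed_sample_size.

Section uniformity.
Context {R : realType}.
Variables (j0 : nat) (alpha1 alpha2 K mu eta a : R).
Hypothesis alpha10 : 0 < alpha1.
Hypothesis alpha2_le : alpha2 <= 1.
Hypothesis K0 : 0 < K.
Hypothesis mu0 : 0 < mu.
Hypothesis eta0 : 0 < eta.
Hypothesis a0 : 0 < a.

Lemma ln_nat_cvg (A : R) : \forall n \near \oo, A <= ln n%:R.
Proof.
near=> n; have h : expR A <= n%:R by near: n; exact: nbhs_infty_ger.
by rewrite -ler_expR lnK// posrE; apply: lt_le_trans h; exact: expR_gt0.
Unshelve. all: by end_near. Qed.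

(** The order of the quantifiers dictates the order of the constants: C1,
    hence Gamma0, depends on the class of densities only, whereas the
    threshold tau for signals may depend on Gamma. *)
Lemma good_events : exists Gamma0 : R, forall Gamma : R, Gamma0 <= Gamma ->
  forall (d : measure_display) (Om : measurableType d) (Q : probability Om R)
    (S : node -> {RV Q >-> bool}) (Y : seq bool -> {RV Q >-> R}),
  opt_variables (fun u : node => Gamma ^- u.1) a S Y ->
  forall v : nat -> R, v n / Num.sqrt (ln n%:R) @[n --> \oo] --> +oo ->
  \forall n \near \oo, forall (alpha : R) (f0 : R -> R)
    (P0 : probability (n.-tuple (measurableTypeR R)) R),
  true_law j0 alpha1 alpha2 K mu eta alpha f0 P0 ->
  exists G : set (n.-tuple (measurableTypeR R)),
  [/\ measurable G, (P0 (~` G) <= (4 / n%:R)%:E)%E &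
  forall X, G X ->
    [/\ (sup_diameter (opt_confidence_set S Y v X) <= (6 * (v n * rate n alpha))%:E)%E,
        opt_confidence_set S Y v X f0 &
        `| opt_posterior S Y X [set fT | opt_confidence_set S Y v X fT.1] - 1| <= 8 / n%:R]].
Proof.
have D0 : 0 < dev_cst K by rewrite addr_gt0// mulr_gt0.
have K1 : 0 < 1 + K by rewrite addr_gt0.
pose C1 := (Num.truncn ((3 * K + 3 * dev_cst K) ^+ 2 / (2 * mu))).+1.
have C1_ge : (3 * K + 3 * dev_cst K) ^+ 2 / (2 * mu) <= C1%:R.
  have /truncn_itv/andP[_ /ltW//] : 0 <= (3 * K + 3 * dev_cst K) ^+ 2 / (2 * mu).
  by rewrite divr_ge0 ?sqr_ge0// mulr_ge0// ltW.
exists (2 ^+ (6 * (C1 + 2))) => Gamma Gamma_ge d Om Q S Y SY v v_cvg.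
have Gamma1 : 1 <= Gamma by apply: le_trans Gamma_ge; rewrite exprn_ege1// ler1n.
have lG : 0 <= ln Gamma by exact: ln_ge0.
(* T beats the prior cost of a whole branch, see theta_bound *)
pose T := 3 * (4 + 3 * ln Gamma + (2 + 2 * a)) + 5.
have T1 : 1 <= T by rewrite /T; have := a0; lra.
pose tau := 256 * (1 + K) * T.
have tau0 : 0 < tau by rewrite /tau !mulr_gt0//; lra.
have tau_big : T <= tau ^+ 2 / (256 * (1 + K)).
  have -> : tau ^+ 2 / (256 * (1 + K)) = 256 * (1 + K) * T ^+ 2.
    by rewrite /tau; field; rewrite gt_eqF.
  by have := K0; nra.
(* the summand 1 makes the square of C4 at least C4 *)
pose C4 := 4 * (2 + 2 * a + 2) / mu + 1.
have C40' : 0 <= 4 * (2 + 2 * a + 2) / mu.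
  by rewrite divr_ge0 ?(ltW mu0)//; have := a0; lra.
have C40 : 0 <= C4 by rewrite /C4; lra.
have C4_big : 2 + 2 * a + 2 <= mu * C4 ^+ 2 / 4.
  have h1 : mu * (4 * (2 + 2 * a + 2) / mu) = 4 * (2 + 2 * a + 2) by field; rewrite gt_eqF.
  have h2 : 4 * (2 + 2 * a + 2) / mu <= C4 ^+ 2.
    by rewrite /C4; move: (4 * _ / mu) C40' => t t0; nra.
  have := ler_wpM2l (ltW mu0) h2; rewrite h1; lra.
(* h levels below J the regularity of f leaves at most a quarter of eta *)
have [h h_big] : exists h, K * scale alpha1 h <= eta / 4.
  have e4 : 0 < eta / 4 / K by rewrite !divr_gt0.
  have [N _ /(_ N (leqnn N)) hN] := cvgr_lt 0 (scale_cvg0 alpha10) _ e4.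
  by exists N; rewrite mulrC -ler_pdivlMr// ltW.
(* c keeps 3/2 tau sqrt (ln n) noise (J + h) at most eta / 2 times 2^(-J alpha) *)
pose c := (eta / (3 * tau * 2 ^+ h)) ^+ 2 / 8.
have A0 : 0 < eta / (3 * tau * 2 ^+ h).
  by apply: divr_gt0 => //; apply: mulr_gt0; [exact: mulr_gt0|exact: exprn_gt0].
have c0 : 0 < c by rewrite divr_gt0// exprn_gt0.
have cE : Num.sqrt (8 * c) = eta / (3 * tau * 2 ^+ h).
  by rewrite /c mulrC divfK// sqrtr_sqr gtr0_norm.
near=> n => alpha f0 P0 f0P.
apply: (@good_event R d Om Q Gamma a S Y SY a0 alpha1 alpha2 K mu eta j0 alpha10 alpha2_le
  K0 mu0 eta0 C1 h tau C4 c C1_ge Gamma_ge tau0 tau_big C40 C4_big h_big c0 cE v n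
  _ _ _ _ _ _ _ _ _ _ alpha f0 P0 f0P).
- by near: n; exact: nbhs_infty_gt.
- by near: n; exact: ln_nat_cvg.
- by near: n; exact: ln_nat_cvg.
- by near: n; exact: ln_nat_cvg.
- by near: n; exact: ln_nat_cvg.
- by near: n; exact: ln_nat_cvg.
- have h1 : 32 / alpha1 ^+ 2 + 1 <= ln n%:R by near: n; exact: ln_nat_cvg.
  by apply: lt_le_trans h1; rewrite ltrDl.
- set b := 2 * _; have h1 : b + 1 <= ln n%:R by near: n; exact: ln_nat_cvg.
  by apply: lt_le_trans h1; rewrite ltrDl.
- by near: n; exact: ln_nat_cvg.
- by near: n; move/cvgryPge : v_cvg; exact.
Unshelve. all: by end_near. Qed.

End uniformity.

Theorem theorem4p2 (R : realType) (j0 : nat) (alpha1 alpha2 K mu eta a : R)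
    (j0_gt0 : (0 < j0)%N) (alpha1_gt0 : 0 < alpha1)
    (alpha1_lt_alpha2 : alpha1 < alpha2) (alpha2_le1 : alpha2 <= 1)
    (K_gt0 : 0 < K) (mu_gt0 : 0 < mu) (eta_gt0 : 0 < eta) (a_gt0 : 0 < a) :
  exists Gamma0 : R, forall Gamma : R, Gamma0 <= Gamma ->
  forall (d : measure_display) (Om : measurableType d) (Q : probability Om R)
    (S : node -> {RV Q >-> bool}) (Y : seq bool -> {RV Q >-> R}),
  opt_variables (fun u : node => Gamma ^- u.1) a S Y ->
  forall v : nat -> R,
  v n / Num.sqrt (ln n%:R) @[n --> \oo] --> +oo ->
  [/\
      forall eps : R, 0 < eps -> exists M : R, \forall n \near \oo,
        forall (alpha : R) (f0 : R -> R)
          (P0 : probability (n.-tuple (measurableTypeR R)) R),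
        true_law j0 alpha1 alpha2 K mu eta alpha f0 P0 ->
        (P0 [set X | (M * (v n * rate n alpha))%:E <
                     sup_diameter (opt_confidence_set S Y v X)] <= eps%:E)%E,
      forall eps : R, 0 < eps -> \forall n \near \oo,
        forall (alpha : R) (f0 : R -> R)
          (P0 : probability (n.-tuple (measurableTypeR R)) R),
        true_law j0 alpha1 alpha2 K mu eta alpha f0 P0 ->
        ((1 - eps)%:E <= P0 [set X | opt_confidence_set S Y v X f0])%E &
      forall eps delta : R, 0 < eps -> 0 < delta -> \forall n \near \oo,
        forall (alpha : R) (f0 : R -> R)
          (P0 : probability (n.-tuple (measurableTypeR R)) R),
        true_law j0 alpha1 alpha2 K mu eta alpha f0 P0 ->
        (P0 [set X | (eps < `| opt_posterior S Y X
                                 [set fT | opt_confidence_set S Y v X fT.1]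
                               - 1|)%R] <= delta%:E)%E].
Proof.
have [Gamma0 HG] := good_events j0 alpha1_gt0 alpha2_le1 K_gt0 mu_gt0 eta_gt0 a_gt0.
exists Gamma0 => Gamma GG d Om Q S Y SY v v_cvg.
have {HG SY v_cvg} H := HG Gamma GG d Om Q S Y SY v v_cvg.
have small (c e : R) : 0 < c -> 0 < e -> \forall n \near \oo, c / n%:R <= e.
  move=> c0 e0; near=> n.
  have h : c / e + 1 <= n%:R by near: n; exact: nbhs_infty_ger.
  have n0 : 0 < n%:R :> R by apply: lt_le_trans h; rewrite ltr_wpDl ?divr_ge0 ?ltW.
  by rewrite ler_pdivrMr// mulrC -ler_pdivrMr//; apply: le_trans h; rewrite lerDl.
have cells n (E : set (n.-tuple (measurableTypeR R))) :
    (forall X X' : n.-tuple (measurableTypeR R),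
       opt_posterior S Y X = opt_posterior S Y X' ->
       opt_confidence_set S Y v X = opt_confidence_set S Y v X' -> E X -> E X') ->
    measurable E.
  move=> HE; apply: (@measurable_cells R n (@level_max R n).+1) => X X' XX'.
  by apply: HE; [exact: opt_posterior_cells|exact: opt_confidence_set_cells].
split.
- move=> eps eps0; exists 6; apply: filterS2 H (small 4 eps (ltr0Sn R 3) eps0) => n Hn e4 alpha f0 P0 f0P.
  have [G [mG PG HX]] := Hn alpha f0 P0 f0P.
  apply: (@le_trans _ _ (P0 (~` G))); last by apply: (le_trans PG); rewrite lee_fin.
  apply: le_measure; rewrite ?inE; last 2 first.
  + exact: measurableC.
  + by move=> X /= lt GX; have [h _ _] := HX X GX; move: lt; rewrite ltNge h.
  by apply: cells => X X' _ /= ->.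
- move=> eps eps0; apply: filterS2 H (small 4 eps (ltr0Sn R 3) eps0) => n Hn e4 alpha f0 P0 f0P.
  have [G [mG PG HX]] := Hn alpha f0 P0 f0P.
  apply: (@le_trans _ _ (P0 G)); last first.
    apply: le_measure; rewrite ?inE//; last by move=> X /HX[].
    by apply: cells => X X' _ /= ->.
  have PG' : (P0 (~` G) <= eps%:E)%E by apply: (le_trans PG); rewrite lee_fin.
  rewrite probability_setC// in PG'.
  move: PG'; have : P0 G \is a fin_num by exact: fin_num_measure.
  case: (P0 G) => // r _; rewrite -EFinB !lee_fin; lra.
- move=> eps delta eps0 delta0.
  apply: filterS3 H (small 4 delta (ltr0Sn R 3) delta0) (small 8 eps (ltr0Sn R 7) eps0) => n Hn e4 e8 alpha f0 P0 f0P.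
  have [G [mG PG HX]] := Hn alpha f0 P0 f0P.
  apply: (@le_trans _ _ (P0 (~` G))); last by apply: (le_trans PG); rewrite lee_fin.
  apply: le_measure; rewrite ?inE; last 2 first.
  + exact: measurableC.
  + move=> X /= lt GX; have [_ _ h] := HX X GX.
    by move: lt; rewrite ltNge (le_trans h e8).
  by apply: cells => X X' /= -> ->.
Unshelve. all: by end_near. Qed.
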